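(* Let $z\in\mathbb{C}$, $\tau\in\mathbb{H}$ and $\begin{pmatrix}a&b\\c&d\end{pmatrix}\in\mathrm{SL}_2(\mathbb{Z})$ with $c>0$. Then \begin{multline*} \psi(z;\tau) = \chi\begin{pmatrix}a&b\\c&d\end{pmatrix}^{-3} (c\tau+d)^{-\frac12} e^{-\frac{\pi icz^2}{c\tau+d}}\\ \times \left(\psi\left(\frac{z}{c\tau+d};\frac{a\tau+b}{c\tau+d}\right) - ie^{\frac{\pi i}{c(c\tau+d)}\left(\frac{\mathrm{Im}\left(\frac{z}{c\tau+d}\right)}{\mathrm{Im}\left(\frac{a\tau+b}{c\tau+d}\right)}\right)^2} \mathcal{E}_{\frac ac}\left(\frac{z}{c\tau+d};\frac{a\tau+b}{c\tau+d}\right)\right). \end{multline*}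
   Context: For $\tau=\tau_1+i\tau_2\in\mathbb{H}$ and $z=z_1+iz_2\in\mathbb{C}$ let $q=e^{2\pi i\tau}$, $\zeta=e^{2\pi iz}$ and define the false theta function $\psi(z;\tau):=i\sum_{m\in\mathbb{Z}+\frac12}\mathrm{sgn}\left(m+\frac{z_2}{\tau_2}\right)(-1)^{m-\frac12}q^{\frac{m^2}{2}}\zeta^m$. For $\frac ac\in\mathbb{Q}$ define the Eichler integral $$\mathcal{E}_{\frac ac}(z;\tau):=e^{-\frac{\pi iaz_2^2}{c\tau_2^2}}\int_{\frac ac}^{\tau+i\infty+\varepsilon}e^{\frac{\pi iz_2^2\mathfrak{z}}{\tau_2^2}}\frac{\sum_{m\in\mathbb{Z}+\frac12}(-1)^{m-\frac12}\left(m+\frac{z_2}{\tau_2}\right)e^{\pi i\left(m^2\mathfrak{z}+2m\left(z+(\mathfrak{z}-\tau)\frac{z_2}{\tau_2}\right)\right)}}{\sqrt{i(\mathfrak{z}-\tau)}}d\mathfrak{z},$$ where $\varepsilon>0$ is small, the path goes from $\frac ac$ to $i\infty$ ending along the vertical line $\tau+\varepsilon+i\mathbb{R}$ so as to avoid the branch cut $\tau+i[0,\infty)$ of $\sqrt{i(\mathfrak{z}-\tau)}$, and square roots and powers are principal branches. For $\begin{pmatrix}a&b\\c&d\end{pmatrix}\in\mathrm{SL}_2(\mathbb{Z})$, $\chi\begin{pmatrix}a&b\\c&d\end{pmatrix}:=\left(\frac{d}{|c|}\right)e^{\frac{\pi i}{12}((a+d)c-bd(c^2-1)-3c)}$ if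 $c$ is odd and $\left(\frac cd\right)e^{\frac{\pi i}{12}(ac(1-d^2)+d(b-c+3)-3)}$ if $c$ is even, with the Kronecker symbol. *)

(* Defs.v *)
From Stdlib Require Import Reals ZArith List.
From Coquelicot Require Import Coquelicot.
From mathcomp Require prime.

Open Scope R_scope.

Definition Cexp (z : C) : C := (exp (Re z) * cos (Im z), exp (Re z) * sin (Im z)).

(* Principal argument, in (-PI, PI] for z <> 0. *)
Definition Carg (z : C) : R :=
  if Rle_dec 0 (Im z) then acos (Re z / Cmod z) else - acos (Re z / Cmod z).

Definition Clog (z : C) : C := (ln (Cmod z), Carg z).

(* Principal power z ^ s for z <> 0. *)
Definition Cpower (z s : C) : C := Cexp (s * Clog z)%C.

Definition Csqrt (z : C) : C := Cpower z (1 / 2)%C.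

Definition CSeries (f : nat -> C) : C :=
  (Series (fun n => Re (f n)), Series (fun n => Im (f n))).

Definition ZSeries (f : Z -> C) : C :=
  (CSeries (fun n => f (Z.of_nat n)) + CSeries (fun n => f (- Z.of_nat n - 1)%Z))%C.

(* The summation index m in Z + 1/2 is m = n + 1/2 with n : Z, so that
   (-1)^(m - 1/2) = (-1)^n. *)
Definition half (n : Z) : R := IZR n + 1 / 2.

(* q^(m^2/2) is e^(pi i m^2 tau) and zeta^m is e^(2 pi i m z); these are not
   principal powers of the complex numbers q and zeta.
   [sign] satisfies sign 0 = 0. *)
Definition psi (z tau : C) : C :=
  (Ci * ZSeries (fun n =>
     let m := half n in
     sign (m + Im z / Im tau) * powerRZ (-1) n
     * Cexp (PI * Ci * (m ^ 2)%R * tau) * Cexp (2 * PI * Ci * m * z)))%C.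

Definition eichler_integrand (z tau w : C) : C :=
  let u := Im z / Im tau in
  (Cexp (PI * Ci * (u ^ 2)%R * w)
   * (ZSeries (fun n =>
        let m := half n in
        powerRZ (-1) n * (m + u)%R
        * Cexp (PI * Ci * ((m ^ 2)%R * w + 2 * m * (z + (w - tau) * u))))
      / Csqrt (Ci * (w - tau))))%C.

Definition C1_path (h : R -> C) : Prop :=
  exists dh : R -> C, forall t : R,
    is_derive (K := R_AbsRing) (V := C_R_NormedModule) h t (dh t)
    /\ continuous (U := C_R_NormedModule) dh t.

Definition piecewise_C1_path (g : R -> C) : Prop :=
  forall t : R, 0 < t ->
    exists (delta : R) (hl hr : R -> C),
      0 < delta /\ C1_path hl /\ C1_path hr
      /\ (forall s, t - delta < s <= t -> g s = hl s)
      /\ (forall s, t <= s < t + delta -> g s = hr s).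

(* Paths g : (0, +oo) -> H from the cusp x to tau + i oo + epsilon in the
   complement of the branch cut tau + i [0, +oo).  The cusp is approached inside
   a Stolz angle, as usual for integrals with an endpoint at a cusp. *)
Record eichler_path (x : R) (tau : C) (g : R -> C) : Prop := {
  eichler_path_C1 : piecewise_C1_path g;
  eichler_path_upper : forall t, 0 < t -> 0 < Im (g t);
  eichler_path_cut : forall t, 0 < t -> ~ (Re (g t) = Re tau /\ Im tau <= Im (g t));
  eichler_path_start : filterlim g (at_right 0) (locally (RtoC x));
  eichler_path_stolz : exists K : R,
    at_right 0 (fun t => Rabs (Re (g t) - x) <= K * Im (g t));
  eichler_path_vertical : exists epsilon : R, 0 < epsilon /\
    Rbar_locally p_infty (fun t => Re (g t) = Re tau + epsilon);
  eichler_path_end :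
    filterlim (fun t => Im (g t)) (Rbar_locally p_infty) (Rbar_locally p_infty)
}.

Definition path_derive (g : R -> C) (t : R) : C :=
  (Derive (fun s => Re (g s)) t, Derive (fun s => Im (g s)) t).

Definition path_integral (f : C -> C) (g : R -> C) : C :=
  RInt_gen (V := C_R_CompleteNormedModule)
    (fun t => (f (g t) * path_derive g t)%C) (at_right 0) (Rbar_locally p_infty).

Definition eichler (g : R -> C) (a c : Z) (z tau : C) : C :=
  (Cexp (- (PI * Ci * IZR a * (Im z ^ 2)%R / (IZR c * (Im tau ^ 2)%R)))
   * path_integral (eichler_integrand z tau) g)%C.

Definition legendre (a p : Z) : Z :=
  if (a mod p =? 0)%Z then 0%Z
  else if existsb (fun x => ((Z.of_nat x * Z.of_nat x - a) mod p =? 0)%Z)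
            (seq 0 (Z.to_nat p))
  then 1%Z else (-1)%Z.

Definition kronecker_prime (a p : Z) : Z :=
  if (p =? 2)%Z then
    if Z.even a then 0%Z
    else if ((a mod 8 =? 1)%Z || (a mod 8 =? 7)%Z)%bool then 1%Z else (-1)%Z
  else legendre a p.

Definition kronecker (a n : Z) : Z :=
  if (n =? 0)%Z then (if (Z.abs a =? 1)%Z then 1%Z else 0%Z)
  else
    let N := Z.abs_nat n in
    ((if ((n <? 0)%Z && (a <? 0)%Z)%bool then -1 else 1)
     * fold_right Z.mul 1
         (map (fun p => kronecker_prime a (Z.of_nat p) ^ Z.of_nat (prime.logn p N))
              (prime.primes N)))%Z.

Definition chi (a b c d : Z) : C :=
  if Z.odd c then
    (IZR (kronecker d (Z.abs c))
     * Cexp (PI * Ci / 12 * IZR ((a + d) * c - b * d * (c ^ 2 - 1) - 3 * c)))%C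
  else
    (IZR (kronecker c d)
     * Cexp (PI * Ci / 12 * IZR (a * c * (1 - d ^ 2) + d * (b - c + 3) - 3)))%C.

(* Main.v *)
Require Import Defs.
From Stdlib Require Import Reals ZArith Lra Lia Psatz FunctionalExtensionality Classical List.
From Coquelicot Require Import Coquelicot.
From HB Require Import structures.
From mathcomp Require ssreflect ssrbool ssrfun eqtype ssrnat seq div choice fintype bigop prime binomial ssralg poly zmodp zify.

(** Write z = u tau + v with u, v real, let x run through m + u for m in Z + 1/2, and let
    theta_{u,v}(w) = sum (-1)^(m-1/2) x e^(pi i x^2 w + 2 pi i m v).  The Eichler integrand is
    theta_{u,v}(w) / sqrt (i (w - tau)); in the coordinate y = sqrt (i (w - tau)) it becomes
    -2i theta_{u,v}(tau - i y^2) dy, whose primitive H(y) is a series of Gaussian primitives that is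
    holomorphic on the region Re (y^2) < Im tau, star-shaped about y = 0.  As y tends to infinity in
    a sector around i R_+, every Gaussian primitive tends to (i/2) sgn x, so -2i H tends to the false
    theta series: this is the value at the top end of the path.  At the cusp, the modular
    transformation of theta identifies H for (z', tau') with a multiple of H for (z, tau), and the
    Stolz condition says that the transformed y again tends to infinity in a sector.  The path
    integral is therefore a difference of two false theta series.

    The weight 3/2 transformation law is Poisson summation for the inversion; descending along
    (c, d) -> (|d|, -c sgn d) with d odd and |d| < c reduces the general multiplier to quadratic
    reciprocity for the Jacobi symbol. *)

(** Path independence comes from the explicit primitive alone: no contour is deformed and no Cauchy
    theorem enters. Both sides of the transformation law of H vanish at y = 0, so equality of their
    derivatives along rays from 0 suffices, and this is what star-shapedness is for. The weight 3/2
    factor of theta is absorbed by the derivative of the change of coordinate, which is why H itself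
    transforms by a constant. The coordinate y also carries the branch information. A path ending on
    the right of the cut has i (w - tau) just above the negative reals, so its principal root lies
    near i R_+ and not near - i R_+; this fixes the sign of (i/2) sgn x. The theorem involves only
    the cube of chi. Cubing turns 24th roots of unity into eighth roots, so each step of the descent
    is a congruence modulo 8 that a finite enumeration decides. The descent runs through odd c,
    where the symbol (d/c) has an odd positive bottom; even c is reached from it by one
    inversion. *)

Open Scope R_scope.

(** * Quadratic reciprocity *)

Module Reciprocity.
Import ssreflect ssrbool ssrfun eqtype ssrnat seq div choice fintype bigop prime binomial ssralg poly zmodp zify.
Import GRing.Theory.
Local Open Scope nat_scope.

(** * Quadratic residues modulo an odd prime: Euler, Gauss, Eisenstein *)

Definition quadres (p a : nat) : bool := has (fun r => r * r == a %[mod p]) (iota 0 p).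

Section OddPrime.
Variable p : nat.
Hypotheses (pp : prime p) (po : odd p).
Let h := p./2.
Local Notation F := 'F_p.

Let p_eq : p = h.*2.+1.
Proof. by rewrite /h -[LHS]odd_double_half po. Qed.

Let h_gt0 : 0 < h.
Proof. by case: h p_eq (prime_gt1 pp) => // ->. Qed.

Let h_lt : h < p.
Proof. by rewrite [X in _ < X]p_eq ltnS -addnn leq_addr. Qed.

Lemma Fp_nat_eq0 n : ((n%:R : F)%R == 0%R) = (p %| n).
Proof. by rewrite -(dvdn_pcharf (pchar_Fp pp)). Qed.

Lemma Fp_nat_eq m n : ((m%:R : F) == n%:R)%R = (m == n %[mod p]).
Proof.
apply/eqP/eqP => E.
  by have := congr1 (@nat_of_ord _) E; rewrite !val_Fp_nat.
by rewrite -(Fp_nat_mod pp m) E Fp_nat_mod.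
Qed.

Lemma Fp_fermat (x : F) : (x != 0 -> x ^+ h.*2 = 1)%R.
Proof.
move=> nz; apply: (mulfI nz); rewrite -exprS -p_eq mulr1.
rewrite -[x]natr_Zp -natrX; apply/eqP; rewrite Fp_nat_eq.
by rewrite fermat_little.
Qed.

Lemma Fp_neg1 : (-1 != 1 :> F)%R.
Proof.
rewrite eq_sym -subr_eq0 opprK -(natrD _ 1 1) Fp_nat_eq0.
by apply/negP => /dvdn_leq; move: p_eq h_gt0; case: h => // k -> _ /(_ isT).
Qed.

Lemma Fp_sign_inj (b c : bool) : ((-1) ^+ b = (-1) ^+ c :> F)%R -> b = c.
Proof.
by case: b; case: c => // /eqP; rewrite ?expr1 ?expr0 1?[(1 == _)%R]eq_sym (negPf Fp_neg1).
Qed.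

Lemma half_nonzero r : 0 < r <= h -> ~~ (p %| r).
Proof. by case/andP=> r0 rh; rewrite gtnNdvd // (leq_ltn_trans rh). Qed.

(** For a nonresidue, a^h is a square root of 1; were it 1, then a and the h squares of 1, ..., h
    would be h + 1 distinct roots of X^h - 1. *)
Lemma euler_criterion a : ~~ (p %| a) -> ((a%:R : F) ^+ h = (-1) ^+ (~~ quadres p a))%R.
Proof.
move=> na; have nz : (a%:R != 0 :> F)%R by rewrite Fp_nat_eq0.
case: (boolP (quadres p a)) => [/hasP[r _ /eqP E]|nres].
  have Er : (a%:R = r%:R * r%:R :> F)%R.
    by apply/eqP; rewrite -natrM Fp_nat_eq E.
  have rnz : (r%:R != 0 :> F)%R by apply: contraNneq nz => r0; rewrite Er r0 mul0r.
  by rewrite Er -expr2 -exprM mul2n Fp_fermat.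
have : (((a%:R : F) ^+ h) ^+ 2 == 1)%R by rewrite -exprM muln2 Fp_fermat.
rewrite sqrf_eq1 => /orP[/eqP E|/eqP-> //]; exfalso.
pose P : {poly F} := ('X^h - 1)%R.
have sP : size P = h.+1 by rewrite /P size_XnsubC.
have P0 : P != 0%R by rewrite -size_poly_eq0 sP.
pose s := [seq ((r%:R : F) ^+ 2)%R | r <- iota 1 h].
have rs : all (root P) ((a%:R)%R :: s).
  apply/allP=> x; rewrite inE => /orP[/eqP->|/mapP[r]].
    by rewrite rootE !hornerE E subrr.
  rewrite mem_iota add1n ltnS => rh ->.
  by rewrite rootE !hornerE -exprM mul2n Fp_fermat ?subrr // Fp_nat_eq0 half_nonzero.
have us : uniq ((a%:R : F)%R :: s).
  rewrite cons_uniq; apply/andP; split.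
    apply/negP=> /mapP[r]; rewrite mem_iota add1n ltnS => /andP[r0 rh] Ea.
    move/negP: nres; apply; apply/hasP; exists r; first by rewrite mem_iota (leq_ltn_trans rh).
    by rewrite -Fp_nat_eq natrM -expr2 Ea.
  rewrite map_inj_in_uniq ?iota_uniq // => r1 r2.
  rewrite !mem_iota !add1n !ltnS => /andP[r10 r1h] /andP[r20 r2h] /eqP.
  rewrite eqf_sqr => /orP[].
    rewrite Fp_nat_eq !modn_small; [by move/eqP| exact: leq_ltn_trans h_lt | exact: leq_ltn_trans h_lt].
  rewrite -addr_eq0 -natrD Fp_nat_eq0 gtnNdvd //; first by rewrite addn_gt0 r10.
  by rewrite [X in _ < X]p_eq ltnS -addnn leq_add.
by have := max_poly_roots P0 rs us; rewrite sP /= size_map size_iota ltnn.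
Qed.

Section GaussLemma.
Variable a : nat.
Hypothesis na : ~~ (p %| a).
(** [t r] is the absolute value of the least absolute residue of a r; the test [h < s r] records its
    sign. *)
Let s r := (a * r) %% p.
Let t r := if h < s r then p - s r else s r.

Let s_lt r : s r < p. Proof. by rewrite ltn_mod prime_gt0. Qed.

Let t_cast r : ((a * r)%:R = (-1) ^+ (h < s r) * (t r)%:R :> F)%R.
Proof.
have -> : ((a * r)%:R = (s r)%:R :> F)%R by rewrite /s Fp_nat_mod.
rewrite /t; case: ifP => _; last by rewrite mul1r.
by rewrite natrB ?(ltnW (s_lt _)) // pchar_Fp_0 // sub0r mulN1r opprK.
Qed.

Let t_range r : 0 < r <= h -> 0 < t r <= h.
Proof.
move=> rh; have s0 : 0 < s r.
  by rewrite lt0n -/(dvdn p (a * r)) Euclid_dvdM // negb_or na half_nonzero.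
rewrite /t; case: (ltnP h (s r)) => hs; last by rewrite s0.
rewrite subn_gt0 s_lt /= leq_subLR [X in X <= _]p_eq -addnn -addSn leq_add2r //.
Qed.

(** Equal values of t mean a r1 = a r2 up to sign, hence r1 = r2 or r1 + r2 = 0 modulo p; the latter
    is excluded by 0 < r1 + r2 < p. An injective self-map of a finite range is a permutation. *)
Let t_perm : perm_eq (map t (iota 1 h)) (iota 1 h).
Proof.
have tin r : r \in iota 1 h -> t r \in iota 1 h.
  by rewrite !mem_iota !add1n !ltnS; apply: t_range.
have ut : uniq (map t (iota 1 h)).
  rewrite map_inj_in_uniq ?iota_uniq // => r1 r2.
  rewrite !mem_iota !add1n !ltnS => r1h r2h E.
  have E2 : ((a * r1)%:R ^+ 2 = (a * r2)%:R ^+ 2 :> F)%R.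
    by rewrite !t_cast E !exprMn -!exprM !(mulnC _ 2) !exprM sqrrN !expr1n.
  move/eqP: E2; rewrite !natrM !exprMn (inj_eq (mulfI _)); last by rewrite expf_neq0 // Fp_nat_eq0.
  case/andP: r1h => r10 r1h; case/andP: r2h => r20 r2h.
  rewrite eqf_sqr => /orP[].
    rewrite Fp_nat_eq !modn_small; [by move/eqP| exact: leq_ltn_trans h_lt | exact: leq_ltn_trans h_lt].
  rewrite -addr_eq0 -natrD Fp_nat_eq0 gtnNdvd //; first by rewrite addn_gt0 r10.
  by rewrite [X in _ < X]p_eq ltnS -addnn leq_add.
apply: uniq_perm => //; first exact: iota_uniq.
have sub : {subset map t (iota 1 h) <= iota 1 h} by move=> x /mapP[r rin ->]; apply: tin.
by case: (uniq_min_size ut sub) => //; rewrite size_map.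
Qed.

(** Multiply by h!: the product of the a r is the product of the signs times the product of the
    [t r], which is h! again by [t_perm]. *)
Lemma gauss_lemma : ((a%:R : F) ^+ h = (-1) ^+ (\sum_(r <- iota 1 h) (h < s r)))%R.
Proof.
have nz : (\prod_(r <- iota 1 h) (r%:R : F) != 0)%R.
  rewrite prodf_seq_neq0; apply/allP=> r; rewrite mem_iota add1n ltnS => rh.
  by rewrite Fp_nat_eq0 half_nonzero.
apply: (mulIf nz).
have Et : (\prod_(r <- iota 1 h) (r%:R : F) = \prod_(r <- iota 1 h) (t r)%:R)%R.
  by rewrite -(big_map t predT (fun x => x%:R)%R); apply/esym/perm_big.
rewrite [in RHS]Et.
have Ea l : ((a%:R : F) ^+ size l * \prod_(r <- l) (r%:R : F) = \prod_(r <- l) (a * r)%:R)%R.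
  elim: l => [|r l IH]; first by rewrite !big_nil mulr1.
  by rewrite !big_cons exprS natrM -IH mulrACA.
rewrite -{1}(size_iota 1 h) Ea (eq_bigr (fun r => (-1) ^+ (h < s r) * (t r)%:R)%R); last first.
  by move=> r _; rewrite t_cast.
rewrite big_split /=; congr (_ * _)%R.
elim: (iota 1 h) => [|r l IH]; first by rewrite !big_nil.
by rewrite !big_cons exprD IH.
Qed.

(** Sum the divisions a r = p floor(a r / p) + s r and reduce modulo 2: p odd gives s r = t r +
    [h < s r], a odd makes the left side the sum of the r, and that equals the sum of the t r. *)
Lemma eisenstein_parity : odd a ->
  odd (\sum_(r <- iota 1 h) (h < s r)) = odd (\sum_(r <- iota 1 h) (a * r) %/ p).
Proof.
move=> oa.
have Et : \sum_(r <- iota 1 h) t r = \sum_(r <- iota 1 h) r.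
  by rewrite -(big_map t predT id); apply: perm_big.
have E1 : odd (\sum_(r <- iota 1 h) a * r) = odd (\sum_(r <- iota 1 h) r).
  by rewrite -big_distrr oddM oa.
have E2 : \sum_(r <- iota 1 h) a * r = (\sum_(r <- iota 1 h) (a * r) %/ p) * p + \sum_(r <- iota 1 h) s r.
  by rewrite big_distrl -big_split /=; apply: eq_bigr => r _; rewrite /s -divn_eq.
have E3 : odd (\sum_(r <- iota 1 h) s r) = odd (\sum_(r <- iota 1 h) t r) (+) odd (\sum_(r <- iota 1 h) (h < s r)).
  have key r : odd (s r) = odd (t r + (h < s r)).
    rewrite oddD /t; case: ifP => _ /=; last by rewrite addbF.
    by rewrite oddB ?(ltnW (s_lt _)) // po; case: (odd (s r)).
  rewrite -oddD -big_split /=.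
  elim: (iota 1 h) => [|r l IH]; first by rewrite !big_nil.
  by rewrite !big_cons !oddD IH key oddD.
move: E1; rewrite E2 oddD oddM po andbT E3 Et.
by case: (odd (\sum_(r <- iota 1 h) r)); case: (odd (\sum_(r <- iota 1 h) _ %/ p)); case: (odd (\sum_(r <- iota 1 h) (h < s r))).
Qed.
End GaussLemma.

Lemma quadres_eisenstein a : ~~ (p %| a) -> odd a ->
  ~~ quadres p a = odd (\sum_(r <- iota 1 h) (a * r) %/ p).
Proof.
move=> na oa; have := euler_criterion a na; rewrite (gauss_lemma a na) -signr_odd (eisenstein_parity a na oa).
by move/Fp_sign_inj => ->.
Qed.

Lemma quadres_neg1 : ~~ quadres p p.-1 = odd h.
Proof.
have p1 : p.-1.+1 = p by rewrite prednK // prime_gt0.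
have na : ~~ (p %| p.-1).
  rewrite gtnNdvd //; last by rewrite p1. by rewrite p_eq /= double_gt0.
have := euler_criterion _ na.
have -> : ((p.-1)%:R = -1 :> F)%R.
  by apply/eqP; rewrite -subr_eq0 opprK -(natrD _ _ 1) addn1 p1 Fp_nat_eq0.
by move=> E; apply/esym/Fp_sign_inj; rewrite signr_odd.
Qed.

Lemma quadres_mul a b : ~~ (p %| a) -> ~~ (p %| b) ->
  ~~ quadres p (a * b) = (~~ quadres p a) (+) (~~ quadres p b).
Proof.
move=> na nb; have nab : ~~ (p %| a * b) by rewrite Euclid_dvdM // negb_or na.
have := euler_criterion _ nab; rewrite natrM exprMn !euler_criterion // -signr_addb.
by move/Fp_sign_inj => ->.
Qed.
End OddPrime.

Lemma count_leq m k : \sum_(s <- iota 1 k) (s <= m) = minn m k.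
Proof.
elim: k => [|k IH]; first by rewrite big_nil minn0.
rewrite -(addn1 k) iotaD big_cat IH add1n /= big_cons big_nil addn0 addn1.
by case: (ltnP k m) => km; lia.
Qed.

(** The two sums count the lattice points of a p/2 by q/2 rectangle on either side of its diagonal;
    distinct primes leave no point on the diagonal. *)
Lemma lattice_count p q : prime p -> prime q -> odd p -> odd q -> p != q ->
  \sum_(r <- iota 1 p./2) (q * r) %/ p + \sum_(s <- iota 1 q./2) (p * s) %/ q = p./2 * q./2.
Proof.
have half_lt x y r : odd x -> odd y -> r <= x./2 -> y * r < x * y./2.+1.
  move=> ox oy rx; have := odd_double_half x; have := odd_double_half y; rewrite ox oy.
  by nia.
have H x y : prime x -> odd x -> odd y -> \sum_(r <- iota 1 x./2) (y * r) %/ x =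
  \sum_(r <- iota 1 x./2) \sum_(s <- iota 1 y./2) (s * x <= y * r).
  move=> px ox oy; apply: eq_big_seq => r.
  rewrite mem_iota add1n ltnS => /andP[_ rx].
  under eq_bigr do rewrite -leq_divRL ?prime_gt0 //.
  rewrite count_leq; apply/esym/minn_idPl.
  by rewrite -ltnS ltn_divLR ?prime_gt0 // [X in _ < X]mulnC half_lt.
move=> pp pq op oq npq; rewrite (H p q) // (H q p) //.
rewrite [X in _ + X]exchange_big -big_split /= -[p./2 in RHS](size_iota 1) -sum1_size big_distrl /=.
apply: eq_big_seq => r.
rewrite mem_iota add1n ltnS => /andP[r0 rp].
rewrite -big_split /= mul1n -[q./2 in RHS](size_iota 1) -sum1_size.
apply: eq_big_seq => s.
rewrite mem_iota add1n ltnS => /andP[s0 sq].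
have ne : s * p != q * r.
  apply/eqP=> E; have : p %| q * r by rewrite -E dvdn_mull.
  rewrite Euclid_dvdM // dvdn_prime2 // (negPf npq) /= => /dvdn_leq; rewrite r0 => /(_ isT).
  by have := odd_double_half p; rewrite op; lia.
rewrite (mulnC r q) (mulnC p s). by case: ltngtP ne.
Qed.

Lemma quadres_reciprocity p q : prime p -> prime q -> odd p -> odd q -> p != q ->
  (~~ quadres p q) (+) (~~ quadres q p) = odd p./2 && odd q./2.
Proof.
move=> pp pq op oq npq.
have nqp : ~~ (q %| p) by rewrite dvdn_prime2 // eq_sym.
have npq' : ~~ (p %| q) by rewrite dvdn_prime2.
by rewrite !quadres_eisenstein // -oddD lattice_count // oddM.
Qed.

(** * From residues of natural numbers to the Kronecker symbol of integers *)

Definition sgn (b : bool) : Z := if b then (-1)%Z else 1%Z.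

Lemma sgn_addb b c : sgn (b (+) c) = (sgn b * sgn c)%Z.
Proof. by case: b; case: c. Qed.

Lemma Zmod_sub0 (u v p : Z) : (0 < p)%Z -> ((u - v) mod p = 0 <-> u mod p = v mod p)%Z.
Proof.
move=> p0; split=> E.
  have [k Ek] : (p | u - v)%Z by apply/Z.mod_divide => //; lia.
  by rewrite (_ : u = v + k * p)%Z ?Z_mod_plus_full //; lia.
by rewrite Zminus_mod E Z.sub_diag.
Qed.

Lemma of_nat_mod m d : 0 < d -> Z.of_nat (m %% d) = (Z.of_nat m mod Z.of_nat d)%Z.
Proof.
move=> d0; apply: (Z.mod_unique_pos _ _ (Z.of_nat (m %/ d))).
  by have := ltn_pmod m d0; lia.
by rewrite {1}(divn_eq m d); lia.
Qed.

Lemma eqmod_Z m n d : 0 < d -> (m == n %[mod d]) <-> (Z.of_nat m mod Z.of_nat d = Z.of_nat n mod Z.of_nat d)%Z.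
Proof.
move=> d0; rewrite -!of_nat_mod //; split; first by move/eqP->.
by move/Nat2Z.inj/eqP.
Qed.

Definition zres (p : nat) (a : Z) : nat := Z.to_nat (a mod Z.of_nat p).

Lemma zresK p a : 0 < p -> Z.of_nat (zres p a) = (a mod Z.of_nat p)%Z.
Proof. by move=> p0; rewrite Z2Nat.id //; have := Z.mod_pos_bound a (Z.of_nat p); lia. Qed.

Lemma quadres_mod p a b : a == b %[mod p] -> quadres p a = quadres p b.
Proof. by move/eqP=> E; apply: eq_has => r; rewrite E. Qed.

Lemma legendreE p a : prime p ->
  legendre a (Z.of_nat p) = if p %| zres p a then 0%Z else sgn (~~ quadres p (zres p a)).
Proof.
move=> pp; have p0 := prime_gt0 pp; rewrite /legendre.
have -> : (a mod Z.of_nat p =? 0)%Z = (p %| zres p a).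
  apply/Z.eqb_spec/idP => [E|].
    by rewrite /zres E.
  rewrite -zresK //; have lt : zres p a < p by have := Z.mod_pos_bound a (Z.of_nat p); rewrite -zresK //; lia.
  by case: (posnP (zres p a)) => [->//|z0]; rewrite gtnNdvd.
case: ifP => // _; rewrite Nat2Z.id.
have -> : List.existsb (fun x => ((Z.of_nat x * Z.of_nat x - a) mod Z.of_nat p =? 0)%Z) (List.seq 0 p) = quadres p (zres p a).
  have key x : ((Z.of_nat x * Z.of_nat x - a) mod Z.of_nat p = 0)%Z <-> (x * x == zres p a %[mod p]).
    rewrite Zmod_sub0; last lia.
    rewrite eqmod_Z // zresK // Zmod_mod Nat2Z.inj_mul //.
  apply/idP/idP.
    case/existsb_exists => x [/in_seq xin /Z.eqb_spec E]; apply/hasP; exists x; first by rewrite mem_iota; lia.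
    exact/key.
  case/hasP=> x; rewrite mem_iota => xin /key E; apply/existsb_exists; exists x; split; last exact/Z.eqb_spec.
  by apply/in_seq; lia.
by case: quadres.
Qed.

Lemma legendre_mod p a b : prime p -> (a mod Z.of_nat p = b mod Z.of_nat p)%Z ->
  legendre a (Z.of_nat p) = legendre b (Z.of_nat p).
Proof. by move=> pp E; rewrite !legendreE // /zres E. Qed.

Lemma legendre_mul p a b : prime p -> odd p ->
  legendre (a * b) (Z.of_nat p) = (legendre a (Z.of_nat p) * legendre b (Z.of_nat p))%Z.
Proof.
move=> pp po; have p0 := prime_gt0 pp.
have E : zres p (a * b) == zres p a * zres p b %[mod p].
  by apply/eqmod_Z; rewrite // Nat2Z.inj_mul !zresK // Zmod_mod Zmult_mod.
rewrite !legendreE // (quadres_mod _ _ _ E).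
have -> : (p %| zres p (a * b)) = (p %| zres p a) || (p %| zres p b).
  by rewrite -Euclid_dvdM // /dvdn (eqP E).
case: (boolP (p %| zres p a)) => //= na; case: (boolP (p %| zres p b)) => nb; first by rewrite Z.mul_0_r.
by rewrite quadres_mul // sgn_addb.
Qed.

Lemma legendre_neg1 p : prime p -> odd p -> legendre (-1) (Z.of_nat p) = sgn (odd p./2).
Proof.
move=> pp po; have p1 := prime_gt1 pp.
have E : zres p (-1) = p.-1.
  apply: Nat2Z.inj; rewrite zresK; last lia.
  by apply/esym/(Z.mod_unique_pos _ _ (-1)); lia.
rewrite legendreE // E quadres_neg1 //; case: ifP => // /dvdn_leq; lia.
Qed.

Lemma legendre_nat p a : prime p -> ~~ (p %| a) -> legendre (Z.of_nat a) (Z.of_nat p) = sgn (~~ quadres p a).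
Proof.
move=> pp na; have p0 := prime_gt0 pp.
have E : zres p (Z.of_nat a) == a %[mod p] by apply/eqmod_Z; rewrite // zresK // Zmod_mod.
by rewrite legendreE // (quadres_mod _ _ _ E) /dvdn (eqP E) -/(dvdn p a) (negPf na).
Qed.

(** Makes the big-operator lemmas available for products in Z. *)
HB.instance Definition _ := Monoid.isComLaw.Build Z 1%Z Z.mul Z.mul_assoc Z.mul_comm Z.mul_1_l.

(** A common index range for different bottoms turns multiplicativity in the bottom into additivity
    of [logn]. Indices that are not prime factors of N have exponent 0. *)
Lemma kronecker_big a N b : odd N -> N <= b ->
  kronecker a (Z.of_nat N) = \big[Z.mul/1%Z]_(p <- iota 0 b.+1) (legendre a (Z.of_nat p) ^ Z.of_nat (logn p N))%Z.
Proof.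
move=> oN Nb; have N0 : 0 < N by case: N oN {Nb}.
have -> : kronecker a (Z.of_nat N)
  = \big[Z.mul/1%Z]_(p <- primes N) (kronecker_prime a (Z.of_nat p) ^ Z.of_nat (logn p N))%Z.
  rewrite /kronecker; case: Z.eqb_spec => [|_]; first by lia.
  case: Z.ltb_spec => [|_]; first by lia.
  rewrite Zabs2Nat.id andFb Z.mul_1_l; elim: (primes N) => [|p s IH] /=; first by rewrite big_nil.
  by rewrite big_cons IH.
rewrite (eq_big_seq (fun p => legendre a (Z.of_nat p) ^ Z.of_nat (logn p N))%Z); last first.
  move=> p; rewrite mem_primes => /and3P[pp _ pN]; congr (_ ^ _)%Z; rewrite /kronecker_prime.
  case: Z.eqb_spec => // E2; have E : p = 2 by lia.
  by move: pN oN; rewrite E dvdn2 => /negPf->.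
set l := iota 0 b.+1; rewrite [RHS](bigID (fun p => p \in primes N)) /= [X in _ = (_ * X)%Z]big1_seq ?Z.mul_1_r; last first.
  move=> p /andP[np _]; rewrite (_ : logn p N = 0) //.
  by move: np; rewrite -logn_gt0 lt0n negbK => /eqP.
rewrite -[RHS]big_filter; apply: perm_big; apply: uniq_perm; first exact: primes_uniq.
  by rewrite filter_uniq // iota_uniq.
move=> p; rewrite mem_filter mem_iota /= add0n; case: (boolP (p \in primes N)) => //=.
by rewrite mem_primes => /and3P[_ _ /dvdn_leq]; lia.
Qed.

Lemma kronecker_mul_bottom a M N : odd M -> odd N ->
  kronecker a (Z.of_nat (M * N)) = (kronecker a (Z.of_nat M) * kronecker a (Z.of_nat N))%Z.
Proof.
move=> oM oN; have M0 : 0 < M by case: M oM. have N0 : 0 < N by case: N oN.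
rewrite (kronecker_big a (M * N) (M * N)) ?oddM ?oM //.
rewrite (kronecker_big a M (M * N)) // ?leq_pmulr // (kronecker_big a N (M * N)) // ?leq_pmull //.
rewrite -big_split /=; apply: eq_bigr => p _; rewrite lognM // Nat2Z.inj_add Z.pow_add_r //; lia.
Qed.

Lemma kronecker_1 a : kronecker a 1 = 1%Z.
Proof. by []. Qed.

Lemma kronecker_prime_bottom a p : prime p -> odd p -> kronecker a (Z.of_nat p) = legendre a (Z.of_nat p).
Proof.
move=> pp po; rewrite (kronecker_big a p p) // (big_rem p); last by rewrite mem_iota leq0n add0n ltnSn.
rewrite logn_prime // eqxx Z.pow_1_r big1_seq; first exact: Z.mul_1_r.
move=> q /andP[_].
rewrite (mem_rem_uniq _ (iota_uniq 0 p.+1)) inE => /andP[qp _].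
by rewrite logn_prime // (negPf qp).
Qed.

Lemma odd_prime_ind (P : nat -> Prop) : P 1 ->
  (forall p M, prime p -> odd p -> odd M -> P M -> P (p * M)) -> forall N, odd N -> P N.
Proof.
move=> P1 PM N; have [n] := ubnP N; elim: n N => // n IH N Nn oN.
have [->//|N1] := eqVneq N 1; have N0 : 0 < N by case: N oN {Nn N1}.
have N2 : 1 < N by lia.
have pp := pdiv_prime N2; have EN : N = pdiv N * (N %/ pdiv N) by rewrite mulnC divnK // pdiv_dvd.
have := oN; rewrite {1}EN oddM => /andP[op oM].
rewrite EN; apply: PM => //; apply: IH => //; rewrite ltnS in Nn; apply: leq_trans _ Nn.
by rewrite ltn_Pdiv // prime_gt1.
Qed.

Lemma kronecker_mod a b N : odd N -> (a mod Z.of_nat N = b mod Z.of_nat N)%Z ->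
  kronecker a (Z.of_nat N) = kronecker b (Z.of_nat N).
Proof.
move: N; apply: odd_prime_ind => // p M pp po oM IH E.
have M0 : 0 < M by case: M oM {IH E}. have p0 := prime_gt0 pp.
have [k Ek] : (Z.of_nat (p * M) | a - b)%Z.
  apply/Z.mod_divide; first by nia. by apply/Zmod_sub0 => //; nia.
rewrite !kronecker_mul_bottom // !(kronecker_prime_bottom _ p) // IH; last first.
  by apply/Zmod_sub0; [lia|]; apply/Z.mod_divide; [lia|]; exists (k * Z.of_nat p)%Z; rewrite Ek; lia.
rewrite (legendre_mod p a b) //.
by apply/Zmod_sub0; [lia|]; apply/Z.mod_divide; [lia|]; exists (k * Z.of_nat M)%Z; rewrite Ek; lia.
Qed.

Lemma kronecker_mul_top a b N : odd N ->
  kronecker (a * b) (Z.of_nat N) = (kronecker a (Z.of_nat N) * kronecker b (Z.of_nat N))%Z.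
Proof.
move: N; apply: odd_prime_ind => // p M pp po oM IH.
by rewrite !kronecker_mul_bottom // !(kronecker_prime_bottom _ p) // IH legendre_mul //; lia.
Qed.

(** The parity of (n - 1) / 2 is the nontrivial character modulo 4 in additive form. *)
Lemma odd_half_mul m n : odd m -> odd n -> odd (m * n)./2 = odd m./2 (+) odd n./2.
Proof.
move=> om on; have Em := odd_double_half m; have En := odd_double_half n; rewrite om on in Em En.
have -> : (m * n)./2 = m * n./2 + m./2 by nia.
by rewrite oddD oddM om addbC.
Qed.

Lemma kronecker_neg1 N : odd N -> kronecker (-1) (Z.of_nat N) = sgn (odd N./2).
Proof.
move: N; apply: odd_prime_ind => // p M pp po oM IH.
by rewrite kronecker_mul_bottom // (kronecker_prime_bottom _ p) // IH legendre_neg1 // odd_half_mul // sgn_addb.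
Qed.

Lemma kronecker_1_top N : odd N -> kronecker 1 (Z.of_nat N) = 1%Z.
Proof.
move=> oN; have := kronecker_neg1 N oN; rewrite (_ : 1 = (-1) * (-1))%Z // kronecker_mul_top // => ->.
by case: (odd _).
Qed.

(** Both sides are multiplicative in each argument: induction on the prime factors of K for a prime
    top, then on those of M, reduces to [quadres_reciprocity]. *)
Lemma kronecker_reciprocity M N : odd M -> odd N -> coprime M N ->
  (kronecker (Z.of_nat M) (Z.of_nat N) * kronecker (Z.of_nat N) (Z.of_nat M))%Z = sgn (odd M./2 && odd N./2).
Proof.
have prime_case p : prime p -> odd p -> forall K, odd K -> coprime p K ->
   (kronecker (Z.of_nat p) (Z.of_nat K) * kronecker (Z.of_nat K) (Z.of_nat p))%Z = sgn (odd p./2 && odd K./2).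
  move=> pp po; apply: odd_prime_ind => [_|q K pq oq oK IH].
    by rewrite kronecker_1 kronecker_1_top // andbF.
  rewrite coprimeMr => /andP[cpq cpK].
  have npq : p != q by apply: contraTneq cpq => ->; rewrite prime_coprime // dvdnn.
  rewrite kronecker_mul_bottom // Nat2Z.inj_mul kronecker_mul_top // odd_half_mul // andb_addr sgn_addb -IH //.
  rewrite -(quadres_reciprocity p q) // sgn_addb (kronecker_prime_bottom _ p) // (kronecker_prime_bottom _ q) // !legendre_nat //; first by lia.
    by rewrite dvdn_prime2.
  by rewrite dvdn_prime2 // eq_sym.
move=> oM oN; move: M oM; apply: odd_prime_ind => [_|p M pp po oM IH].
  by rewrite kronecker_1 kronecker_1_top.
rewrite coprimeMl => /andP[cp cM].
rewrite kronecker_mul_bottom // Nat2Z.inj_mul kronecker_mul_top // odd_half_mul // andb_addl sgn_addb -IH // -prime_case //.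
by lia.
Qed.

Lemma odd_half_mod4 N : odd N -> odd N./2 = (Z.of_nat N mod 4 =? 3)%Z.
Proof.
move=> oN; have EN := odd_double_half N; have EM := odd_double_half N./2; rewrite oN in EN.
have -> : Z.of_nat N = ((if odd N./2 then 3 else 1) + Z.of_nat N./2./2 * 4)%Z.
  by move: EM; case: (odd N./2); lia.
by rewrite Z_mod_plus_full; case: (odd N./2).
Qed.

Lemma Zodd_to_nat (n : Z) : (0 < n)%Z -> Z.odd n -> exists2 N, n = Z.of_nat N & odd N.
Proof.
move=> n0 on; exists (Z.to_nat n); first by lia.
by move: on; rewrite Zodd_even_bool; have := odd_double_half (Z.to_nat n); case: odd => // E; rewrite (_ : n = 2 * Z.of_nat (Z.to_nat n)./2)%Z ?Z.even_mul //; lia.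
Qed.

Lemma coprime_of_Zgcd M N : Z.gcd (Z.of_nat M) (Z.of_nat N) = 1%Z -> coprime M N.
Proof.
move=> E; have dv k : gcdn M N %| k -> (Z.of_nat (gcdn M N) | Z.of_nat k)%Z.
  by case/dvdnP=> x ->; exists (Z.of_nat x); lia.
have [x] : (Z.of_nat (gcdn M N) | Z.gcd (Z.of_nat M) (Z.of_nat N))%Z.
  by apply: Z.gcd_greatest; apply: dv; rewrite ?dvdn_gcdl ?dvdn_gcdr.
rewrite E Z.mul_comm => /esym/Z.mul_eq_1 H; rewrite /coprime; apply/eqP; lia.
Qed.

End Reciprocity.

(** * Reciprocity restated for positive odd integers *)

Lemma kronecker_mod_top (a b n : Z) : (0 < n)%Z -> Z.odd n = true -> (a mod n = b mod n)%Z ->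
  kronecker a n = kronecker b n.
Proof.
  intros n0 on. destruct (Reciprocity.Zodd_to_nat n n0 on) as [N -> oN]. now apply Reciprocity.kronecker_mod.
Qed.

Lemma kronecker_opp_top (a n : Z) : (0 < n)%Z -> Z.odd n = true ->
  kronecker (- a) n = ((if (n mod 4 =? 3)%Z then -1 else 1) * kronecker a n)%Z.
Proof.
  intros n0 on. destruct (Reciprocity.Zodd_to_nat n n0 on) as [N -> oN].
  rewrite <- (Reciprocity.odd_half_mod4 N oN).
  replace (- a)%Z with (-1 * a)%Z by lia.
  rewrite (Reciprocity.kronecker_mul_top _ _ N oN), (Reciprocity.kronecker_neg1 N oN). reflexivity.
Qed.

Lemma kronecker_reciprocity (m n : Z) : (0 < m)%Z -> (0 < n)%Z -> Z.odd m = true -> Z.odd n = true ->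
  Z.gcd m n = 1%Z ->
  (kronecker m n * kronecker n m)%Z = (if ((m mod 4 =? 3)%Z && (n mod 4 =? 3)%Z)%bool then -1 else 1)%Z.
Proof.
  intros m0 n0 om on g.
  destruct (Reciprocity.Zodd_to_nat m m0 om) as [M -> oM].
  destruct (Reciprocity.Zodd_to_nat n n0 on) as [N -> oN].
  rewrite (Reciprocity.kronecker_reciprocity M N oM oN), !Reciprocity.odd_half_mod4 by auto using Reciprocity.coprime_of_Zgcd.
  reflexivity.
Qed.

(** * Calculus of complex functions of a real variable *)

(* [refine] unifies through canonical structures where [apply] fails. *)
Tactic Notation "rap" uconstr(t) :=
  first [ refine t | refine (t _) | refine (t _ _) | refine (t _ _ _) | refine (t _ _ _ _)
        | refine (t _ _ _ _ _) | refine (t _ _ _ _ _ _) | refine (t _ _ _ _ _ _ _)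
        | refine (t _ _ _ _ _ _ _ _) | refine (t _ _ _ _ _ _ _ _ _) | refine (t _ _ _ _ _ _ _ _ _ _) ].

Ltac toR := match goal with |- @eq _ ?a ?b => change (@eq R a b) end.

Lemma C_ext (a b : C) : Re a = Re b -> Im a = Im b -> a = b.
Proof. destruct a, b; simpl; congruence. Qed.

Lemma Re_plus (a b : C) : Re (a + b)%C = Re a + Re b. Proof. reflexivity. Qed.
Lemma Im_plus (a b : C) : Im (a + b)%C = Im a + Im b. Proof. reflexivity. Qed.
Lemma Re_opp (a : C) : Re (- a)%C = - Re a. Proof. reflexivity. Qed.
Lemma Im_opp (a : C) : Im (- a)%C = - Im a. Proof. reflexivity. Qed.
Lemma Re_minus (a b : C) : Re (a - b)%C = Re a - Re b. Proof. reflexivity. Qed.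
Lemma Im_minus (a b : C) : Im (a - b)%C = Im a - Im b. Proof. reflexivity. Qed.
Lemma Re_mult (a b : C) : Re (a * b)%C = Re a * Re b - Im a * Im b. Proof. reflexivity. Qed.
Lemma Im_mult (a b : C) : Im (a * b)%C = Re a * Im b + Im a * Re b. Proof. reflexivity. Qed.
Lemma Re_RtoC (r : R) : Re (RtoC r) = r. Proof. reflexivity. Qed.
Lemma Im_RtoC (r : R) : Im (RtoC r) = 0. Proof. reflexivity. Qed.
Lemma Re_Ci : Re Ci = 0. Proof. reflexivity. Qed.
Lemma Im_Ci : Im Ci = 1. Proof. reflexivity. Qed.
Lemma Re_pair (a b : R) : Re (a, b) = a. Proof. reflexivity. Qed.
Lemma Im_pair (a b : R) : Im (a, b) = b. Proof. reflexivity. Qed.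
Lemma Re_Cexp (z : C) : Re (Cexp z) = exp (Re z) * cos (Im z). Proof. reflexivity. Qed.
Lemma Im_Cexp (z : C) : Im (Cexp z) = exp (Re z) * sin (Im z). Proof. reflexivity. Qed.

Ltac reim := rewrite ?Re_plus, ?Im_plus, ?Re_minus, ?Im_minus, ?Re_opp, ?Im_opp, ?Re_mult, ?Im_mult,
  ?Re_Cexp, ?Im_Cexp, ?Re_RtoC, ?Im_RtoC, ?Re_Ci, ?Im_Ci, ?Re_pair, ?Im_pair.

Lemma Ci2 : (Ci * Ci = - 1)%C.
Proof. apply C_ext; repeat progress reim; ring. Qed.

Lemma Cexp_plus (a b : C) : Cexp (a + b) = (Cexp a * Cexp b)%C.
Proof.
  apply C_ext; repeat progress reim; rewrite exp_plus, ?cos_plus, ?sin_plus; ring.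
Qed.

Lemma Cexp_0 : Cexp 0 = 1.
Proof. apply C_ext; repeat progress reim; rewrite exp_0, ?cos_0, ?sin_0; ring. Qed.

Lemma Cexp_opp_l (a : C) : (Cexp (- a) * Cexp a = 1)%C.
Proof. rewrite <- Cexp_plus. replace (- a + a)%C with (RtoC 0) by ring. apply Cexp_0. Qed.

Lemma C1_neq0 : (1 : C) <> 0.
Proof. intros H. injection H. lra. Qed.

Lemma Cexp_neq0 (a : C) : Cexp a <> 0.
Proof.
  intros H. pose proof (Cexp_opp_l a) as H1. rewrite H, Cmult_0_r in H1. now apply C1_neq0.
Qed.

Lemma Cexp_opp (a : C) : Cexp (- a) = (/ Cexp a)%C.
Proof.
  rewrite <- (Cmult_1_r (Cexp (- a))), <- (Cinv_r (Cexp a)), Cmult_assoc, Cexp_opp_l by apply Cexp_neq0.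
  apply Cmult_1_l.
Qed.

Lemma Cmod_Cexp (a : C) : Cmod (Cexp a) = exp (Re a).
Proof.
  unfold Cmod, Cexp; simpl fst; simpl snd.
  replace ((exp (Re a) * cos (Im a)) ^ 2 + (exp (Re a) * sin (Im a)) ^ 2)
    with ((exp (Re a))²).
  - apply sqrt_Rsqr. left. apply exp_pos.
  - pose proof (sin2_cos2 (Im a)) as H. unfold Rsqr in *.
    transitivity (exp (Re a) * exp (Re a) * (sin (Im a) * sin (Im a) + cos (Im a) * cos (Im a))).
    rewrite H; ring. ring.
Qed.

Lemma Cmod_sqr (a : C) : Cmod a ^ 2 = Re a ^ 2 + Im a ^ 2.
Proof. unfold Cmod, Re, Im. rewrite pow2_sqrt; nra. Qed.

Lemma Rabs_Re_le (a : C) : Rabs (Re a) <= Cmod a.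
Proof. apply Rle_trans with (2 := Rmax_Cmod a). apply Rmax_l. Qed.
Lemma Rabs_Im_le (a : C) : Rabs (Im a) <= Cmod a.
Proof. apply Rle_trans with (2 := Rmax_Cmod a). apply Rmax_r. Qed.

Lemma Re_le_Cmod (a : C) : Re a <= Cmod a.
Proof. apply Rle_trans with (2 := Rabs_Re_le a). apply Rle_abs. Qed.
Lemma Cmod_le_ReIm (a : C) : Cmod a <= Rabs (Re a) + Rabs (Im a).
Proof.

  apply Rsqr_incr_0_var.
  - rewrite !Rsqr_pow2, Cmod_sqr. rewrite <- (pow2_abs (Re a)), <- (pow2_abs (Im a)).
    pose proof (Rabs_pos (Re a)); pose proof (Rabs_pos (Im a)). nra.
  - pose proof (Rabs_pos (Re a)); pose proof (Rabs_pos (Im a)). lra.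
Qed.

Lemma Cmod_triangle_minus (a b : C) : Cmod (a - b) <= Cmod a + Cmod b.
Proof. unfold Cminus. rewrite <- (Cmod_opp b). apply Cmod_triangle. Qed.

Lemma Cmod_minus_sym (a b : C) : Cmod (a - b) = Cmod (b - a).
Proof. rewrite <- Cmod_opp. f_equal. ring. Qed.

Lemma Cmod_tri3 (a b c : C) : Cmod (a - c) <= Cmod (a - b) + Cmod (b - c).
Proof. replace (a - c)%C with ((a - b) + (b - c))%C by ring. apply Cmod_triangle. Qed.

(** Componentwise, so that differentiation and integration reduce to real functions and
    [auto_derive]. *)
Definition Cderiv (f : R -> C) (t : R) (l : C) : Prop :=
  is_derive (fun s => Re (f s)) t (Re l) /\ is_derive (fun s => Im (f s)) t (Im l).

Definition Ccont (f : R -> C) (t : R) : Prop :=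
  continuous (fun s => Re (f s)) t /\ continuous (fun s => Im (f s)) t.

Lemma Cderiv_eq (f : R -> C) t l l' : Cderiv f t l -> l = l' -> Cderiv f t l'.
Proof. now intros H <-. Qed.

Lemma Cderiv_ext_loc (f g : R -> C) t l :
  locally t (fun s => f s = g s) -> Cderiv f t l -> Cderiv g t l.
Proof.
  intros H [H1 H2].
  split; (eapply is_derive_ext_loc; [|eassumption]);
  (eapply filter_imp; [|exact H]); intros s Hs; now rewrite Hs.
Qed.

Lemma Cderiv_const (a : C) t : Cderiv (fun _ => a) t 0.
Proof. split; rap (is_derive_const _ t). Qed.

Lemma Cderiv_RtoC (f : R -> R) t l : is_derive f t l -> Cderiv (fun s => RtoC (f s)) t (RtoC l).
Proof. intros H. split; simpl. exact H. rap (is_derive_const _ t). Qed.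

Lemma Cderiv_id t : Cderiv (fun s => RtoC s) t 1.
Proof. apply Cderiv_RtoC. apply (is_derive_id t). Qed.

Lemma Cderiv_plus (f g : R -> C) t a b : Cderiv f t a -> Cderiv g t b -> Cderiv (fun s => f s + g s)%C t (a + b).
Proof. intros [] []. split; rap is_derive_plus; auto. Qed.

Lemma Cderiv_opp (f : R -> C) t a : Cderiv f t a -> Cderiv (fun s => - f s)%C t (- a).
Proof. intros []. split; rap is_derive_opp; auto. Qed.

Lemma Cderiv_minus (f g : R -> C) t a b : Cderiv f t a -> Cderiv g t b -> Cderiv (fun s => f s - g s)%C t (a - b).
Proof. intros [] []. split; rap is_derive_minus; auto. Qed.

Ltac dfact := repeat match goal with H : is_derive ?f ?t ?l |- _ =>
   let E := fresh "E" in assert (E : Derive (fun x : R => f x) t = l) by (apply is_derive_unique; exact H);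
   let X := fresh "X" in assert (X : ex_derive (fun x : R => f x) t) by (exists l; exact H); clear H end.

Lemma is_derive_mult_pair (x1 y1 x2 y2 : R -> R) t a1 b1 a2 b2 :
  is_derive x1 t a1 -> is_derive y1 t b1 -> is_derive x2 t a2 -> is_derive y2 t b2 ->
  is_derive (fun s => x1 s * x2 s - y1 s * y2 s) t
    (a1 * x2 t - b1 * y2 t + (x1 t * a2 - y1 t * b2)) /\
  is_derive (fun s => x1 s * y2 s + y1 s * x2 s) t
    (a1 * y2 t + b1 * x2 t + (x1 t * b2 + y1 t * a2)).
Proof. intros. dfact. split; auto_derive; try tauto; rewrite E, E0, E1, E2; ring. Qed.

Lemma Cderiv_mult (f g : R -> C) t a b :
  Cderiv f t a -> Cderiv g t b -> Cderiv (fun s => f s * g s)%C t (a * g t + f t * b).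
Proof.
  intros [H1 H2] [H3 H4].
  destruct (is_derive_mult_pair _ _ _ _ t _ _ _ _ H1 H2 H3 H4) as [A B].
  split; repeat progress reim; assumption.
Qed.

Lemma Cderiv_scal (c : C) (f : R -> C) t a : Cderiv f t a -> Cderiv (fun s => c * f s)%C t (c * a).
Proof.
  intros H. eapply Cderiv_eq. apply Cderiv_mult. apply Cderiv_const. exact H. simpl; ring.
Qed.

Lemma is_derive_expcos (x y : R -> R) t a b : is_derive x t a -> is_derive y t b ->
  is_derive (fun s => exp (x s) * cos (y s)) t (a * (exp (x t) * cos (y t)) - b * (exp (x t) * sin (y t))) /\
  is_derive (fun s => exp (x s) * sin (y s)) t (a * (exp (x t) * sin (y t)) + b * (exp (x t) * cos (y t))).
Proof. intros. dfact. split; auto_derive; try tauto; rewrite E, E0; ring. Qed.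

Lemma Cderiv_exp (f : R -> C) t a : Cderiv f t a -> Cderiv (fun s => Cexp (f s)) t (a * Cexp (f t)).
Proof.
  intros [H1 H2]. destruct (is_derive_expcos _ _ t _ _ H1 H2) as [A B].
  split; repeat progress reim; assumption.
Qed.

Lemma Cmod_neq0_sqr (a : C) : a <> 0 -> Re a ^ 2 + Im a ^ 2 <> 0.
Proof. intros H. rewrite <- Cmod_sqr. apply pow_nonzero. now intros H1; apply H, Cmod_eq_0. Qed.

Lemma is_derive_inv_pair (x y : R -> R) t a b : is_derive x t a -> is_derive y t b ->
  x t ^ 2 + y t ^ 2 <> 0 ->
  is_derive (fun s => x s / (x s ^ 2 + y s ^ 2)) t
    ((a * (y t ^ 2 - x t ^ 2) - 2 * b * x t * y t) / (x t ^ 2 + y t ^ 2) ^ 2) /\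
  is_derive (fun s => - y s / (x s ^ 2 + y s ^ 2)) t
    ((b * (y t ^ 2 - x t ^ 2) + 2 * a * x t * y t) / (x t ^ 2 + y t ^ 2) ^ 2).
Proof.
  intros. dfact. split; auto_derive; try (repeat split; tauto); rewrite E, E0; field; auto.
Qed.

Lemma Cderiv_inv (f : R -> C) t a : Cderiv f t a -> f t <> 0 -> Cderiv (fun s => / f s)%C t (- a / (f t * f t)).
Proof.
  intros [H1 H2] H0. pose proof (Cmod_neq0_sqr _ H0) as Hn.
  assert (Hv : (- a / (f t * f t) = - a * (/ f t * / f t))%C) by (field; auto).
  rewrite Hv. clear Hv.
  destruct (is_derive_inv_pair _ _ t _ _ H1 H2 Hn) as [A B].
  split.
  - evar_last. exact A. unfold Cinv. repeat progress reim.
    change (fst (f t)) with (Re (f t)). change (snd (f t)) with (Im (f t)). field. auto.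
  - evar_last. exact B. unfold Cinv. repeat progress reim.
    change (fst (f t)) with (Re (f t)). change (snd (f t)) with (Im (f t)). field. auto.
Qed.

Lemma Cderiv_cC (f : R -> C) t l : Cderiv f t l -> Ccont f t.
Proof. intros [H1 H2]. split; rap ex_derive_continuous; eexists; eauto. Qed.

Lemma Ccont_mult (f g : R -> C) t : Ccont f t -> Ccont g t -> Ccont (fun s => f s * g s)%C t.
Proof.
  intros [] []. split.
  - rap continuous_minus; rap continuous_mult; auto.
  - rap continuous_plus; rap continuous_mult; auto.
Qed.

Lemma Ccont_plus (f g : R -> C) t : Ccont f t -> Ccont g t -> Ccont (fun s => f s + g s)%C t.
Proof. intros [] []. split; rap continuous_plus; auto. Qed.

Lemma Ccont_const (a : C) t : Ccont (fun _ => a) t.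
Proof. split; apply continuous_const. Qed.

Lemma Ccont_RtoC (f : R -> R) t : continuous f t -> Ccont (fun s => RtoC (f s)) t.
Proof. intros H. split. exact H. apply continuous_const. Qed.

Lemma rInt_const (c a b : R) : is_RInt (fun _ : R => c) a b ((b - a) * c).
Proof. exact (is_RInt_const a b c). Qed.
Lemma rInt_plus (f g : R -> R) (a b l l' : R) :
  is_RInt f a b l -> is_RInt g a b l' -> is_RInt (fun x => f x + g x) a b (l + l').
Proof. exact (is_RInt_plus f g a b l l'). Qed.
Lemma rInt_minus (f g : R -> R) (a b l l' : R) :
  is_RInt f a b l -> is_RInt g a b l' -> is_RInt (fun x => f x - g x) a b (l - l').
Proof. exact (is_RInt_minus f g a b l l'). Qed.
Lemma rInt_scal (c : R) (f : R -> R) (a b l : R) :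
  is_RInt f a b l -> is_RInt (fun x => c * f x) a b (c * l).
Proof. exact (is_RInt_scal f a b c l). Qed.

Definition is_CInt (f : R -> C) a b (l : C) :=
  is_RInt (fun s => Re (f s)) a b (Re l) /\ is_RInt (fun s => Im (f s)) a b (Im l).

Definition CInt (f : R -> C) a b : C := (RInt (fun s => Re (f s)) a b, RInt (fun s => Im (f s)) a b).

Lemma is_CInt_unique f a b l : is_CInt f a b l -> CInt f a b = l.
Proof. intros [H1 H2]. apply C_ext; simpl; now apply is_RInt_unique. Qed.

Lemma CInt_correct f a b : (forall t, Rmin a b <= t <= Rmax a b -> Ccont f t) -> is_CInt f a b (CInt f a b).
Proof.
  intros H. split; rap RInt_correct; rap ex_RInt_continuous; intros; now apply H.
Qed.

Lemma is_CInt_derive (f df : R -> C) a b :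
  (forall t, Rmin a b <= t <= Rmax a b -> Cderiv f t (df t)) ->
  (forall t, Rmin a b <= t <= Rmax a b -> Ccont df t) -> is_CInt df a b (f b - f a).
Proof.
  intros H1 H2. split; rap is_RInt_derive; intros; now (apply H1 || apply H2).
Qed.

Lemma is_CInt_plus f g a b l l' :
  is_CInt f a b l -> is_CInt g a b l' -> is_CInt (fun s => f s + g s)%C a b (l + l').
Proof. intros [] []. split; rap is_RInt_plus; auto. Qed.

Lemma is_CInt_minus f g a b l l' :
  is_CInt f a b l -> is_CInt g a b l' -> is_CInt (fun s => f s - g s)%C a b (l - l').
Proof. intros [] []. split; rap is_RInt_minus; auto. Qed.

Lemma is_CInt_scal c f a b l : is_CInt f a b l -> is_CInt (fun s => c * f s)%C a b (c * l).
Proof.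
  intros [H1 H2]. split.
  - rap is_RInt_minus; rap is_RInt_scal; auto.
  - rap is_RInt_plus; rap is_RInt_scal; auto.
Qed.

Lemma is_CInt_ext f g a b l :
  (forall t, Rmin a b < t < Rmax a b -> f t = g t) -> is_CInt f a b l -> is_CInt g a b l.
Proof.
  intros H [H1 H2]. split; eapply is_RInt_ext; eauto; intros; simpl; now rewrite H.
Qed.

Lemma is_CInt_Chasles f a b c l l' :
  is_CInt f a b l -> is_CInt f b c l' -> is_CInt f a c (l + l').
Proof. intros [] []. split; rap is_RInt_Chasles; eauto. Qed.

(* Testing against the conjugate of the value reduces to the real case. *)
Lemma is_CInt_norm_le f (g : R -> R) a b l lg : a <= b ->
  (forall t, a <= t <= b -> Cmod (f t) <= g t) -> is_CInt f a b l -> is_RInt g a b lg -> Cmod l <= lg.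
Proof.
  intros Hab Hle [H1 H2] Hg.
  assert (H : is_RInt (fun t => Re l * Re (f t) + Im l * Im (f t)) a b (Re l * Re l + Im l * Im l)).
  { rap is_RInt_plus; rap is_RInt_scal; auto. }
  assert (Hc : forall t, Re l * Re (f t) + Im l * Im (f t) <= Cmod l * Cmod (f t)).
  { intros t. rewrite <- (Cmod_conj l), <- Cmod_mult.
    apply Rle_trans with (Re (Cconj l * f t)%C). 2: apply Re_le_Cmod.
    reim. unfold Cconj. simpl. unfold Re, Im. lra. }
  assert (H3 : Cmod l * Cmod l <= Cmod l * lg).
  { replace (Cmod l * Cmod l) with (Cmod l ^ 2) by ring. rewrite Cmod_sqr.
    replace (Re l ^ 2 + Im l ^ 2) with (Re l * Re l + Im l * Im l) by ring.
    eapply (is_RInt_le _ (fun t => Cmod l * g t) a b _ _ Hab H).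
    rap is_RInt_scal. exact Hg.
    intros t Ht. apply Rle_trans with (1 := Hc t). apply Rmult_le_compat_l. apply Cmod_ge_0.
    apply Hle. lra. }
  destruct (Req_dec (Cmod l) 0) as [H0 | H0].
  - rewrite H0. rap (is_RInt_ge_0 g a b lg Hab Hg).
    intros t Ht. apply Rle_trans with (2 := Hle t ltac:(lra)). apply Cmod_ge_0.
  - apply Rmult_le_reg_l with (2 := H3). pose proof (Cmod_ge_0 l). lra.
Qed.

(** There is no mean value equality for complex values; projecting f onto the direction of its
    increment l gives a real function whose increment is |l|^2 and whose slope is at most |l| M. *)
Lemma Cderiv_mvt (f df : R -> C) (M : R) :
  (forall t, 0 <= t <= 1 -> Cderiv f t (df t)) -> (forall t, 0 <= t <= 1 -> Cmod (df t) <= M) ->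
  Cmod (f 1 - f 0) <= M.
Proof.
  intros Hd HM. set (l := (f 1 - f 0)%C).
  set (h := fun t => Re l * Re (f t) + Im l * Im (f t)).
  assert (Hh : forall t, 0 <= t <= 1 -> is_derive h t (Re l * Re (df t) + Im l * Im (df t))).
  { intros t Ht. destruct (Hd t Ht) as [H1 H2]. unfold h. rap (is_derive_plus _ _ _ _ _ _ _); rap (is_derive_scal _ _ _ _ _); assumption. }
  destruct (MVT_gen h 0 1 (fun t => Re l * Re (df t) + Im l * Im (df t))) as [t [Ht E]].
  - rewrite Rmin_left, Rmax_right by lra. intros; apply Hh; lra.
  - rewrite Rmin_left, Rmax_right by lra. intros. apply continuity_pt_filterlim.
    rap ex_derive_continuous. eexists. now apply Hh.
  - rewrite Rmin_left, Rmax_right in Ht by lra.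
    assert (Hs : h 1 - h 0 = Cmod l * Cmod l).
    { replace (Cmod l * Cmod l) with (Cmod l ^ 2) by ring. rewrite Cmod_sqr. unfold h.
      unfold l. reim. ring. }
    assert (Hc : Re l * Re (df t) + Im l * Im (df t) <= Cmod l * Cmod (df t)).
    { rewrite <- (Cmod_conj l), <- Cmod_mult.
      apply Rle_trans with (Re (Cconj l * df t)%C). 2: apply Re_le_Cmod.
      reim. unfold Cconj. simpl. unfold Re, Im. lra. }
    pose proof (Cmod_ge_0 l). pose proof (HM t Ht). pose proof (Cmod_ge_0 (df t)).
    rewrite Hs in E. destruct (Req_dec (Cmod l) 0) as [Hz|Hz]. lra.
    assert (Cmod l * Cmod l <= Cmod l * M) by nra.
    apply Rmult_le_reg_l with (Cmod l); lra.
Qed.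

Lemma Cderiv_zero_const (f : R -> C) : (forall t, 0 <= t <= 1 -> Cderiv f t 0) -> f 1 = f 0.
Proof.
  intros H. assert (H1 : Cmod (f 1 - f 0) <= 0).
  { apply Cderiv_mvt with (fun _ => RtoC 0). exact H. intros. rewrite Cmod_0. lra. }
  pose proof (Cmod_ge_0 (f 1 - f 0)).
  replace (f 1) with (f 1 - f 0 + f 0)%C by ring. rewrite (Cmod_eq_0 (f 1 - f 0)%C) by lra. ring.
Qed.

(* Complex differentiability, encoded as the chain rule along every differentiable path. *)
Definition holo_deriv (f : C -> C) (z l : C) : Prop :=
  forall (Y : R -> C) t Y', Y t = z -> Cderiv Y t Y' -> Cderiv (fun s => f (Y s)) t (l * Y').

Lemma holo_deriv_segment (f : C -> C) (y k : C) (t : R) l : holo_deriv f (y + t * k)%C l ->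
  Cderiv (fun s => f (y + s * k)%C) t (l * k).
Proof.
  intros H. apply (H (fun s => y + s * k)%C). reflexivity.
  eapply Cderiv_eq. apply Cderiv_plus. apply Cderiv_const. apply Cderiv_mult. apply Cderiv_id. apply Cderiv_const. cbv beta; ring.
Qed.

Lemma holo_deriv_mvt (f f' : C -> C) (y k : C) M :
  (forall t, 0 <= t <= 1 -> holo_deriv f (y + t * k)%C (f' (y + t * k)%C)) ->
  (forall t, 0 <= t <= 1 -> Cmod (f' (y + t * k)%C) <= M) ->
  Cmod (f (y + k) - f y)%C <= M * Cmod k.
Proof.
  intros H HM.
  replace (f (y + k) - f y)%C with (f (y + 1 * k) - f (y + 0 * k))%C by (f_equal; f_equal; try ring; f_equal; ring).
  apply (Cderiv_mvt (fun s => f (y + s * k)%C) (fun t => f' (y + t * k) * k)%C).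
  - intros t Ht. apply holo_deriv_segment. now apply H.
  - intros t Ht. rewrite Cmod_mult. apply Rmult_le_compat_r. apply Cmod_ge_0. now apply HM.
Qed.

Lemma holo_deriv_taylor2 (f f' f'' : C -> C) (y k : C) M :
  (forall t, 0 <= t <= 1 -> holo_deriv f (y + t * k)%C (f' (y + t * k)%C)) ->
  (forall t, 0 <= t <= 1 -> holo_deriv f' (y + t * k)%C (f'' (y + t * k)%C)) ->
  (forall t, 0 <= t <= 1 -> Cmod (f'' (y + t * k)%C) <= M) ->
  Cmod (f (y + k) - f y - k * f' y)%C <= M * Cmod k ^ 2.
Proof.
  intros H1 H2 HM.
  set (F := fun s : R => (f (y + s * k) - s * (k * f' y))%C).
  replace (f (y + k) - f y - k * f' y)%C with (F 1 - F 0)%C.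
  2: { unfold F. replace (y + 1 * k)%C with (y + k)%C by ring. replace (y + 0 * k)%C with y by ring. ring. }
  apply (Cderiv_mvt F (fun t => f' (y + t * k) * k - k * f' y)%C).
  - intros t Ht. apply Cderiv_minus. apply holo_deriv_segment. now apply H1.
    eapply Cderiv_eq. apply Cderiv_mult. apply Cderiv_id. apply Cderiv_const. cbv beta; ring.
  - intros t Ht.
    replace (f' (y + t * k) * k - k * f' y)%C with ((f' (y + t * k) - f' y) * k)%C by ring.
    rewrite Cmod_mult. simpl. rewrite Rmult_1_r, <- Rmult_assoc.
    apply Rmult_le_compat_r. apply Cmod_ge_0.
    apply Rle_trans with (M * Cmod (t * k)).
    + apply holo_deriv_mvt with f''; intros s Hs;
      replace (y + s * (t * k))%C with (y + (s * t)%R * k)%C by (rewrite RtoC_mult; ring);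
      (apply H2 || apply HM); nra.
    + assert (0 <= M) by (apply Rle_trans with (2 := HM 0 ltac:(lra)); apply Cmod_ge_0).
      apply Rmult_le_compat_l. auto. rewrite Cmod_mult, Cmod_R, Rabs_pos_eq by lra.
      pose proof (Cmod_ge_0 k). nra.
Qed.

Lemma Cderiv_Cmod_bound (f : R -> C) t l :
  (forall eps : posreal, locally t (fun s => Cmod (f s - f t - (s - t)%R * l) <= eps * Rabs (s - t))) ->
  Cderiv f t l.
Proof.
  intros H.
  split; (split; [apply is_linear_scal_l|]; intros x Hx eps;
    apply (is_filter_lim_locally_unique (V := AbsRing_NormedModule R_AbsRing) t x) in Hx; subst x;
    eapply filter_imp; [|exact (H eps)]; intros s Hs; unfold norm, minus, plus, opp, scal; simpl;
    unfold abs, mult; simpl; apply Rle_trans with (2 := Hs)).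
  - replace (Re (f s) + - Re (f t) + - ((s + - t) * Re l)) with (Re (f s - f t - (s - t)%R * l)%C).
    apply Rabs_Re_le. repeat progress reim. ring.
  - replace (Im (f s) + - Im (f t) + - ((s + - t) * Im l)) with (Im (f s - f t - (s - t)%R * l)%C).
    apply Rabs_Im_le. repeat progress reim. ring.
Qed.

Lemma Cderiv_eps (f : R -> C) t l : Cderiv f t l ->
  forall eps : posreal, locally t (fun s => Cmod (f s - f t - (s - t)%R * l) <= eps * Rabs (s - t)).
Proof.
  intros [[_ H1] [_ H2]] eps.
  set (e2 := mkposreal (eps / 2) (is_pos_div_2 eps)).
  specialize (H1 t (fun P H => H) e2). specialize (H2 t (fun P H => H) e2).
  eapply filter_imp; [|exact (filter_and _ _ H1 H2)]; intros s [A B].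
  apply Rle_trans with (1 := Cmod_le_ReIm _).
  unfold norm, minus, plus, opp, scal in A, B; simpl in A, B; unfold abs, mult in A, B; simpl in A, B.
  replace (Re (f s - f t - (s - t)%R * l)) with (Re (f s) + - Re (f t) + - ((s + - t) * Re l))
    by (repeat progress reim; ring).
  replace (Im (f s - f t - (s - t)%R * l)) with (Im (f s) + - Im (f t) + - ((s + - t) * Im l))
    by (repeat progress reim; ring).
  unfold Rminus. lra.
Qed.

(** Unlike a little-o remainder, a quadratic one with explicit constant can be integrated over a
    parameter or summed over n. [Gp], [Csqrt] and the series in n are all differentiated through
    this criterion. *)
Lemma holo_deriv_of_quadratic (f : C -> C) (y l : C) (M delta : R) : 0 < delta ->
  (forall k, Cmod k < delta -> Cmod (f (y + k) - f y - k * l)%C <= M * Cmod k ^ 2) -> holo_deriv f y l.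
Proof.
  intros Hd H Y t Y' EY HY. subst y. apply Cderiv_Cmod_bound. intros eps.
  assert (HM : 0 <= Rabs M) by apply Rabs_pos.
  assert (Hl := Cmod_ge_0 l). assert (HY' := Cmod_ge_0 Y').
  set (e1 := eps / 2 / (Cmod l + 1)).
  assert (He1 : 0 < e1). { unfold e1. pose proof (cond_pos eps). apply Rdiv_lt_0_compat; lra. }
  pose proof (Cderiv_eps _ _ _ HY (mkposreal _ He1)) as H1.
  pose proof (Cderiv_eps _ _ _ HY (mkposreal 1 Rlt_0_1)) as H2. simpl in H1, H2.
  set (B := Cmod Y' + 1) in *.
  set (d := Rmin (delta / B) (eps / 2 / (Rabs M * B ^ 2 + 1))).
  assert (HB : 0 < B) by (unfold B; lra).
  assert (HD : 0 < Rabs M * B ^ 2 + 1) by nra.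
  assert (Hdp : 0 < d).
  { unfold d. pose proof (cond_pos eps). apply Rmin_glb_lt; apply Rdiv_lt_0_compat; lra. }
  assert (H3 : locally t (fun s => Rabs (s - t) < d)).
  { exists (mkposreal _ Hdp). intros s Hs. exact Hs. }
  eapply filter_imp; [|exact (filter_and _ _ H1 (filter_and _ _ H2 H3))]; intros s [A [A2 A3]].
  set (k := (Y s - Y t)%C).
  assert (Hk : Cmod k <= B * Rabs (s - t)).
  { unfold B. replace k with ((Y s - Y t - (s - t)%R * Y') + (s - t)%R * Y')%C by (unfold k; ring).
    apply Rle_trans with (1 := Cmod_triangle _ _). rewrite (Cmod_mult (RtoC (s - t))), Cmod_R. lra. }
  assert (Hk2 : Cmod k < delta).
  { apply Rle_lt_trans with (1 := Hk). apply Rlt_le_trans with (B * d).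
    - apply Rmult_lt_compat_l; auto.
    - apply Rle_trans with (B * (delta / B)). apply Rmult_le_compat_l. lra. apply Rmin_l.
      right. field. lra. }
  specialize (H k Hk2). replace (Y t + k)%C with (Y s) in H by (unfold k; ring).
  replace (f (Y s) - f (Y t) - (s - t)%R * (l * Y'))%C with
    ((f (Y s) - f (Y t) - k * l) + l * (Y s - Y t - (s - t)%R * Y'))%C by (unfold k; ring).
  apply Rle_trans with (1 := Cmod_triangle _ _). rewrite Cmod_mult.
  set (r := Rabs (s - t)) in *. assert (Hr : 0 <= r) by apply Rabs_pos.
  assert (P1 : Cmod (f (Y s) - f (Y t) - k * l) <= eps / 2 * r).
  { apply Rle_trans with (1 := H). apply Rle_trans with (Rabs M * (B * r) ^ 2).
    - apply Rle_trans with (Rabs M * Cmod k ^ 2). apply Rmult_le_compat_r. apply pow2_ge_0. apply Rle_abs.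
      apply Rmult_le_compat_l; auto. apply pow_incr. split; auto. apply Cmod_ge_0.
    - assert (Hr2 : r * (Rabs M * B ^ 2 + 1) <= eps / 2).
      { apply Rle_trans with (eps / 2 / (Rabs M * B ^ 2 + 1) * (Rabs M * B ^ 2 + 1)).
        apply Rmult_le_compat_r. lra. apply Rle_trans with d. lra. apply Rmin_r.
        right. field. lra. }
      replace (Rabs M * (B * r) ^ 2) with (r * (Rabs M * B ^ 2) * r) by ring.
      apply Rmult_le_compat_r; auto. nra. }
  assert (P2 : Cmod l * Cmod (Y s - Y t - (s - t)%R * Y') <= eps / 2 * r).
  { apply Rle_trans with (Cmod l * (e1 * r)). apply Rmult_le_compat_l; auto.
    rewrite <- Rmult_assoc. apply Rmult_le_compat_r; auto. unfold e1.
    pose proof (cond_pos eps).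
    apply Rle_trans with ((Cmod l + 1) * (eps / 2 / (Cmod l + 1))). apply Rmult_le_compat_r. left; exact He1. lra.
    right. field. lra. }
  lra.
Qed.

(** * The Gaussian and its primitive *)

Lemma holo_deriv_eq f z l l' : holo_deriv f z l -> l = l' -> holo_deriv f z l'.
Proof. now intros H <-. Qed.

Lemma holo_deriv_const (a z : C) : holo_deriv (fun _ => a) z 0.
Proof. intros Y t Y' _ _. eapply Cderiv_eq. apply Cderiv_const. ring. Qed.

Lemma holo_deriv_id (z : C) : holo_deriv (fun w => w) z 1.
Proof. intros Y t Y' _ H. eapply Cderiv_eq. exact H. ring. Qed.

Lemma holo_deriv_plus f g z a b : holo_deriv f z a -> holo_deriv g z b -> holo_deriv (fun w => f w + g w)%C z (a + b).
Proof.
  intros H1 H2 Y t Y' E H. eapply Cderiv_eq. apply Cderiv_plus. apply (H1 Y _ _ E H). apply (H2 Y _ _ E H). ring.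
Qed.

Lemma holo_deriv_mult f g z a b : holo_deriv f z a -> holo_deriv g z b -> holo_deriv (fun w => f w * g w)%C z (a * g z + f z * b).
Proof.
  intros H1 H2 Y t Y' E H. eapply Cderiv_eq. apply Cderiv_mult. apply (H1 Y _ _ E H). apply (H2 Y _ _ E H).
  cbv beta. rewrite E. ring.
Qed.

Lemma holo_deriv_scal c f z a : holo_deriv f z a -> holo_deriv (fun w => c * f w)%C z (c * a).
Proof. intros H. eapply holo_deriv_eq. apply holo_deriv_mult. apply holo_deriv_const. exact H. cbv beta; ring. Qed.

Lemma holo_deriv_comp f g z a b : holo_deriv g z b -> holo_deriv f (g z) a -> holo_deriv (fun w => f (g w)) z (a * b).
Proof.
  intros H1 H2 Y t Y' E H. eapply Cderiv_eq. apply (H2 (fun s => g (Y s))). now rewrite E.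
  apply (H1 Y _ _ E H). ring.
Qed.

Lemma holo_deriv_exp z : holo_deriv Cexp z (Cexp z).
Proof. intros Y t Y' E H. eapply Cderiv_eq. apply Cderiv_exp. exact H. rewrite E. ring. Qed.

(** The sign is that of e^(pi i x^2 w) at w = tau - i y^2, which factors as e^(pi i x^2 tau) times
    e^(pi (x y)^2). Decay is therefore along the imaginary axis. *)
Definition E2 (w : C) : C := Cexp (PI * (w * w)).

Lemma holo_deriv_E2 w : holo_deriv E2 w (2 * PI * w * E2 w).
Proof.
  unfold E2. eapply holo_deriv_eq.
  apply (holo_deriv_comp Cexp (fun w => PI * (w * w))%C). apply holo_deriv_scal. apply holo_deriv_mult; apply holo_deriv_id.
  apply holo_deriv_exp. cbv beta. ring.
Qed.

Lemma holo_deriv_E2_scal (s a : C) : holo_deriv (fun w => E2 (s * w)) a (2 * PI * s * s * a * E2 (s * a)).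
Proof.
  eapply holo_deriv_eq. apply (holo_deriv_comp E2 (fun w => s * w)%C). apply holo_deriv_scal. apply holo_deriv_id. apply holo_deriv_E2. ring.
Qed.

Lemma Cmod_E2 w : Cmod (E2 w) = exp (PI * (Re w ^ 2 - Im w ^ 2)).
Proof. unfold E2. rewrite Cmod_Cexp. f_equal. repeat progress reim. ring. Qed.

Lemma exp_le_mono (a b : R) : a <= b -> exp a <= exp b.
Proof. intros [H | ->]. left; now apply exp_increasing. apply Rle_refl. Qed.

Lemma Cmod_E2_le w r : Cmod w <= r -> Cmod (E2 w) <= exp (PI * r ^ 2).
Proof.
  intros H. rewrite Cmod_E2. apply exp_le_mono. apply Rmult_le_compat_l. left; apply PI_RGT_0.
  pose proof (Cmod_sqr w). pose proof (Cmod_ge_0 w). assert (Cmod w ^ 2 <= r ^ 2) by (apply pow_incr; lra).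
  pose proof (pow2_ge_0 (Im w)). lra.
Qed.

Lemma E2_opp w : E2 (- w) = E2 w.
Proof. unfold E2. f_equal. ring. Qed.

(* The odd entire primitive of [E2]. *)
Definition Gp (y : C) : C := (y * CInt (fun s => E2 (s * y)) 0 1)%C.

Lemma Cderiv_E2_ray (y : C) (t : R) : Cderiv (fun s => E2 (s * y)) t (2 * PI * t * (y * y) * E2 (t * y)).
Proof.
  eapply Cderiv_eq. apply (holo_deriv_E2 (t * y) (fun s => s * y)%C). reflexivity.
  apply Cderiv_mult. apply Cderiv_id. apply Cderiv_const. cbv beta. ring.
Qed.

Lemma Ccont_E2_ray (y : C) t : Ccont (fun s => E2 (s * y)) t.
Proof. eapply Cderiv_cC. apply Cderiv_E2_ray. Qed.

Lemma is_CInt_Gp y : is_CInt (fun s => y * E2 (s * y))%C 0 1 (Gp y).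
Proof. apply is_CInt_scal. apply CInt_correct. intros. apply Ccont_E2_ray. Qed.

Lemma holo_deriv_Gp y : holo_deriv Gp y (E2 y).
Proof.
  set (r := Cmod y + 1).
  (* Bound on |a| <= r for the second derivative in a of a * E2 (s a), uniform in s in [0, 1]. *)
  set (M := (6 * PI * r + 4 * PI ^ 2 * r ^ 3) * exp (PI * r ^ 2)).
  apply (holo_deriv_of_quadratic _ _ _ M 1). lra. intros k Hk.
  set (f := fun (s : R) (a : C) => (a * E2 (s * a))%C).
  set (f' := fun (s : R) (a : C) => (E2 (s * a) * (1 + 2 * PI * s * s * (a * a)))%C).
  set (f'' := fun (s : R) (a : C) => (E2 (s * a) * (6 * PI * s * s * a + 4 * PI * PI * s * s * s * s * (a * a * a)))%C).
  assert (I1 : is_CInt (fun s => k * f' s y)%C 0 1 (k * E2 y)%C).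
  { apply is_CInt_scal.
    (* The derivative in a of a * E2 (s a) equals the derivative in s of s * E2 (s a), so its
       integral over [0, 1] is E2 y. *)
    assert (H : forall t : R, Cderiv (fun s => s * E2 (s * y))%C t (f' t y)).
    { intros t. eapply Cderiv_eq. apply Cderiv_mult. apply Cderiv_id. apply Cderiv_E2_ray. unfold f'. ring. }
    replace (E2 y) with (1 * E2 (1 * y) - 0 * E2 (0 * y))%C.
    2: { replace (1 * y)%C with y by ring. ring. }
    apply (is_CInt_derive (fun s => s * E2 (s * y))%C). intros; apply H.
    intros t _. unfold f'. apply Ccont_mult. apply Ccont_E2_ray. apply Ccont_plus. apply Ccont_const.
    assert (Hid : Ccont (fun s : R => RtoC s) t) by (eapply Cderiv_cC; apply Cderiv_id).
    apply Ccont_mult; [|apply Ccont_const]. apply Ccont_mult; [|exact Hid].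
    apply Ccont_mult; [apply Ccont_const|exact Hid]. }
  pose proof (is_CInt_minus _ _ _ _ _ _ (is_CInt_minus _ _ _ _ _ _ (is_CInt_Gp (y + k)) (is_CInt_Gp y)) I1) as I2.
  replace (M * Cmod k ^ 2) with (scal (1 - 0) (M * Cmod k ^ 2)) by (unfold scal; simpl; unfold mult; simpl; ring).
  eapply (is_CInt_norm_le _ (fun _ => M * Cmod k ^ 2) 0 1). lra. 2: exact I2.
  2: { rap (is_RInt_const 0 1 _). }
  intros s Hs.
  apply (holo_deriv_taylor2 (f s) (f' s) (f'' s)).
  - intros t Ht. unfold f, f'. eapply holo_deriv_eq. apply holo_deriv_mult. apply holo_deriv_id. apply holo_deriv_E2_scal. cbv beta; ring.
  - intros t Ht. unfold f', f''. eapply holo_deriv_eq. apply holo_deriv_mult. apply holo_deriv_E2_scal.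
    apply holo_deriv_plus. apply holo_deriv_const. apply holo_deriv_scal. apply holo_deriv_mult; apply holo_deriv_id. cbv beta. ring.
  - intros t Ht. set (a := (y + t * k)%C).
    assert (Ha : Cmod a <= r).
    { unfold a, r. apply Rle_trans with (1 := Cmod_triangle _ _). rewrite Cmod_mult, Cmod_R, Rabs_pos_eq by lra.
      pose proof (Cmod_ge_0 k). nra. }
    assert (Ha0 := Cmod_ge_0 a). assert (Hpi := PI_RGT_0).
    unfold f''. rewrite Cmod_mult. unfold M. rewrite Rmult_comm. apply Rmult_le_compat; try apply Cmod_ge_0.
    + apply Rle_trans with (1 := Cmod_triangle _ _).
      rewrite !Cmod_mult, !Cmod_R, !(Rabs_pos_eq s), !(Rabs_pos_eq PI), (Rabs_pos_eq 6), (Rabs_pos_eq 4) by lra.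
      assert (s * s <= 1) by nra. assert (0 <= s * s) by nra. assert (s * s * (s * s) <= 1) by nra.
      apply Rplus_le_compat.
      * replace (6 * PI * s * s * Cmod a) with (6 * PI * (s * s * Cmod a)) by ring.
        apply Rmult_le_compat_l. lra. nra.
      * replace (4 * PI * PI * s * s * s * s * (Cmod a * Cmod a * Cmod a))
          with (4 * PI ^ 2 * (s * s * (s * s) * Cmod a ^ 3)) by ring.
        apply Rmult_le_compat_l. nra.
        assert (Cmod a ^ 3 <= r ^ 3) by (apply pow_incr; lra).
        assert (0 <= Cmod a ^ 3) by (apply pow_le; lra). nra.
    + apply Cmod_E2_le. rewrite Cmod_mult, Cmod_R, Rabs_pos_eq by lra. nra.
Qed.

Lemma Gp_0 : Gp 0 = 0.
Proof. unfold Gp. ring. Qed.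

Lemma Gp_opp y : Gp (- y) = (- Gp y)%C.
Proof.
  unfold Gp. replace (fun s : R => E2 (s * - y)) with (fun s : R => E2 (s * y)). ring.
  apply functional_extensionality; intros s. rewrite <- E2_opp. f_equal. ring.
Qed.

(** The integral of e^(-pi x^2) from 0 to s, read off from [Gp] on the imaginary axis. *)
Definition gauss (s : R) : R := Im (Gp (Ci * s)).

Lemma is_derive_gauss s : is_derive gauss s (exp (- (PI * s ^ 2))).
Proof.
  assert (H : Cderiv (fun s : R => Gp (Ci * s)) s (E2 (Ci * s) * Ci)).
  { apply (holo_deriv_Gp _ (fun s => Ci * s)%C). reflexivity. eapply Cderiv_eq. apply Cderiv_scal. apply Cderiv_id. ring. }
  destruct H as [_ H]. evar_last. exact H. unfold E2. repeat progress reim.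
  replace (PI * (0 * s - 1 * 0) * 0) with 0 by ring.
  ring_simplify.
  replace (PI * ((0 * s - 1 * 0) * (0 * 0 + 1 * s) + (0 * 0 + 1 * s) * (0 * s - 1 * 0)) +
           0 * ((0 * s - 1 * 0) * (0 * s - 1 * 0) - (0 * 0 + 1 * s) * (0 * 0 + 1 * s))) with 0 by ring.
  rewrite cos_0, Rmult_1_r. f_equal. ring.
Qed.

Lemma Gp_im (s : R) : Gp (Ci * s) = (Ci * gauss s)%C.
Proof.
  apply C_ext; repeat progress reim. 2: fold (gauss s); ring.
  unfold Gp. repeat progress reim. unfold CInt. reim.
  assert (H : RInt (fun t => Im (E2 (t * (Ci * s)))) 0 1 = 0).
  { transitivity (RInt (fun _ => 0) 0 1).
    - apply RInt_ext. intros t _. unfold E2. repeat progress reim.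
      match goal with |- _ * sin ?a = _ => replace a with 0 by ring end. rewrite sin_0. toR. ring.
    - rewrite RInt_const. unfold scal; simpl; unfold mult; simpl. ring. }
  rewrite H. ring.
Qed.

Lemma gauss_scaled s : gauss s = s * RInt (fun t => exp (- (PI * (t * s) ^ 2))) 0 1.
Proof.
  unfold gauss, Gp. repeat progress reim. unfold CInt. reim.
  transitivity (s * RInt (fun t => Re (E2 (t * (Ci * s)))) 0 1). ring.
  f_equal. apply RInt_ext. intros t _. unfold E2. repeat progress reim.
  match goal with |- _ * cos ?a = _ => replace a with 0 by ring end. rewrite cos_0, Rmult_1_r. f_equal. ring.
Qed.

(** The classical companion of the squared Gauss integral: the s-derivative of its integral over t
    in [0, 1] is minus that of [gauss]^2, and at s = 0 it is the arctangent density divided by pi.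
    Hence [gauss] tends to 1/2 without any double integral. *)
Definition gJ (s t : R) : R := exp (- (PI * s ^ 2 * (1 + t ^ 2))) / (PI * (1 + t ^ 2)).

Lemma gJ_den t : 0 < PI * (1 + t ^ 2).
Proof. pose proof PI_RGT_0. nra. Qed.

Lemma is_derive_gJ s t : is_derive (fun x => gJ x t) s (- 2 * s * exp (- (PI * s ^ 2 * (1 + t ^ 2)))).
Proof.
  unfold gJ. pose proof (gJ_den t). pose proof PI_RGT_0. auto_derive. auto.
  replace (- (PI * s ^ 2 * (1 + t ^ 2))) with (- (PI * (s * (s * 1)) * (1 + t * (t * 1)))) by (simpl; ring).
  generalize (exp (- (PI * (s * (s * 1)) * (1 + t * (t * 1))))). intros e. toR. field. simpl in *. split; nra.
Qed.

Lemma continuous_gJ s t : continuous (gJ s) t.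
Proof.
  rap (ex_derive_continuous _ _ _). unfold gJ. auto_derive. pose proof (gJ_den t). simpl in *. lra.
Qed.

Lemma is_derive_RInt_gJ s :
  is_derive (fun x => RInt (gJ x) 0 1) s (- 2 * exp (- (PI * s ^ 2)) * gauss s).
Proof.
  evar_last. apply (is_derive_RInt_param gJ 0 1 s).
  - exists (mkposreal 1 Rlt_0_1). intros x _ t _. eexists. apply is_derive_gJ.
  - intros t _. apply continuity_2d_pt_ext with (fun u v => - 2 * u * exp (- (PI * u ^ 2 * (1 + v ^ 2)))).
    + intros u v. symmetry. apply is_derive_unique. apply is_derive_gJ.
    + apply continuity_2d_pt_mult. apply continuity_2d_pt_mult. apply continuity_2d_pt_const. apply continuity_2d_pt_id1.
      apply (continuity_1d_2d_pt_comp exp).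
      * apply derivable_continuous_pt. apply derivable_pt_exp.
      * apply continuity_2d_pt_opp. apply continuity_2d_pt_mult.
        apply continuity_2d_pt_mult. apply continuity_2d_pt_const.
        apply continuity_2d_pt_ext with (fun u v => u * u). intros; ring.
        apply continuity_2d_pt_mult; apply continuity_2d_pt_id1.
        apply continuity_2d_pt_plus. apply continuity_2d_pt_const.
        apply continuity_2d_pt_ext with (fun u v => v * v). intros; ring.
        apply continuity_2d_pt_mult; apply continuity_2d_pt_id2.
  - exists (mkposreal 1 Rlt_0_1). intros x _. rap (ex_RInt_continuous _ _ _). intros; apply continuous_gJ.
  - rewrite gauss_scaled. rewrite <- Rmult_assoc.
    match goal with |- _ = ?c * RInt ?f ?a ?b => change (c * RInt f a b) with (scal c (RInt f a b)) end.
    rewrite <- RInt_scal.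
    + apply RInt_ext. intros t _. transitivity (- 2 * s * exp (- (PI * s ^ 2 * (1 + t ^ 2)))).
      apply is_derive_unique. apply is_derive_gJ.
      unfold scal; simpl; unfold mult; simpl.
      replace (- (PI * (s * (s * 1)) * (1 + t * (t * 1)))) with (- (PI * (s * (s * 1))) + - (PI * (t * s * (t * s * 1)))) by ring.
      rewrite exp_plus. ring.
    + rap (ex_RInt_continuous _ _ _). intros t _. rap (ex_derive_continuous _ _ _). auto_derive. auto.
Qed.

Lemma gauss_0 : gauss 0 = 0.
Proof. unfold gauss. rewrite Cmult_0_r, Gp_0. reflexivity. Qed.

Lemma RInt_gJ_0 : RInt (gJ 0) 0 1 = 1 / 4.
Proof.
  apply is_RInt_unique. pose proof PI_RGT_0.
  replace (1 / 4) with (minus (atan 1 / PI) (atan 0 / PI)).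
  2: { rewrite atan_1, atan_0. unfold minus, plus, opp; simpl. field. lra. }
  apply (is_RInt_derive (fun x => atan x / PI)).
  - intros x _. unfold gJ. auto_derive. auto.
    replace (- (PI * 0 ^ 2 * (1 + x ^ 2))) with 0 by ring. rewrite exp_0. field. split; [|lra]. nra.
  - intros x _. apply continuous_gJ.
Qed.

Lemma RInt_gJ_bound s : 0 <= RInt (gJ s) 0 1 <= exp (- (PI * s ^ 2)) / 2.
Proof.
  assert (Hi : ex_RInt (gJ s) 0 1) by (rap (ex_RInt_continuous _ _ _); intros; apply continuous_gJ).
  assert (Hp : forall t, 0 < gJ s t).
  { intros t. unfold gJ. apply Rdiv_lt_0_compat. apply exp_pos. apply gJ_den. }
  split.
  - apply RInt_ge_0; auto. lra. intros; left; apply Hp.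
  - replace (exp (- (PI * s ^ 2)) / 2) with (RInt (fun _ => exp (- (PI * s ^ 2)) / 2) 0 1).
    2: { rewrite RInt_const. unfold scal; simpl; unfold mult; simpl. ring. }
    apply RInt_le; auto. lra. rap (ex_RInt_const 0 1 _).
    (* Since pi > 3 the denominator is at least 2. *)
    intros t Ht. unfold gJ. pose proof PI2_3_2. unfold PI2 in *. pose proof PI_RGT_0.
    assert (exp (- (PI * s ^ 2 * (1 + t ^ 2))) <= exp (- (PI * s ^ 2))).
    { apply exp_le_mono. assert (0 <= PI * s ^ 2 * t ^ 2). apply Rmult_le_pos; [|nra]. nra. nra. }
    apply Rmult_le_compat. left; apply exp_pos. left; apply Rinv_0_lt_compat, gJ_den. assumption.
    apply Rinv_le_contravar. lra. nra.
Qed.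

Lemma gauss_sqr s : gauss s ^ 2 = 1 / 4 - RInt (gJ s) 0 1.
Proof.
  assert (H : forall x, is_derive (fun x => gauss x ^ 2 + RInt (gJ x) 0 1) x 0).
  { intros x. evar_last. rap (is_derive_plus _ _ _ _ _ _ _).
    apply (is_derive_pow gauss 2). apply is_derive_gauss. apply is_derive_RInt_gJ.
    unfold plus; simpl. ring. }
  assert (E : gauss s ^ 2 + RInt (gJ s) 0 1 = gauss 0 ^ 2 + RInt (gJ 0) 0 1).
  { destruct (MVT_gen (fun x => gauss x ^ 2 + RInt (gJ x) 0 1) 0 s (fun _ => 0)) as [c [_ Hc]].
    intros; apply H. intros. apply continuity_pt_filterlim. rap (ex_derive_continuous _ _ _). eexists; apply H. lra. }
  rewrite RInt_gJ_0, gauss_0 in E. lra.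
Qed.

Lemma gauss_pos s : 0 <= s -> 0 <= gauss s.
Proof.
  intros H. rewrite gauss_scaled. apply Rmult_le_pos; auto. apply RInt_ge_0. lra.
  rap (ex_RInt_continuous _ _ _). intros t _. rap (ex_derive_continuous _ _ _). auto_derive. auto.
  intros; left; apply exp_pos.
Qed.

(** From (1/2 - g) (1/2 + g) = J <= e / 2 and g >= 0. *)
Lemma gauss_limit s : 0 <= s -> Rabs (gauss s - 1 / 2) <= exp (- (PI * s ^ 2)).
Proof.
  intros H. pose proof (gauss_sqr s). pose proof (RInt_gJ_bound s). pose proof (gauss_pos s H).
  apply Rabs_le. set (g := gauss s) in *. set (J := RInt (gJ s) 0 1) in *. set (e := exp (- (PI * s ^ 2))) in *.
  split; nra.
Qed.

(** Compare with the point i Im t at the same height. On the horizontal segment to t the real part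
    of w^2 never exceeds Re (t^2), so the integrand is small there; on the imaginary axis
    [gauss_limit] applies, because the sector gives kap |t|^2 <= (Im t)^2. *)
Lemma Gp_limit (t : C) (kap : R) : 0 < kap -> 0 < Im t -> Re (t * t) <= - kap * Cmod t ^ 2 ->
  Cmod (Gp t - Ci / 2) <= (Cmod t + 1) * exp (- (PI * kap * Cmod t ^ 2)).
Proof.
  intros Hk Hi Hs. pose proof PI_RGT_0 as Hpi. pose proof (Cmod_ge_0 t) as H0. pose proof (Cmod_sqr t) as Hm.
  reim. rewrite Re_mult in Hs.
  assert (Hi2 : kap * Cmod t ^ 2 <= Im t ^ 2) by nra.
  apply Rle_trans with (Cmod (Gp t - Gp (Ci * Im t)) + Cmod (Gp (Ci * Im t) - Ci / 2)).
  apply Cmod_tri3. rewrite Rmult_plus_distr_r. apply Rplus_le_compat.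
  - replace (Gp t) with (Gp (Ci * Im t + Re t)%C).
    2: { f_equal. apply C_ext; repeat progress reim; ring. }
    apply Rle_trans with (exp (- (PI * kap * Cmod t ^ 2)) * Cmod (Re t)).
    + apply holo_deriv_mvt with E2. intros; apply holo_deriv_Gp. intros s Hs'. rewrite Cmod_E2. apply exp_le_mono.
      repeat progress reim.
      replace (0 * Im t - 1 * 0 + (s * Re t - 0 * 0)) with (s * Re t) by ring.
      replace (0 * 0 + 1 * Im t + (s * 0 + 0 * Re t)) with (Im t) by ring.
      assert ((s * Re t) ^ 2 <= Re t ^ 2) by (rewrite Rpow_mult_distr; assert (s ^ 2 <= 1) by nra; pose proof (pow2_ge_0 (Re t)); pose proof (pow2_ge_0 s); nra).
      apply Rle_trans with (PI * (- kap * Cmod t ^ 2)). apply Rmult_le_compat_l; lra. right; ring.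
    + rewrite Rmult_comm, Cmod_R. apply Rmult_le_compat_r. left; apply exp_pos. apply Rabs_Re_le.
  - rewrite Gp_im.
    replace (Ci * gauss (Im t) - Ci / 2)%C with (Ci * (gauss (Im t) - 1 / 2)%R)%C.
    2: { rewrite RtoC_minus, RtoC_div by lra. field. }
    rewrite Cmod_mult, Cmod_R, Cmod_Ci, !Rmult_1_l.
    apply Rle_trans with (1 := gauss_limit _ (Rlt_le _ _ Hi)). apply exp_le_mono. nra.
Qed.

Lemma exp_opp_le (x : R) : 0 <= x -> exp (- x) <= / (1 + x).
Proof.
  intros H. rewrite exp_Ropp. apply Rinv_le_contravar. lra.
  destruct (Req_dec x 0) as [->|H0]. rewrite exp_0; lra. left. apply exp_ineq1. auto.
Qed.

(** This uniform bound dominates the series over n; [Gp_limit_rate] supplies the termwise limit. *)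
Lemma Gp_limit_bound (t : C) (kap : R) : 0 < kap -> 0 < Im t -> Re (t * t) <= - kap * Cmod t ^ 2 ->
  Cmod (Gp t - Ci / 2) <= 2 + / (PI * kap).
Proof.
  intros Hk Hi Hs. apply Rle_trans with (1 := Gp_limit t kap Hk Hi Hs).
  pose proof PI_RGT_0 as Hpi. pose proof (Cmod_ge_0 t) as H0. set (x := Cmod t) in *.
  assert (HP : 0 < PI * kap) by nra. assert (HP' := Rinv_0_lt_compat _ HP).
  assert (Hy : 0 <= PI * kap * x ^ 2) by nra.
  apply Rle_trans with ((x + 1) * / (1 + PI * kap * x ^ 2)).
  apply Rmult_le_compat_l. lra. now apply exp_opp_le.
  apply Rmult_le_reg_r with (1 + PI * kap * x ^ 2). lra.
  rewrite Rmult_assoc, Rinv_l, Rmult_1_r by lra.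
  replace ((2 + / (PI * kap)) * (1 + PI * kap * x ^ 2))
    with (2 + / (PI * kap) + 2 * (PI * kap * x ^ 2) + (/ (PI * kap) * (PI * kap)) * x ^ 2) by ring.
  rewrite Rinv_l by lra. nra.
Qed.

Lemma Gp_limit_rate (t : C) (kap : R) : 0 < kap -> 0 < Im t -> Re (t * t) <= - kap * Cmod t ^ 2 ->
  1 <= Cmod t -> Cmod (Gp t - Ci / 2) <= 2 / (PI * kap) / Cmod t.
Proof.
  intros Hk Hi Hs H1. apply Rle_trans with (1 := Gp_limit t kap Hk Hi Hs).
  pose proof PI_RGT_0 as Hpi. set (x := Cmod t) in *.
  assert (HP : 0 < PI * kap) by nra.
  assert (Hy : 0 < PI * kap * x ^ 2) by (apply Rmult_lt_0_compat; nra).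
  apply Rle_trans with ((2 * x) * / (PI * kap * x ^ 2)).
  - apply Rmult_le_compat. lra. left; apply exp_pos. lra.
    apply Rle_trans with (/ (1 + PI * kap * x ^ 2)). apply exp_opp_le; lra. apply Rinv_le_contravar; lra.
  - right. field. split; [|split]; lra.
Qed.

(** * The principal square root *)

Lemma Cexp_Clog (z : C) : z <> 0 -> Cexp (Clog z) = z.
Proof.
  intros Hz. pose proof (Cmod_gt_0 z) as Hm. assert (H0 : 0 < Cmod z) by (now apply Hm).
  assert (Hb : -1 <= Re z / Cmod z <= 1).
  { pose proof (Rabs_Re_le z) as H. apply Rabs_le_between in H.
    split; [apply Rle_div_r | apply Rle_div_l]; lra. }
  assert (Hs : sqrt (1 - (Re z / Cmod z)²) = Rabs (Im z) / Cmod z).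
  { apply sqrt_lem_1.
    - pose proof (Cmod_sqr z). unfold Rsqr. nra.
    - apply Rdiv_le_0_compat. apply Rabs_pos. lra.
    - pose proof (Cmod_sqr z) as H. rewrite <- (pow2_abs (Im z)) in H. unfold Rsqr.
      apply Rmult_eq_reg_r with (Cmod z ^ 2). 2: nra. field_simplify; lra. }
  assert (Hc : cos (Carg z) = Re z / Cmod z).
  { unfold Carg. destruct (Rle_dec 0 (Im z)); rewrite ?cos_neg; now apply cos_acos. }
  assert (Hsn : sin (Carg z) = Im z / Cmod z).
  { unfold Carg. destruct (Rle_dec 0 (Im z)) as [h|h]; rewrite ?sin_neg, sin_acos, Hs by lra.
    - rewrite Rabs_pos_eq; lra.
    - rewrite Rabs_left by lra. field. lra. }
  apply C_ext; repeat progress reim; unfold Clog; reim; rewrite exp_ln, ?Hc, ?Hsn by lra; field; lra.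
Qed.

Lemma Csqrt_sqr (z : C) : z <> 0 -> (Csqrt z * Csqrt z = z)%C.
Proof.
  intros Hz. unfold Csqrt, Cpower. rewrite <- Cexp_plus.
  replace (1 / 2 * Clog z + 1 / 2 * Clog z)%C with (Clog z) by field. now apply Cexp_Clog.
Qed.

Lemma Csqrt_neq0 (z : C) : Csqrt z <> 0.
Proof. apply Cexp_neq0. Qed.

Lemma Cpower_opp_half (z : C) : Cpower z (- (1 / 2)) = (/ Csqrt z)%C.
Proof. unfold Csqrt, Cpower. rewrite <- Cexp_opp. f_equal. ring. Qed.

Lemma Csqrt_Re_ge0 (z : C) : 0 <= Re (Csqrt z).
Proof.
  unfold Csqrt, Cpower. rewrite Re_Cexp. apply Rmult_le_pos. left; apply exp_pos.
  assert (E : Im (1 / 2 * Clog z) = Carg z / 2).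
  { replace (1 / 2 : C)%C with (RtoC (1 / 2)) by (rewrite RtoC_div by lra; reflexivity).
    reim. unfold Clog. reim. field. }
  rewrite E. unfold Carg.
  pose proof (acos_bound (Re z / Cmod z)).
  apply cos_ge_0; destruct (Rle_dec 0 (Im z)); lra.
Qed.

Definition slit (z : C) : Prop := 0 < Re z \/ Im z <> 0.

Lemma slit_neq0 z : slit z -> z <> 0.
Proof. intros [H|H] E; rewrite E in H; simpl in H; lra. Qed.

Lemma Csqrt_Re_pos (z : C) : slit z -> 0 < Re (Csqrt z).
Proof.
  intros Hz. destruct (Csqrt_Re_ge0 z) as [H|H]; auto. exfalso.
  pose proof (Csqrt_sqr z (slit_neq0 z Hz)) as E.
  assert (E1 := f_equal Re E). assert (E2 := f_equal Im E). rewrite Re_mult in E1. rewrite Im_mult in E2.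
  rewrite <- H in E1, E2. destruct Hz as [Hz|Hz]; nra.
Qed.

Lemma Csqr_eq (a b : C) : (a * a = b * b)%C -> a = b \/ a = (- b)%C.
Proof.
  intros H. destruct (Ceq_dec a b) as [E|E]; auto. right.
  assert (H1 : ((a - b) * (a + b) = 0)%C).
  { replace ((a - b) * (a + b))%C with (a * a - b * b)%C by ring. rewrite H. ring. }
  destruct (Ceq_dec (a + b)%C 0) as [E1|E1].
  - replace a with (a + b - b)%C by ring. rewrite E1. ring.
  - exfalso. apply (Cmult_neq_0 (a - b) (a + b))%C; auto.
    intros E2. apply E. replace a with (a - b + b)%C by ring. rewrite E2. ring.
Qed.

Lemma Csqrt_unique (y z : C) : (y * y = z)%C -> 0 < Re y -> Csqrt z = y.
Proof.
  intros H Hy.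
  assert (Hz : z <> 0).
  { rewrite <- H. apply Cmult_neq_0; intros E; rewrite E in Hy; simpl in Hy; lra. }
  pose proof (Csqrt_Re_ge0 z). pose proof (Csqrt_sqr z Hz) as E. rewrite <- H in E at 3.
  destruct (Csqr_eq _ _ E) as [E1|E1]; auto. rewrite E1, Re_opp in *. lra.
Qed.

Lemma Csqrt_upper (z : C) : 0 < Im z -> 0 < Re (Csqrt z) /\ 0 < Im (Csqrt z).
Proof.
  intros H. assert (Hs : slit z) by (right; lra). pose proof (Csqrt_Re_pos z Hs) as H1. split; auto.
  pose proof (Csqrt_sqr z (slit_neq0 z Hs)) as E. apply (f_equal Im) in E. rewrite Im_mult in E. nra.
Qed.

(** Roots of upper half-plane points lie in the open first quadrant, and a product of two such
    points has positive imaginary part, which decides the sign. *)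
Lemma Csqrt_mult_upper (x y : C) : 0 < Im x -> 0 < Im y -> 0 < Im (x * y) ->
  Csqrt (x * y) = (Csqrt x * Csqrt y)%C.
Proof.
  intros Hx Hy Hxy. destruct (Csqrt_upper x Hx), (Csqrt_upper y Hy), (Csqrt_upper _ Hxy).
  assert (E : (Csqrt (x * y) * Csqrt (x * y) = (Csqrt x * Csqrt y) * (Csqrt x * Csqrt y))%C).
  { replace (Csqrt x * Csqrt y * (Csqrt x * Csqrt y))%C with ((Csqrt x * Csqrt x) * (Csqrt y * Csqrt y))%C by ring.
    rewrite !Csqrt_sqr; auto; apply slit_neq0; right; lra. }
  destruct (Csqr_eq _ _ E) as [E1|E1]; auto. exfalso. rewrite E1, Im_opp, Im_mult in *. nra.
Qed.

(** The product of the two roots has argument in (0, pi); the factor -i turns it into the right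
    half-plane, where it is the principal root. *)
Lemma Csqrt_opp_mult_upper (x y : C) : 0 < Im x -> 0 < Im y ->
  Csqrt (- (x * y)) = (- Ci * (Csqrt x * Csqrt y))%C.
Proof.
  intros Hx Hy. destruct (Csqrt_upper x Hx), (Csqrt_upper y Hy).
  apply Csqrt_unique.
  - replace (- Ci * (Csqrt x * Csqrt y) * (- Ci * (Csqrt x * Csqrt y)))%C
      with ((Ci * Ci) * ((Csqrt x * Csqrt x) * (Csqrt y * Csqrt y)))%C by ring.
    rewrite Ci2, !Csqrt_sqr; [ring| |]; apply slit_neq0; right; lra.
  - rewrite Re_mult, Re_opp, Im_opp, Re_Ci, Im_Ci, Im_mult. nra.
Qed.

Lemma Csqrt_lipschitz (z k : C) : slit z -> (z + k)%C <> 0 ->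
  Cmod (Csqrt (z + k) - Csqrt z) * Re (Csqrt z) <= Cmod k.
Proof.
  intros Hz Hzk. set (a := Csqrt z). set (b := Csqrt (z + k)).
  pose proof (Csqrt_Re_pos z Hz) as Ha. fold a in Ha. pose proof (Csqrt_Re_ge0 (z + k)) as Hb. fold b in Hb.
  pose proof (Csqrt_sqr z (slit_neq0 z Hz)) as Ea. fold a in Ea. pose proof (Csqrt_sqr _ Hzk) as Eb. fold b in Eb.
  replace k with ((b - a) * (a + b))%C.
  2: { transitivity (b * b - a * a)%C. ring. rewrite Ea, Eb. ring. }
  rewrite Cmod_mult. apply Rmult_le_compat_l. apply Cmod_ge_0.
  apply Rle_trans with (2 := Re_le_Cmod _). rewrite Re_plus. lra.
Qed.

(* With a = sqrt z and b = sqrt (z + k) the remainder is - (b - a)^2 / (2 a), and b - a = k / (a + b). *)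
Lemma holo_deriv_Csqrt (z : C) : slit z -> holo_deriv Csqrt z (/ (2 * Csqrt z)).
Proof.
  intros Hz. set (a := Csqrt z). pose proof (Csqrt_Re_pos z Hz) as Ha. fold a in Ha.
  assert (Hz0 := slit_neq0 z Hz). pose proof (Csqrt_sqr z Hz0) as Ea. fold a in Ea.
  assert (Ha0 : a <> 0) by apply Csqrt_neq0.
  assert (Hm : 0 < Cmod a) by (now apply Cmod_gt_0).
  apply (holo_deriv_of_quadratic _ _ _ (/ (2 * Cmod a * Re a ^ 2)) (Cmod z)). now apply Cmod_gt_0.
  intros k Hk. fold a.
  assert (Hzk : (z + k)%C <> 0).
  { intros E. assert (Cmod z = Cmod k). replace z with (z + k - k)%C by ring. rewrite E.
    replace (0 - k)%C with (- k)%C by ring. apply Cmod_opp. lra. }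
  set (b := Csqrt (z + k)). pose proof (Csqrt_Re_ge0 (z + k)) as Hb. fold b in Hb.
  pose proof (Csqrt_sqr _ Hzk) as Eb. fold b in Eb.
  assert (Ek : k = ((b - a) * (a + b))%C).
  { transitivity (b * b - a * a)%C. rewrite Ea, Eb. ring. ring. }
  replace (b - a - k * / (2 * a))%C with (- ((b - a) * (b - a)) * / (2 * a))%C.
  2: { rewrite Ek. field. auto. }
  rewrite Cmod_mult, Cmod_inv, Cmod_opp, !Cmod_mult.
  2: { apply Cmult_neq_0; auto. intros E; injection E; lra. }
  rewrite Cmod_R, (Rabs_pos_eq 2) by lra.
  pose proof (Csqrt_lipschitz z k Hz Hzk) as Hba. fold a b in Hba.
  apply Rle_trans with ((Cmod (b - a) * Re a) ^ 2 * / (2 * Cmod a * Re a ^ 2)).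
  - right. field. split; lra.
  - rewrite Rmult_comm. apply Rmult_le_compat_l.
    + left. apply Rinv_0_lt_compat. apply Rmult_lt_0_compat. lra. apply pow_lt. lra.
    + apply pow_incr. split; auto. apply Rmult_le_pos. apply Cmod_ge_0. lra.
Qed.

(** * Dominated series over the integers *)

Lemma is_series_telescope (N : nat) :
  is_series (fun n => / ((INR (n + N) + 1) * (INR (n + N) + 2))) (/ (INR N + 1)).
Proof.
  assert (Hs : forall M, sum_n (fun n => / ((INR (n + N) + 1) * (INR (n + N) + 2))) M
                         = / (INR N + 1) - / (INR (M + N) + 2)).
  { induction M as [|M IH].
    - rewrite sum_O. simpl. pose proof (pos_INR N). field. lra.
    - rewrite sum_Sn, IH. unfold plus; simpl plus.
      pose proof (pos_INR (M + N)). pose proof (pos_INR N).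
      replace (INR (S M + N)) with (INR (M + N) + 1) by (simpl Nat.add; rewrite S_INR; ring).
      toR. simpl. field. repeat split; lra. }
  change (is_lim_seq (sum_n (fun n : nat => / ((INR (n + N) + 1) * (INR (n + N) + 2)))) (/ (INR N + 1))).
  apply (is_lim_seq_ext (fun M => / (INR N + 1) - / (INR (M + N) + 2))).
  intros M. symmetry. apply Hs.
  replace (Finite (/ (INR N + 1))) with (Finite (/ (INR N + 1) - 0)) by (f_equal; ring).
  apply is_lim_seq_minus'. apply is_lim_seq_const.
  apply (is_lim_seq_le_le (fun _ => 0) _ (fun M => / (INR M + 1))).
  - intros M. pose proof (pos_INR M). pose proof (pos_INR N). split.
    left; apply Rinv_0_lt_compat. pose proof (pos_INR (M + N)); lra.
    apply Rinv_le_contravar. lra. rewrite plus_INR. lra.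
  - apply is_lim_seq_const.
  - apply (is_lim_seq_ext (fun n => / INR (S n))). intros; now rewrite S_INR.
    apply (is_lim_seq_incr_1 (fun n => / INR n)).
    replace (Finite 0) with (Rbar_inv p_infty) by reflexivity. apply is_lim_seq_inv. apply is_lim_seq_INR. discriminate.
Qed.

(** [sum_n a M] has M + 1 terms, so the match is the sum of the first N terms in every case. *)
Lemma Series_tail_bound (a : nat -> R) (K : R) :
  (forall n, Rabs (a n) <= K * / ((INR n + 1) * (INR n + 2))) ->
  ex_series a /\ forall N, Rabs (Series a - match N with O => 0 | S M => sum_n a M end) <= K * / (INR N + 1).
Proof.
  intros H.
  assert (Hb : forall N, ex_series (fun n => Rabs (a (n + N)%nat)) /\
                        Series (fun n => Rabs (a (n + N)%nat)) <= K * / (INR N + 1)).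
  { intros N.
    assert (Hk : is_series (fun n => K * / ((INR (n + N) + 1) * (INR (n + N) + 2))) (K * / (INR N + 1))).
    { rap (is_series_scal_l _ _ _ _). apply is_series_telescope. }
    assert (He : ex_series (fun n => Rabs (a (n + N)%nat))).
    { eapply (ex_series_le (V := R_CompleteNormedModule)). 2: { eexists; exact Hk. }
      intros n. unfold norm; simpl. unfold abs; simpl. rewrite Rabs_Rabsolu. apply H. }
    split; auto. rewrite <- (is_series_unique _ _ Hk). apply Series_le. 2: eexists; exact Hk.
    intros n. split. apply Rabs_pos. apply H. }
  assert (Hex : ex_series a).
  { apply ex_series_Rabs. destruct (Hb O) as [He _].
    eapply ex_series_ext; [|exact He]. intros n. cbv beta. now rewrite Nat.add_0_r. }
  split; auto. intros [|M].
  - rewrite Rminus_0_r. destruct (Hb O) as [He Hle].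
    apply Rle_trans with (2 := Hle).
    replace (fun n => Rabs (a (n + 0)%nat)) with (fun n => Rabs (a n)) in *
      by (apply functional_extensionality; intros; now rewrite Nat.add_0_r).
    now apply Series_Rabs.
  - rewrite (Series_incr_n a (S M)) by (auto; lia).
    destruct (Hb (S M)) as [He Hle]. apply Rle_trans with (2 := Hle).
    replace (sum_f_R0 a (pred (S M)) + Series (fun k => a (S M + k)%nat) - sum_n a M)
      with (Series (fun k => a (k + S M)%nat)).
    2: { simpl pred. rewrite sum_n_Reals.
         replace (fun k => a (S M + k)%nat) with (fun k => a (k + S M)%nat) by
           (apply functional_extensionality; intros; f_equal; lia). toR. ring. }
    now apply Series_Rabs.
Qed.

(** One summable majorant for every series of the development. [Series] has a value even when the
    series diverges, so the linear and limiting manipulations of [ZSeries] carry a bound by a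
    multiple of it. *)
Definition Zb (n : Z) : R := / (1 + IZR n ^ 2).

Definition Zbounded (f : Z -> C) (K : R) : Prop := forall n, Cmod (f n) <= K * Zb n.

Lemma Zb_pos n : 0 < Zb n.
Proof. apply Rinv_0_lt_compat. pose proof (pow2_ge_0 (IZR n)). lra. Qed.

Lemma Zbounded_nonneg f K : Zbounded f K -> 0 <= K.
Proof.
  intros H. specialize (H 0%Z). pose proof (Cmod_ge_0 (f 0%Z)). pose proof (Zb_pos 0).
  assert (0 <= K * Zb 0) by lra. destruct (Rle_or_lt 0 K); auto. nra.
Qed.

(** The window is -N <= n < N: n is paired with -n - 1, which is m with -m for m = n + 1/2, as in
    [ZSeries]. *)
Fixpoint Zpart (f : Z -> C) (N : nat) : C :=
  match N with
  | O => 0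
  | S N => (Zpart f N + (f (Z.of_nat N) + f (- Z.of_nat N - 1)%Z))%C
  end.

Lemma Zb_le_pos (n : nat) : Zb (Z.of_nat n) <= 4 * / ((INR n + 1) * (INR n + 2)).
Proof.
  unfold Zb. rewrite <- INR_IZR_INZ. pose proof (pos_INR n). set (x := INR n) in *.
  apply Rmult_le_reg_l with ((1 + x ^ 2) * ((x + 1) * (x + 2))). nra.
  field_simplify; nra.
Qed.

Lemma Zb_le_neg (n : nat) : Zb (- Z.of_nat n - 1) <= 4 * / ((INR n + 1) * (INR n + 2)).
Proof.
  apply Rle_trans with (2 := Zb_le_pos n). unfold Zb.
  rewrite minus_IZR, opp_IZR, <- INR_IZR_INZ. pose proof (pos_INR n).
  apply Rinv_le_contravar; nra.
Qed.

Lemma ZSeries_approx f K : Zbounded f K -> forall N, Cmod (ZSeries f - Zpart f N) <= 16 * K * / (INR N + 1).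
Proof.
  intros H N. pose proof (Zbounded_nonneg f K H) as HK.
  assert (A1 : forall n, Cmod (f (Z.of_nat n)) <= 4 * K * / ((INR n + 1) * (INR n + 2))).
  { intros n. apply Rle_trans with (1 := H _). pose proof (Zb_le_pos n). nra. }
  assert (A2 : forall n, Cmod (f (- Z.of_nat n - 1)%Z) <= 4 * K * / ((INR n + 1) * (INR n + 2))).
  { intros n. apply Rle_trans with (1 := H _). pose proof (Zb_le_neg n). nra. }
  (* Real and imaginary parts of the two halves give four real series, each with tail at most 4 K /
     (N + 1); this is the constant 16. *)
  destruct (Series_tail_bound (fun n => Re (f (Z.of_nat n))) (4 * K)) as [_ B1].
  { intros n. apply Rle_trans with (1 := Rabs_Re_le _). apply A1. }
  destruct (Series_tail_bound (fun n => Im (f (Z.of_nat n))) (4 * K)) as [_ B2].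
  { intros n. apply Rle_trans with (1 := Rabs_Im_le _). apply A1. }
  destruct (Series_tail_bound (fun n => Re (f (- Z.of_nat n - 1)%Z)) (4 * K)) as [_ B3].
  { intros n. apply Rle_trans with (1 := Rabs_Re_le _). apply A2. }
  destruct (Series_tail_bound (fun n => Im (f (- Z.of_nat n - 1)%Z)) (4 * K)) as [_ B4].
  { intros n. apply Rle_trans with (1 := Rabs_Im_le _). apply A2. }
  specialize (B1 N). specialize (B2 N). specialize (B3 N). specialize (B4 N).
  assert (E : Re (Zpart f N) = match N with O => 0 | S M => sum_n (fun n => Re (f (Z.of_nat n))) M end
                             + match N with O => 0 | S M => sum_n (fun n => Re (f (- Z.of_nat n - 1)%Z)) M end
            /\ Im (Zpart f N) = match N with O => 0 | S M => sum_n (fun n => Im (f (Z.of_nat n))) M end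
                             + match N with O => 0 | S M => sum_n (fun n => Im (f (- Z.of_nat n - 1)%Z)) M end).
  { clear. induction N as [|N [IH1 IH2]]. simpl; lra.
    cbn [Zpart]. rewrite !Re_plus, !Im_plus, IH1, IH2. destruct N as [|M].
    rewrite !sum_O. lra. rewrite !sum_Sn. unfold plus; simpl plus. split; simpl; lra. }
  destruct E as [E1 E2].
  apply Rle_trans with (1 := Cmod_le_ReIm _). rewrite Re_minus, Im_minus, E1, E2.
  unfold ZSeries, CSeries. rewrite Re_plus, Im_plus, !Re_pair, !Im_pair.
  match goal with |- Rabs (?a + ?b - (?c + ?d)) + Rabs (?a' + ?b' - (?c' + ?d')) <= _ =>
    replace (a + b - (c + d)) with ((a - c) + (b - d)) by ring;
    replace (a' + b' - (c' + d')) with ((a' - c') + (b' - d')) by ring;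
    pose proof (Rabs_triang (a - c) (b - d)); pose proof (Rabs_triang (a' - c') (b' - d')) end.
  lra.
Qed.

Definition Zlim (f : Z -> C) (L : C) : Prop :=
  forall eps, 0 < eps -> exists N0 : nat, forall N, (N0 <= N)%nat -> Cmod (Zpart f N - L) <= eps.

Lemma small_inv (K eps : R) : 0 < eps -> exists N0 : nat, forall N, (N0 <= N)%nat -> K * / (INR N + 1) <= eps.
Proof.
  intros He. destruct (INR_unbounded (Rabs K / eps)) as [N0 HN]. exists N0. intros N HNN.
  apply le_INR in HNN. pose proof (pos_INR N).
  apply Rle_trans with (Rabs K * / (INR N + 1)).
  apply Rmult_le_compat_r. left; apply Rinv_0_lt_compat; lra. apply Rle_abs.
  apply Rmult_le_reg_r with (INR N + 1). lra. rewrite Rmult_assoc, Rinv_l, Rmult_1_r by lra.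
  apply Rlt_div_l in HN; nra.
Qed.

Lemma ZSeries_lim f K : Zbounded f K -> Zlim f (ZSeries f).
Proof.
  intros H eps He. destruct (small_inv (16 * K) eps He) as [N0 HN]. exists N0. intros N HNN.
  rewrite Cmod_minus_sym. apply Rle_trans with (1 := ZSeries_approx f K H N). now apply HN.
Qed.

Lemma Cmod_le_all_eps (a b : C) : (forall eps, 0 < eps -> Cmod (a - b) <= eps) -> a = b.
Proof.
  intros H. assert (Cmod (a - b) = 0).
  { pose proof (Cmod_ge_0 (a - b)). destruct (Req_dec (Cmod (a - b)) 0); auto.
    specialize (H (Cmod (a - b) / 2) ltac:(lra)). lra. }
  replace a with (a - b + b)%C by ring. rewrite (Cmod_eq_0 _ H0). ring.
Qed.

Lemma Zlim_unique f L L' : Zlim f L -> Zlim f L' -> L = L'.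
Proof.
  intros H1 H2. apply Cmod_le_all_eps. intros eps He.
  destruct (H1 (eps / 2)) as [N1 A1]. lra. destruct (H2 (eps / 2)) as [N2 A2]. lra.
  specialize (A1 (max N1 N2) ltac:(lia)). specialize (A2 (max N1 N2) ltac:(lia)).
  apply Rle_trans with (1 := Cmod_tri3 L (Zpart f (max N1 N2)) L'). rewrite Cmod_minus_sym. lra.
Qed.

Lemma ZSeries_unique f K L : Zbounded f K -> Zlim f L -> ZSeries f = L.
Proof. intros H1 H2. eapply Zlim_unique; eauto. now apply ZSeries_lim with K. Qed.

Lemma ZSeries_ext f g : (forall n, f n = g n) -> ZSeries f = ZSeries g.
Proof. intros H. f_equal. now apply functional_extensionality. Qed.

Lemma Zpart_plus f g N : Zpart (fun n => f n + g n)%C N = (Zpart f N + Zpart g N)%C.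
Proof. induction N; simpl. ring. rewrite IHN. ring. Qed.

Lemma Zpart_scal c f N : Zpart (fun n => c * f n)%C N = (c * Zpart f N)%C.
Proof. induction N; simpl. ring. rewrite IHN. ring. Qed.

Lemma Zbounded_plus f g K K' : Zbounded f K -> Zbounded g K' -> Zbounded (fun n => f n + g n)%C (K + K').
Proof.
  intros H1 H2 n. apply Rle_trans with (1 := Cmod_triangle _ _). specialize (H1 n). specialize (H2 n). lra.
Qed.

Lemma Zbounded_scal c f K : Zbounded f K -> Zbounded (fun n => c * f n)%C (Cmod c * K).
Proof.
  intros H n. rewrite Cmod_mult, Rmult_assoc. apply Rmult_le_compat_l. apply Cmod_ge_0. apply H.
Qed.

Lemma ZSeries_plus f g K K' : Zbounded f K -> Zbounded g K' ->
  ZSeries (fun n => f n + g n)%C = (ZSeries f + ZSeries g)%C.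
Proof.
  intros H1 H2. apply (ZSeries_unique _ _ _ (Zbounded_plus _ _ _ _ H1 H2)). intros eps He.
  destruct (ZSeries_lim f K H1 (eps / 2)) as [N1 A1]. lra.
  destruct (ZSeries_lim g K' H2 (eps / 2)) as [N2 A2]. lra.
  exists (max N1 N2). intros N HN. specialize (A1 N ltac:(lia)). specialize (A2 N ltac:(lia)).
  rewrite Zpart_plus.
  replace (Zpart f N + Zpart g N - (ZSeries f + ZSeries g))%C
    with ((Zpart f N - ZSeries f) + (Zpart g N - ZSeries g))%C by ring.
  apply Rle_trans with (1 := Cmod_triangle _ _). lra.
Qed.

Lemma ZSeries_scal c f K : Zbounded f K -> ZSeries (fun n => c * f n)%C = (c * ZSeries f)%C.
Proof.
  intros H. apply (ZSeries_unique _ _ _ (Zbounded_scal c _ _ H)). intros eps He.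
  pose proof (Cmod_ge_0 c).
  destruct (ZSeries_lim f K H (eps / (Cmod c + 1))) as [N1 A1]. apply Rdiv_lt_0_compat; lra.
  exists N1. intros N HN. specialize (A1 N HN). rewrite Zpart_scal.
  replace (c * Zpart f N - c * ZSeries f)%C with (c * (Zpart f N - ZSeries f))%C by ring.
  rewrite Cmod_mult. apply Rle_trans with ((Cmod c + 1) * (eps / (Cmod c + 1))).
  apply Rmult_le_compat; try apply Cmod_ge_0; lra. right; field; lra.
Qed.

Lemma ZSeries_minus f g K K' : Zbounded f K -> Zbounded g K' ->
  ZSeries (fun n => f n - g n)%C = (ZSeries f - ZSeries g)%C.
Proof.
  intros H1 H2. rewrite (ZSeries_ext _ (fun n => f n + (-1) * g n)%C) by (intros; ring).
  rewrite (ZSeries_plus _ _ _ _ H1 (Zbounded_scal _ _ _ H2)), (ZSeries_scal _ _ _ H2). ring.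
Qed.

Lemma ZSeries_norm f K : Zbounded f K -> Cmod (ZSeries f) <= 16 * K.
Proof.
  intros H. pose proof (ZSeries_approx f K H 0) as A. simpl in A.
  replace (ZSeries f - 0)%C with (ZSeries f) in A by ring. rewrite Rplus_0_l, Rinv_1, Rmult_1_r in A. exact A.
Qed.

Lemma Zbounded_tends0 f K : Zbounded f K -> forall eps, 0 < eps ->
  exists N0 : nat, forall N, (N0 <= N)%nat -> Cmod (f (Z.of_nat N)) <= eps /\ Cmod (f (- Z.of_nat N)%Z) <= eps.
Proof.
  intros H eps He. pose proof (Zbounded_nonneg _ _ H) as HK.
  destruct (small_inv (2 * K) eps He) as [N0 HN]. exists N0. intros N HNN. specialize (HN N HNN).
  assert (Hz : K * / (1 + INR N ^ 2) <= eps).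
  { apply Rle_trans with (2 := HN). pose proof (pos_INR N).
    replace (2 * K * / (INR N + 1)) with (K * (2 * / (INR N + 1))) by ring. apply Rmult_le_compat_l; auto.
    apply Rmult_le_reg_l with ((1 + INR N ^ 2) * (INR N + 1)). nra. field_simplify; nra. }
  split; apply Rle_trans with (2 := Hz); apply Rle_trans with (1 := H _); unfold Zb.
  - rewrite <- INR_IZR_INZ. lra.
  - rewrite opp_IZR, <- INR_IZR_INZ. right. f_equal. f_equal. ring.
Qed.

Lemma Zb_opp n : Zb (- n) = Zb n.
Proof. unfold Zb. rewrite opp_IZR. f_equal. ring. Qed.

(** Negation does not preserve the windows -N <= n < N: the partial sums differ by the two end terms
    f N and f (-N), which tend to 0. *)
Lemma ZSeries_opp f K : Zbounded f K -> ZSeries (fun n => f (- n)%Z) = ZSeries f.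
Proof.
  intros H. assert (Hb : Zbounded (fun n => f (- n)%Z) K).
  { intros n. rewrite <- Zb_opp. apply H. }
  apply (ZSeries_unique _ K); auto. intros eps He.
  assert (E : forall N, Zpart (fun n => f (- n)%Z) N = (Zpart f N + (f (Z.of_nat N) - f (- Z.of_nat N)%Z))%C).
  { induction N. simpl. ring. cbn [Zpart]. rewrite IHN.
    replace (- (- Z.of_nat N - 1))%Z with (Z.of_nat (S N)) by lia.
    replace (- Z.of_nat N - 1)%Z with (- Z.of_nat (S N))%Z by lia. ring. }
  destruct (ZSeries_lim f K H (eps / 2)) as [N1 A1]. lra.
  destruct (Zbounded_tends0 f K H (eps / 4)) as [N2 A2]. lra.
  exists (max N1 N2). intros N HN. specialize (A1 N ltac:(lia)). specialize (A2 N ltac:(lia)).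
  rewrite E. replace (Zpart f N + (f (Z.of_nat N) - f (- Z.of_nat N)%Z) - ZSeries f)%C
    with ((Zpart f N - ZSeries f) + (f (Z.of_nat N) - f (- Z.of_nat N)%Z))%C by ring.
  apply Rle_trans with (1 := Cmod_triangle _ _).
  pose proof (Cmod_triangle_minus (f (Z.of_nat N)) (f (- Z.of_nat N)%Z)). lra.
Qed.

Lemma ZSeries_reflect f : ZSeries (fun n => f (- n - 1)%Z) = ZSeries f.
Proof.
  unfold ZSeries. rewrite Cplus_comm. f_equal; f_equal; apply functional_extensionality; intros n; f_equal; lia.
Qed.

Lemma ZSeries_single (k : Z) (g : Z -> C) :
  (forall n, n <> k -> g n = 0) -> ZSeries g = g k.
Proof.
  intros H.
  assert (Hb : Zbounded g (Cmod (g k) * (1 + IZR k ^ 2))).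
  { intros n. destruct (Z.eq_dec n k) as [->|E].
    - unfold Zb. rewrite Rmult_assoc, Rinv_r. lra. pose proof (pow2_ge_0 (IZR k)). lra.
    - rewrite H by auto. rewrite Cmod_0. pose proof (Zb_pos n). pose proof (Cmod_ge_0 (g k)).
      pose proof (pow2_ge_0 (IZR k)). apply Rmult_le_pos; [|lra]. apply Rmult_le_pos; lra. }
  apply (ZSeries_unique _ _ _ Hb). intros eps He. exists (S (Z.to_nat (Z.abs k))). intros N HN.
  assert (E : forall N, Zpart g N = if (Z.leb (- Z.of_nat N) k && Z.ltb k (Z.of_nat N))%bool then g k else 0).
  { clear N HN. induction N as [|N IH].
    - simpl. destruct k; reflexivity.
    - cbn [Zpart]. rewrite IH.
      assert (E1 : g (Z.of_nat N) = if Z.eq_dec (Z.of_nat N) k then g k else 0).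
      { destruct (Z.eq_dec (Z.of_nat N) k) as [e|e]. now rewrite e. now apply H. }
      assert (E2 : g (- Z.of_nat N - 1)%Z = if Z.eq_dec (- Z.of_nat N - 1) k then g k else 0).
      { destruct (Z.eq_dec (- Z.of_nat N - 1) k) as [e|e]. now rewrite e. now apply H. }
      rewrite E1, E2.
      destruct (Z.eq_dec (Z.of_nat N) k); destruct (Z.eq_dec (- Z.of_nat N - 1) k);
      destruct (Z.leb_spec (- Z.of_nat N) k); destruct (Z.ltb_spec k (Z.of_nat N));
      destruct (Z.leb_spec (- Z.of_nat (S N)) k); destruct (Z.ltb_spec k (Z.of_nat (S N)));
      try (exfalso; lia); simpl; ring. }
  rewrite E. rewrite (proj2 (Z.leb_le _ _)) by lia. rewrite (proj2 (Z.ltb_lt _ _)) by lia. simpl.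
  replace (g k - g k)%C with (RtoC 0) by ring. rewrite Cmod_0. lra.
Qed.

(** Dominated convergence over an arbitrary filter: it serves the limit N -> oo in Poisson
    summation, both ends of the path, and the continuity of theta. *)
Lemma ZSeries_tannery {T : Type} (F : (T -> Prop) -> Prop) {FF : Filter F}
  (a : T -> Z -> C) (l : Z -> C) (K : R) :
  F (fun y => Zbounded (a y) K) -> Zbounded l K ->
  (forall n eps, 0 < eps -> F (fun y => Cmod (a y n - l n) <= eps)) ->
  forall eps, 0 < eps -> F (fun y => Cmod (ZSeries (a y) - ZSeries l) <= eps).
Proof.
  intros Hb Hl Hn eps He.
  destruct (small_inv (16 * K) (eps / 3)) as [N HN]. lra. specialize (HN N ltac:(lia)).
  assert (Hp : forall M e, 0 < e -> F (fun y => Cmod (Zpart (a y) M - Zpart l M) <= e)).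
  { induction M as [|M IH]; intros e Hpe.
    - apply filter_forall. intros y. simpl. replace (0 - 0)%C with (RtoC 0) by ring. rewrite Cmod_0. lra.
    - pose proof (IH (e / 3) ltac:(lra)) as B1.
      pose proof (Hn (Z.of_nat M) (e / 3) ltac:(lra)) as B2.
      pose proof (Hn (- Z.of_nat M - 1)%Z (e / 3) ltac:(lra)) as B3.
      eapply filter_imp. 2: apply (filter_and _ _ B1 (filter_and _ _ B2 B3)).
      intros y [C1 [C2 C3]]. cbn [Zpart].
      match goal with |- Cmod (?p + (?q + ?r) - (?p' + (?q' + ?r'))) <= _ =>
        replace (p + (q + r) - (p' + (q' + r')))%C with ((p - p') + ((q - q') + (r - r')))%C by ring;
        pose proof (Cmod_triangle (p - p') ((q - q') + (r - r')));
        pose proof (Cmod_triangle (q - q') (r - r')) end. lra. }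
  eapply filter_imp. 2: apply (filter_and _ _ Hb (Hp N (eps / 3) ltac:(lra))).
  intros y [C1 C2]. pose proof (ZSeries_approx _ _ C1 N) as D1. pose proof (ZSeries_approx _ _ Hl N) as D2.
  pose proof (Cmod_tri3 (ZSeries (a y)) (Zpart (a y) N) (ZSeries l)).
  pose proof (Cmod_tri3 (Zpart (a y) N) (Zpart l N) (ZSeries l)).
  rewrite (Cmod_minus_sym (Zpart l N)) in *. lra.
Qed.

Lemma holo_deriv_ZSeries (f f' : Z -> C -> C) (y : C) (K delta : R) : 0 < delta ->
  (forall k, Cmod k < delta -> exists B, Zbounded (fun n => f n (y + k)%C) B) ->
  (exists B, Zbounded (fun n => f' n y) B) ->
  (forall k n, Cmod k < delta -> Cmod (f n (y + k) - f n y - k * f' n y)%C <= K * Zb n * Cmod k ^ 2) ->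
  holo_deriv (fun w => ZSeries (fun n => f n w)) y (ZSeries (fun n => f' n y)).
Proof.
  intros Hd Hf [B' Hf'] H. apply (holo_deriv_of_quadratic _ _ _ (16 * K) delta Hd). intros k Hk.
  destruct (Hf k Hk) as [B1 H1].
  destruct (Hf 0) as [B0 H0]. rewrite Cmod_0; auto.
  replace (y + 0)%C with y in H0 by ring.
  rewrite <- (ZSeries_scal k _ _ Hf'), <- (ZSeries_minus _ _ _ _ H1 H0).
  assert (H10 : Zbounded (fun n => f n (y + k) - f n y)%C (B1 + B0)).
  { intros n. apply Rle_trans with (1 := Cmod_triangle_minus _ _). specialize (H1 n). specialize (H0 n). lra. }
  rewrite <- (ZSeries_minus _ _ _ _ H10 (Zbounded_scal k _ _ Hf')).
  rewrite Rmult_assoc. apply ZSeries_norm. intros n.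
  apply Rle_trans with (1 := H k n Hk). right; ring.
Qed.

(** With x = n + t, the cube of e^(-eta x^2 / 3) is at most (m (1 + x^2))^(-3), while (1 + |x|)^3 <=
    4 (1 + x^2)^2 and 1 + n^2 <= 2 (1 + T^2) (1 + x^2). The third power covers the largest
    polynomial factor needed, x^3 in the second derivative of a term of [Hprim]. *)
Lemma gaussian_dominated (T eta : R) : 0 < eta -> exists K, 0 < K /\
  forall t n, Rabs t <= T -> (1 + Rabs (IZR n + t)) ^ 3 * exp (- (eta * (IZR n + t) ^ 2)) <= K * Zb n.
Proof.
  intros He. set (m := Rmin 1 (eta / 3)).
  assert (Hm : 0 < m) by (apply Rmin_glb_lt; lra).
  assert (Hm1 : m <= 1) by apply Rmin_l. assert (Hm2 : m <= eta / 3) by apply Rmin_r.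
  exists (8 * (1 + T ^ 2) / m ^ 3). split.
  { apply Rdiv_lt_0_compat. pose proof (pow2_ge_0 T); lra. now apply pow_lt. }
  intros t n Ht. set (x := IZR n + t).
  assert (Hx : 0 <= x ^ 2) by apply pow2_ge_0. assert (Ht2 : t ^ 2 <= T ^ 2).
  { rewrite <- (pow2_abs t). apply pow_incr. split; auto. apply Rabs_pos. }
  assert (Hn : 1 + IZR n ^ 2 <= 2 * (1 + T ^ 2) * (1 + x ^ 2)).
  { replace (IZR n) with (x - t) by (unfold x; ring). pose proof (pow2_ge_0 (x + t)). nra. }
  assert (H3 : (1 + Rabs x) ^ 3 <= 4 * (1 + x ^ 2) ^ 2).
  { rewrite <- (pow2_abs x). pose proof (Rabs_pos x). set (y := Rabs x) in *.
    pose proof (pow2_ge_0 (y ^ 2 - 1)). pose proof (pow2_ge_0 (y - 1)).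
    assert (0 <= y * (y - 1) ^ 2) by nra. nra. }
  assert (Hex : exp (- (eta * x ^ 2)) <= / (m * (1 + x ^ 2)) ^ 3).
  { replace (- (eta * x ^ 2)) with (- (eta * x ^ 2 / 3) + - (eta * x ^ 2 / 3) + - (eta * x ^ 2 / 3)) by field.
    rewrite !exp_plus.
    assert (H1 : exp (- (eta * x ^ 2 / 3)) <= / (m * (1 + x ^ 2))).
    { apply Rle_trans with (/ (1 + eta * x ^ 2 / 3)). apply exp_opp_le. nra.
      apply Rinv_le_contravar; nra. }
    pose proof (exp_pos (- (eta * x ^ 2 / 3))) as Hp. set (e := exp _) in *.
    rewrite <- pow_inv. apply Rle_trans with (e ^ 3). right; ring. apply pow_incr; lra. }
  unfold Zb.
  apply Rle_trans with (4 * (1 + x ^ 2) ^ 2 * / (m * (1 + x ^ 2)) ^ 3).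
  { apply Rmult_le_compat; auto. apply pow_le. pose proof (Rabs_pos x); lra. left; apply exp_pos. }
  assert (Hz : 0 < 1 + IZR n ^ 2) by (pose proof (pow2_ge_0 (IZR n)); lra).
  apply Rmult_le_reg_r with (m ^ 3 * (1 + x ^ 2) * (1 + IZR n ^ 2)).
  { apply Rmult_lt_0_compat; auto. apply Rmult_lt_0_compat. now apply pow_lt. lra. }
  apply Rle_trans with (4 * (1 + IZR n ^ 2)). right; field; split; lra.
  apply Rle_trans with (8 * (1 + T ^ 2) * (1 + x ^ 2)). lra.
  right. field. split; lra.
Qed.

(** * Poisson summation *)

(* The kernels ck N / ci N concentrate at 0 and their Fourier coefficients cb N k / ci N are bounded by 1
   and tend to 1, so dominated convergence on both sides yields Poisson summation. *)
Definition ck (N : nat) (x : R) : R := cos (PI * x) ^ (2 * N).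

Definition ek (j : Z) (x : R) : C := Cexp (- (2 * PI * Ci * IZR j * x)).

Lemma continuous_ck N x : continuous (ck N) x.
Proof. rap (ex_derive_continuous _ _ _). unfold ck. auto_derive. auto. Qed.

Lemma Cderiv_ek j x : Cderiv (ek j) x (- (2 * PI * Ci * IZR j) * ek j x).
Proof.
  unfold ek. eapply Cderiv_eq. apply Cderiv_exp. apply Cderiv_opp. apply Cderiv_scal. apply Cderiv_id. cbv beta; ring.
Qed.

Lemma Ccont_ek j x : Ccont (ek j) x.
Proof. eapply Cderiv_cC, Cderiv_ek. Qed.

Lemma ek_plus i j x : ek (i + j) x = (ek i x * ek j x)%C.
Proof. unfold ek. rewrite <- Cexp_plus, plus_IZR, RtoC_plus. f_equal. ring. Qed.

Lemma ek_trig j x : ek j x = (cos (2 * PI * IZR j * x), - sin (2 * PI * IZR j * x)).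
Proof.
  unfold ek, Cexp.
  assert (E1 : Re (- (2 * PI * Ci * IZR j * x)) = 0) by (repeat progress reim; ring).
  assert (E2 : Im (- (2 * PI * Ci * IZR j * x)) = - (2 * PI * IZR j * x)) by (repeat progress reim; ring).
  rewrite E1, E2, exp_0, cos_neg, sin_neg. f_equal; ring.
Qed.

Lemma Cmod_ek j x : Cmod (ek j x) = 1.
Proof.
  unfold ek. rewrite Cmod_Cexp. rewrite <- exp_0. f_equal. repeat progress reim. ring.
Qed.

Lemma sin_2PI_Z (k : Z) : sin (2 * PI * IZR k) = 0.
Proof.
  rewrite Rmult_assoc, (Rmult_comm PI), sin_2a. rewrite sin_eq_0_1. ring. now exists k.
Qed.

Lemma sin_PI_Z (k : Z) : sin (PI * IZR k) = 0.
Proof. apply sin_eq_0_1. exists k. ring. Qed.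

Lemma cos_2PI_Z (k : Z) : cos (2 * PI * IZR k) = 1.
Proof.
  rewrite Rmult_assoc, cos_2a_sin, sin_PI_Z. ring.
Qed.

Lemma ek_int j (n : Z) x : ek j (IZR n + x) = ek j x.
Proof.
  rewrite !ek_trig.
  replace (2 * PI * IZR j * (IZR n + x)) with (2 * PI * IZR j * x + 2 * PI * IZR (j * n)) by (rewrite mult_IZR; ring).
  rewrite cos_plus, sin_plus, cos_2PI_Z, sin_2PI_Z. f_equal; ring.
Qed.

(* cos^2 (pi x) = (2 + e(x) + e(-x)) / 4 *)
Lemma ck_S N j x :
  (ck (S N) x * ek j x = / 4 * (2 * (ck N x * ek j x) + ck N x * ek (j - 1) x + ck N x * ek (j + 1) x))%C.
Proof.
  change (j - 1)%Z with (j + -1)%Z. rewrite !ek_plus.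
  assert (E : (ek (-1) x + ek 1 x = (4 * cos (PI * x) ^ 2 - 2)%R)%C).
  { rewrite !ek_trig. replace (2 * PI * IZR (-1) * x) with (- (2 * (PI * x))) by ring.
    replace (2 * PI * IZR 1 * x) with (2 * (PI * x)) by ring. rewrite cos_neg, sin_neg, cos_2a_cos.
    apply C_ext; repeat progress reim; ring. }
  replace (2 * (ck N x * ek j x) + ck N x * (ek j x * ek (-1) x) + ck N x * (ek j x * ek 1 x))%C
    with (ck N x * ek j x * (2 + (ek (-1) x + ek 1 x)))%C by ring.
  rewrite E. unfold ck. replace (2 * S N)%nat with (2 + 2 * N)%nat by lia. rewrite pow_add, RtoC_mult, RtoC_minus, RtoC_mult.
  field.
Qed.

(** Put a = pi x. Then a <= 2 gives sin a >= a - a^3 / 6 >= a / 3 >= x. It is needed only to compare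
    x^2 with sin^2 (pi x). *)
Lemma sin_lower x : 0 <= x <= 1 / 2 -> x <= sin (PI * x).
Proof.
  intros Hx. pose proof PI2_3_2. unfold PI2 in *. pose proof PI_4.
  assert (Ha : 0 <= PI * x) by nra. assert (Hb : PI * x <= PI) by nra.
  destruct (sin_bound (PI * x) 0 Ha Hb) as [Hl _].
  apply Rle_trans with (2 := Hl). unfold sin_approx, sin_term. simpl.
  assert (PI * x <= 2) by nra. set (a := PI * x) in *.
  assert (3 * x <= a) by (unfold a; nra).
  assert (a * (a * a) <= a * 4) by (apply Rmult_le_compat_l; nra).
  match goal with |- _ <= ?r => replace r with (a - a * (a * a) / 6) by field end. lra.
Qed.

Lemma sqr_le_sin2 x : - (1 / 2) <= x <= 1 / 2 -> x ^ 2 <= sin (PI * x) ^ 2.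
Proof.
  intros Hx. destruct (Rle_or_lt 0 x) as [h|h].
  - pose proof (sin_lower x ltac:(lra)). apply pow_incr. lra.
  - pose proof (sin_lower (- x) ltac:(lra)) as H. replace (PI * - x) with (- (PI * x)) in H by ring.
    rewrite sin_neg in H. replace (x ^ 2) with ((- x) ^ 2) by ring.
    replace (sin (PI * x) ^ 2) with ((- sin (PI * x)) ^ 2) by ring. apply pow_incr. lra.
Qed.

Definition ci (N : nat) : R := RInt (ck N) (- (1 / 2)) (1 / 2).

Lemma is_RInt_ck N : is_RInt (ck N) (- (1 / 2)) (1 / 2) (ci N).
Proof. rap (RInt_correct _ _ _ _). rap (ex_RInt_continuous _ _ _). intros; apply continuous_ck. Qed.

Lemma ck_nonneg N x : 0 <= ck N x.
Proof. unfold ck. rewrite pow_mult. apply pow_le. apply pow2_ge_0. Qed.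

Lemma ci_pos N : 0 < ci N.
Proof.
  apply RInt_gt_0. lra.
  - intros x Hx. unfold ck. apply pow_lt. apply cos_gt_0; pose proof PI_RGT_0; nra.
  - intros; apply continuous_ck.
Qed.

(** Wallis recursion: integrate the derivative of sin (pi x) cos (pi x)^(2 N + 1) / pi, which
    vanishes at both ends of the cell. *)
Lemma ci_S N : (2 * INR N + 2) * ci (S N) = (2 * INR N + 1) * ci N.
Proof.
  pose proof PI_RGT_0 as Hpi.
  set (f := fun x => sin (PI * x) * cos (PI * x) ^ (2 * N + 1) / PI).
  assert (H : is_RInt (fun x => (2 * INR N + 2) * ck (S N) x - (2 * INR N + 1) * ck N x) (- (1 / 2)) (1 / 2)
      (f (1 / 2) - f (- (1 / 2)))).
  { apply (is_RInt_derive f).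
    - intros x _. unfold f, ck. auto_derive. auto.
      fold (2 * N)%nat. change (N + (N + 0))%nat with (2 * N)%nat.
      replace (2 * S N)%nat with (2 + 2 * N)%nat by lia. rewrite pow_add.
      replace (pred (2 * N + 1)) with (2 * N)%nat by lia.
      replace (INR (2 * N + 1)) with (2 * INR N + 1) by (rewrite plus_INR, mult_INR; simpl; ring).
      rewrite pow_add. pose proof (sin2_cos2 (PI * x)) as E. unfold Rsqr in E.
      replace (cos (PI * x) ^ 2) with (1 - sin (PI * x) * sin (PI * x)) by (rewrite <- E; ring).
      rewrite pow_1. set (c := cos (PI * x) ^ (2 * N)) in *.
      transitivity (c * (cos (PI * x) * cos (PI * x) - (2 * INR N + 1) * (sin (PI * x) * sin (PI * x)))).
      field. lra.
      replace (cos (PI * x) * cos (PI * x)) with (1 - sin (PI * x) * sin (PI * x)) by (rewrite <- E; ring). ring.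
    - intros x _. rap (ex_derive_continuous _ _ _). unfold ck. auto_derive. auto. }
  assert (H2 : is_RInt (fun x => (2 * INR N + 2) * ck (S N) x - (2 * INR N + 1) * ck N x) (- (1 / 2)) (1 / 2)
      ((2 * INR N + 2) * ci (S N) - (2 * INR N + 1) * ci N)).
  { apply rInt_minus; apply rInt_scal; apply is_RInt_ck. }
  pose proof (is_RInt_unique _ _ _ _ H) as E1. rewrite (is_RInt_unique _ _ _ _ H2) in E1.
  unfold f in E1. replace (PI * (1 / 2)) with (PI / 2) in E1 by field.
  replace (PI * - (1 / 2)) with (- (PI / 2)) in E1 by field. rewrite cos_neg, cos_PI2 in E1.
  rewrite !pow_ne_zero in E1 by lia. lra.
Qed.

(** Use |x| <= eps / 2 + x^2 / (2 eps) and x^2 <= sin^2 (pi x). Since [ck N] times sin^2 is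
    [ck N - ck (S N)], its mass is [ci N] / (2 N + 2) by the Wallis recursion, hence below eps^2
    [ci N] for large N. *)
Lemma ck_abs_small eps : 0 < eps -> exists N0 : nat, forall N, (N0 <= N)%nat ->
  exists l, is_RInt (fun x => ck N x * Rabs x) (- (1 / 2)) (1 / 2) l /\ l <= eps * ci N.
Proof.
  intros He. destruct (small_inv 1 (eps ^ 2)) as [N0 HN]. nra. exists N0. intros N HNN. specialize (HN N HNN).
  assert (Hx : ex_RInt (fun x => ck N x * Rabs x) (- (1 / 2)) (1 / 2)).
  { rap (ex_RInt_continuous _ _ _). intros x _. apply (continuous_mult (ck N) Rabs). apply continuous_ck.
    apply continuous_Rabs. }
  destruct Hx as [l Hl]. exists l. split; auto.
  assert (H2 : is_RInt (fun x => (eps / 2) * ck N x + (/ (2 * eps)) * (ck N x - ck (S N) x)) (- (1 / 2)) (1 / 2)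
     ((eps / 2) * ci N + (/ (2 * eps)) * (ci N - ci (S N)))).
  { apply rInt_plus; apply rInt_scal. apply is_RInt_ck.
    apply rInt_minus; apply is_RInt_ck. }
  apply Rle_trans with ((eps / 2) * ci N + (/ (2 * eps)) * (ci N - ci (S N))).
  - eapply is_RInt_le with (3 := H2) (2 := Hl). lra. intros x Hx.
    assert (E : ck (S N) x = ck N x * (1 - sin (PI * x) ^ 2)).
    { unfold ck. replace (2 * S N)%nat with (2 * N + 2)%nat by lia. rewrite pow_add. f_equal.
      pose proof (sin2_cos2 (PI * x)) as E. unfold Rsqr in E. simpl. lra. }
    rewrite E. replace ((eps / 2) * ck N x + (/ (2 * eps)) * (ck N x - ck N x * (1 - sin (PI * x) ^ 2)))
      with (ck N x * (eps / 2 + (/ (2 * eps)) * sin (PI * x) ^ 2)) by ring.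
    apply Rmult_le_compat_l. apply ck_nonneg.
    apply Rle_trans with (eps / 2 + / (2 * eps) * Rabs x ^ 2).
    + pose proof (pow2_ge_0 (eps - Rabs x)).
      apply Rmult_le_reg_l with (2 * eps). lra. rewrite Rmult_plus_distr_l, <- Rmult_assoc, Rinv_r, Rmult_1_l by lra. nra.
    + apply Rplus_le_compat_l. apply Rmult_le_compat_l. left; apply Rinv_0_lt_compat; lra.
      rewrite pow2_abs. apply sqr_le_sin2. lra.
  - pose proof (ci_S N) as E. pose proof (pos_INR N) as HNp. pose proof (ci_pos N) as Hc.
    assert (E2 : ci N - ci (S N) = ci N * / (2 * INR N + 2)).
    { apply Rmult_eq_reg_l with (2 * INR N + 2). 2: lra. field_simplify. nra. lra. }
    rewrite E2.
    assert (/ (2 * INR N + 2) <= eps ^ 2).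
    { apply Rle_trans with (2 := HN). rewrite Rmult_1_l. apply Rinv_le_contravar; lra. }
    apply Rle_trans with (eps / 2 * ci N + / (2 * eps) * (ci N * eps ^ 2)).
    + apply Rplus_le_compat_l. apply Rmult_le_compat_l. left; apply Rinv_0_lt_compat; lra.
      apply Rmult_le_compat_l; lra.
    + right. field. lra.
Qed.

Lemma Cmod_ek_minus_1 k x : Cmod (ek k x - 1) <= 2 * PI * Rabs (IZR k) * Rabs x.
Proof.
  replace (ek k x - 1)%C with (ek k (1 * x) - ek k (0 * x))%C.
  2: { rewrite Rmult_1_l, Rmult_0_l. unfold ek. replace (- (2 * PI * Ci * IZR k * 0))%C with (RtoC 0) by ring.
       rewrite Cexp_0. reflexivity. }
  apply (Cderiv_mvt (fun s => ek k (s * x)) (fun s => - (2 * PI * Ci * IZR k * x) * ek k (s * x))%C).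
  - intros t _. unfold ek. eapply Cderiv_eq. apply Cderiv_exp. apply Cderiv_opp. apply Cderiv_scal. apply Cderiv_RtoC.
    apply (is_derive_scal_l (fun x => x) t 1 x). rap (is_derive_id t). cbv beta.
    unfold scal; simpl; unfold mult; simpl. rewrite Rmult_1_l. ring.
  - intros t _. rewrite Cmod_mult, Cmod_ek, Cmod_opp, !Cmod_mult, !Cmod_R, Cmod_Ci.
    pose proof PI_RGT_0. rewrite (Rabs_pos_eq 2), (Rabs_pos_eq PI) by lra. right; ring.
Qed.

Definition cb (N : nat) (k : Z) : C := CInt (fun x => ck N x * ek k x)%C (- (1 / 2)) (1 / 2).

Lemma is_CInt_cb N k : is_CInt (fun x => ck N x * ek k x)%C (- (1 / 2)) (1 / 2) (cb N k).
Proof. apply CInt_correct. intros. apply Ccont_mult. apply Ccont_RtoC, continuous_ck. apply Ccont_ek. Qed.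

Lemma cb_0 k : cb 0 k = if Z.eq_dec k 0 then 1 else 0.
Proof.
  apply is_CInt_unique. destruct (Z.eq_dec k 0) as [->|Hk].
  - apply is_CInt_ext with (fun _ => RtoC 1).
    + intros t _. unfold ck, ek. simpl. replace (- (2 * PI * Ci * 0 * t))%C with (RtoC 0) by ring. rewrite Cexp_0. ring.
    + split; simpl; (evar_last; [apply rInt_const | toR; field]).
  - assert (Hc : (2 * PI * Ci * IZR k)%C <> 0).
    { pose proof PI_RGT_0. repeat apply Cmult_neq_0.
      intros E; injection E; lra. intros E; injection E; lra. intros E; injection E; lra.
      intros E; injection E. intros E1. apply eq_IZR in E1. auto. }
    set (F := fun x => (/ (- (2 * PI * Ci * IZR k)) * ek k x)%C).
    assert (HcN : (- (2 * PI * Ci * IZR k))%C <> 0).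
    { intros E. apply Hc. replace (2 * PI * Ci * IZR k)%C with (- (- (2 * PI * Ci * IZR k)))%C by ring. rewrite E. ring. }
    replace (RtoC 0) with (F (1 / 2)%R - F (- (1 / 2))%R)%C.
    2: { unfold F. replace (1 / 2) with (IZR 1 + - (1 / 2)) at 1 by field. rewrite ek_int. ring. }
    apply is_CInt_ext with (ek k). { intros t _. unfold ck. simpl. ring. }
    apply (is_CInt_derive F). 2: intros; apply Ccont_ek.
    intros t _. unfold F. eapply Cderiv_eq. apply Cderiv_scal. apply Cderiv_ek.
    rewrite Cmult_assoc, Cinv_l, Cmult_1_l by auto. reflexivity.
Qed.

Lemma cb_S N k : cb (S N) k = (/ 4 * (2 * cb N k + cb N (k - 1) + cb N (k + 1)))%C.
Proof.
  apply is_CInt_unique. eapply is_CInt_ext. { intros t _. symmetry. apply ck_S. }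
  apply is_CInt_scal. apply is_CInt_plus. apply is_CInt_plus. apply is_CInt_scal. all: apply is_CInt_cb.
Qed.

Lemma Cmod_cb N k : Cmod (cb N k) <= ci N.
Proof.
  apply (is_CInt_norm_le (fun x => ck N x * ek k x)%C (ck N) (- (1 / 2)) (1 / 2)). lra.
  2: apply is_CInt_cb. 2: apply is_RInt_ck.
  intros t _. rewrite Cmod_mult, Cmod_ek, Cmod_R, Rabs_pos_eq by apply ck_nonneg. lra.
Qed.

Lemma is_CInt_ck N : is_CInt (fun x => RtoC (ck N x)) (- (1 / 2)) (1 / 2) (ci N).
Proof.
  split. apply is_RInt_ck. simpl.
  evar_last; [apply rInt_const | toR; field].
Qed.

Lemma cb_limit k eps : 0 < eps -> eventually (fun N => Cmod (cb N k / ci N - 1) <= eps).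
Proof.
  intros He. pose proof PI_RGT_0 as Hpi. pose proof (Rabs_pos (IZR k)) as Hk.
  set (c := 2 * PI * Rabs (IZR k)). assert (Hc : 0 <= c) by (unfold c; nra).
  destruct (ck_abs_small (eps / (c + 1))) as [N0 HN]. apply Rdiv_lt_0_compat; lra.
  exists N0. intros N HNN. destruct (HN N HNN) as [l [Hl Hle]]. pose proof (ci_pos N) as Hp.
  assert (Hci : RtoC (ci N) <> 0) by (intros E; injection E; lra).
  replace (cb N k / ci N - 1)%C with ((cb N k - ci N) * / ci N)%C by (field; auto).
  rewrite Cmod_mult, Cmod_inv, Cmod_R, (Rabs_pos_eq (ci N)) by (auto; lra).
  assert (Hm : Cmod (cb N k - ci N) <= c * l).
  { apply (is_CInt_norm_le (fun x => ck N x * ek k x - ck N x)%C (fun x => c * (ck N x * Rabs x)) (- (1 / 2)) (1 / 2)).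
    lra. 2: apply is_CInt_minus; [apply is_CInt_cb|apply is_CInt_ck]. 2: apply rInt_scal; exact Hl.
    intros t _. replace (ck N t * ek k t - ck N t)%C with (ck N t * (ek k t - 1))%C by ring.
    rewrite Cmod_mult, Cmod_R, Rabs_pos_eq by apply ck_nonneg.
    replace (c * (ck N t * Rabs t)) with (ck N t * (c * Rabs t)) by ring.
    apply Rmult_le_compat_l. apply ck_nonneg. apply Cmod_ek_minus_1. }
  apply Rmult_le_reg_r with (ci N); auto. rewrite Rmult_assoc, Rinv_l, Rmult_1_r by lra.
  apply Rle_trans with (1 := Hm). apply Rle_trans with (c * (eps / (c + 1) * ci N)).
  apply Rmult_le_compat_l; auto.
  replace (c * (eps / (c + 1) * ci N)) with (eps * ci N * (c / (c + 1))) by (field; lra).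
  rewrite <- (Rmult_1_r (eps * ci N)) at 2. apply Rmult_le_compat_l. nra.
  apply Rle_div_l; lra.
Qed.

Section Poisson.
Variables (phi phi' : R -> C) (K : R).
Hypothesis Hd : forall x, Cderiv phi x (phi' x).
Hypothesis Hb : forall n x, - (1 / 2) <= x <= 1 / 2 -> Cmod (phi (IZR n + x)) <= K * Zb n.
Hypothesis Hb' : forall n x, - (1 / 2) <= x <= 1 / 2 -> Cmod (phi' (IZR n + x)) <= K * Zb n.

(** Contribution of the n-th unit cell to the integral over the line of phi times the periodic
    function [ck N] * [ek j]. *)
Definition pint (N : nat) (j n : Z) : C :=
  CInt (fun x => phi (IZR n + x) * (ck N x * ek j x))%C (- (1 / 2)) (1 / 2).

Lemma Cderiv_shift (n : Z) x : Cderiv (fun x => phi (IZR n + x)) x (phi' (IZR n + x)).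
Proof.
  destruct (Hd (IZR n + x)) as [H1 H2].
  assert (E : forall f (l : R), is_derive f (IZR n + x) l -> is_derive (fun x : R => f (IZR n + x)) x l).
  { intros f l H. evar_last. apply (is_derive_comp f (fun x => IZR n + x)). exact H.
    rap (is_derive_plus _ _ _ _ _ _ _). rap (is_derive_const _ _). rap (is_derive_id _).
    unfold scal, plus, zero, one; simpl. unfold mult; simpl. toR. ring. }
  split. now apply (E (fun s => Re (phi s))). now apply (E (fun s => Im (phi s))).
Qed.

Lemma is_CInt_pint N j n :
  is_CInt (fun x => phi (IZR n + x) * (ck N x * ek j x))%C (- (1 / 2)) (1 / 2) (pint N j n).
Proof.
  apply CInt_correct. intros. apply Ccont_mult. eapply Cderiv_cC, Cderiv_shift.
  apply Ccont_mult. apply Ccont_RtoC, continuous_ck. apply Ccont_ek.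
Qed.

Lemma pint_bounded N j : Zbounded (pint N j) (K * ci N).
Proof.
  intros n. refine (is_CInt_norm_le _ (fun x => K * Zb n * ck N x) _ _ _ _ _ _ (is_CInt_pint N j n) _). lra.
  - intros t Ht. rewrite !Cmod_mult, Cmod_ek, Cmod_R, Rmult_1_r, Rabs_pos_eq by apply ck_nonneg.
    apply Rmult_le_compat_r. apply ck_nonneg. apply Hb; lra.
  - replace (K * ci N * Zb n) with (K * Zb n * ci N) by ring. apply rInt_scal. apply is_RInt_ck.
Qed.

Lemma pint_S N j n : pint (S N) j n = (/ 4 * (2 * pint N j n + pint N (j - 1) n + pint N (j + 1) n))%C.
Proof.
  apply is_CInt_unique.
  eapply is_CInt_ext with (fun x => / 4 * (2 * (phi (IZR n + x) * (ck N x * ek j x))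
    + phi (IZR n + x) * (ck N x * ek (j - 1) x) + phi (IZR n + x) * (ck N x * ek (j + 1) x)))%C.
  { intros t _. rewrite ck_S. ring. }
  apply is_CInt_scal. apply is_CInt_plus. apply is_CInt_plus. apply is_CInt_scal. all: apply is_CInt_pint.
Qed.

(** On the n-th cell |phi (n + x) - phi n| <= K [Zb n] |x|, so the error is controlled by the first
    absolute moment of the kernel. *)
Lemma pint_approx eps : 0 < eps ->
  eventually (fun N => Cmod (ZSeries (pint N 0) / ci N - ZSeries (fun n => phi (IZR n))) <= eps).
Proof.
  intros He.
  assert (HK : 0 <= K).
  { pose proof (Hb 0 0 ltac:(lra)). pose proof (Zb_pos 0). pose proof (Cmod_ge_0 (phi (IZR 0 + 0))).
    destruct (Rle_or_lt 0 K); auto. nra. }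
  destruct (ck_abs_small (eps / (16 * K + 1))) as [N0 HN]. apply Rdiv_lt_0_compat; lra.
  exists N0. intros N HNN. destruct (HN N HNN) as [l [Hl Hle]]. pose proof (ci_pos N) as Hp.
  assert (Hci : RtoC (ci N) <> 0) by (intros E; injection E; lra).
  assert (Hphi : Zbounded (fun n => phi (IZR n)) K).
  { intros n. rewrite <- (Rplus_0_r (IZR n)). apply Hb. lra. }
  assert (Hl0 : 0 <= l).
  { eapply is_RInt_ge_0 with (2 := Hl). lra. intros. apply Rmult_le_pos. apply ck_nonneg. apply Rabs_pos. }
  replace (ZSeries (pint N 0) / ci N - ZSeries (fun n => phi (IZR n)))%C
    with (/ ci N * ZSeries (fun n => pint N 0 n - ci N * phi (IZR n)))%C.
  2: { rewrite (ZSeries_minus _ _ _ _ (pint_bounded N 0) (Zbounded_scal (ci N) _ _ Hphi)), (ZSeries_scal _ _ _ Hphi).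
       field. auto. }
  rewrite Cmod_mult, Cmod_inv, Cmod_R, (Rabs_pos_eq (ci N)) by (auto; lra).
  assert (Hm : Cmod (ZSeries (fun n => pint N 0 n - ci N * phi (IZR n))%C) <= 16 * (K * l)).
  { apply ZSeries_norm. intros n.
    apply (is_CInt_norm_le (fun x => phi (IZR n + x) * (ck N x * ek 0 x) - phi (IZR n) * ck N x)%C
      (fun x => K * Zb n * (ck N x * Rabs x)) (- (1 / 2)) (1 / 2)). lra.
    2: { apply is_CInt_minus. apply is_CInt_pint. rewrite Cmult_comm. apply is_CInt_scal. apply is_CInt_ck. }
    2: { replace (K * l * Zb n) with (K * Zb n * l) by ring. apply rInt_scal. exact Hl. }
    intros t Ht. replace (ek 0 t) with (RtoC 1).
    2: { unfold ek. replace (- (2 * PI * Ci * 0 * t))%C with (RtoC 0) by ring. now rewrite Cexp_0. }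
    replace (phi (IZR n + t)%R * (ck N t * 1) - phi (IZR n) * ck N t)%C
      with (ck N t * (phi (IZR n + t)%R - phi (IZR n)))%C by ring.
    rewrite Cmod_mult, Cmod_R, Rabs_pos_eq by apply ck_nonneg.
    replace (K * Zb n * (ck N t * Rabs t)) with (ck N t * (K * Zb n * Rabs t)) by ring.
    apply Rmult_le_compat_l. apply ck_nonneg.
    replace (phi (IZR n)) with (phi (IZR n + 0 * t)) by (f_equal; ring).
    replace (phi (IZR n + t)) with (phi (IZR n + 1 * t)) by (f_equal; ring).
    apply (Cderiv_mvt (fun s => phi (IZR n + s * t)) (fun s => phi' (IZR n + s * t) * t)%C).
    - intros s Hs. destruct (Cderiv_shift n (s * t)) as [D1 D2].
      assert (E : forall f (l : R), is_derive f (s * t) l -> is_derive (fun x : R => f (x * t)) s (l * t)).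
      { intros f l0 H. evar_last. apply (is_derive_comp f (fun x => x * t)). exact H.
        apply (is_derive_scal_l (fun x => x) s 1 t). rap (is_derive_id s).
        unfold scal, one; simpl. unfold mult; simpl. toR. ring. }
      apply E in D1. apply E in D2. split; repeat progress reim; rewrite ?Rmult_0_r, ?Rminus_0_r, ?Rplus_0_l; assumption.
    - intros s Hs. rewrite Cmod_mult, Cmod_R. apply Rmult_le_compat_r. apply Rabs_pos. apply Hb'. nra. }
  apply Rmult_le_reg_l with (ci N); auto. rewrite <- Rmult_assoc, Rinv_r, Rmult_1_l by lra.
  apply Rle_trans with (1 := Hm). apply Rle_trans with (16 * (K * (eps / (16 * K + 1) * ci N))).
  apply Rmult_le_compat_l. lra. apply Rmult_le_compat_l; auto.
  replace (16 * (K * (eps / (16 * K + 1) * ci N))) with (ci N * eps * (16 * K / (16 * K + 1))) by (field; lra).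
  rewrite <- (Rmult_1_r (ci N * eps)) at 2. apply Rmult_le_compat_l. nra.
  apply Rle_div_l; lra.
Qed.

Variables (A : Z -> C) (K' : R).
Hypothesis HA : Zbounded A K'.
(** The Fourier transform of phi at k, cut into unit cells so that no improper integral is
    needed. *)
Hypothesis HAint : forall k, A k = ZSeries (fun n => CInt (fun x => phi (IZR n + x) * ek k x)%C (- (1 / 2)) (1 / 2)).

Lemma Zbounded_A_cb N j : Zbounded (fun k => A k * cb N (j - k))%C (K' * ci N).
Proof.
  intros k. rewrite Cmod_mult. replace (K' * ci N * Zb k) with (K' * Zb k * ci N) by ring.
  apply Rmult_le_compat; try apply Cmod_ge_0. apply HA. apply Cmod_cb.
Qed.

(** [pint] and [cb] obey the same recursion in N, coming from cos^2 (pi x). Induction thus replaces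
    the expansion of the kernel into characters; at N = 0 the kernel is 1 and only the orthogonality
    [cb_0] is used. *)
Lemma pint_expand N : forall j, ZSeries (pint N j) = ZSeries (fun k => A k * cb N (j - k))%C.
Proof.
  induction N as [|N IH]; intros j.
  - rewrite (ZSeries_single j (fun k => A k * cb 0 (j - k))%C).
    + rewrite Z.sub_diag, cb_0. simpl. rewrite Cmult_1_r, HAint. apply ZSeries_ext. intros n.
      unfold pint. f_equal. apply functional_extensionality. intros x. unfold ck. simpl. ring.
    + intros n Hn. rewrite cb_0. destruct (Z.eq_dec (j - n) 0). lia. ring.
  - assert (E : forall (X Y Z' : Z -> C) B1 B2 B3, Zbounded X B1 -> Zbounded Y B2 -> Zbounded Z' B3 ->
      ZSeries (fun n => / 4 * (2 * X n + Y n + Z' n))%C = (/ 4 * (2 * ZSeries X + ZSeries Y + ZSeries Z'))%C).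
    { intros X Y Z' B1 B2 B3 H1 H2 H3.
      pose proof (Zbounded_scal 2 _ _ H1) as H1'.
      pose proof (Zbounded_plus _ _ _ _ H1' H2) as H4. pose proof (Zbounded_plus _ _ _ _ H4 H3) as H5.
      rewrite (ZSeries_scal _ _ _ H5), (ZSeries_plus _ _ _ _ H4 H3), (ZSeries_plus _ _ _ _ H1' H2), (ZSeries_scal _ _ _ H1).
      reflexivity. }
    rewrite (ZSeries_ext _ _ (pint_S N j)).
    rewrite (E _ _ _ _ _ _ (pint_bounded N j) (pint_bounded N (j - 1)) (pint_bounded N (j + 1))), !IH.
    rewrite <- (E _ _ _ _ _ _ (Zbounded_A_cb N j) (Zbounded_A_cb N (j - 1)) (Zbounded_A_cb N (j + 1))).
    apply ZSeries_ext. intros k. rewrite cb_S.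
    replace (j - k - 1)%Z with (j - 1 - k)%Z by lia. replace (j - k + 1)%Z with (j + 1 - k)%Z by lia. ring.
Qed.

Theorem poisson_summation : ZSeries A = ZSeries (fun n => phi (IZR n)).
Proof.
  apply Cmod_le_all_eps. intros eps He.
  assert (H1 : eventually (fun N => Cmod (ZSeries (fun k => A k * cb N (0 - k) / ci N)%C - ZSeries A) <= eps / 2)).
  { apply (ZSeries_tannery eventually (fun N k => A k * cb N (0 - k) / ci N)%C A K'); auto. 3: lra.
    - apply filter_forall. intros N k. pose proof (ci_pos N) as Hp.
      assert (Hci : RtoC (ci N) <> 0) by (intros E; injection E; lra).
      unfold Cdiv. rewrite !Cmod_mult, Cmod_inv, Cmod_R, (Rabs_pos_eq (ci N)) by (auto; lra).
      apply Rle_trans with (2 := HA k). rewrite Rmult_assoc. rewrite <- (Rmult_1_r (Cmod (A k))) at 2.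
      apply Rmult_le_compat_l. apply Cmod_ge_0. apply Rle_div_l. lra. rewrite Rmult_1_l. apply Cmod_cb.
    - intros k e Hpe. pose proof (Cmod_ge_0 (A k)) as HAk.
      destruct (cb_limit (0 - k) (e / (Cmod (A k) + 1))) as [N0 HN]. apply Rdiv_lt_0_compat; lra.
      exists N0. intros N HNN. specialize (HN N HNN).
      replace (A k * cb N (0 - k) / ci N - A k)%C with (A k * (cb N (0 - k) / ci N - 1))%C by (unfold Cdiv; ring).
      rewrite Cmod_mult. apply Rle_trans with ((Cmod (A k) + 1) * (e / (Cmod (A k) + 1))).
      apply Rmult_le_compat; try apply Cmod_ge_0; lra. right; field; lra. }
  pose proof (pint_approx (eps / 2) ltac:(lra)) as H2.
  destruct H1 as [N1 H1]. destruct H2 as [N2 H2].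
  specialize (H1 (max N1 N2) ltac:(lia)). specialize (H2 (max N1 N2) ltac:(lia)). set (N := max N1 N2) in *.
  assert (E : ZSeries (fun k => A k * cb N (0 - k) / ci N)%C = (ZSeries (pint N 0) / ci N)%C).
  { rewrite pint_expand. unfold Cdiv. rewrite Cmult_comm, <- (ZSeries_scal _ _ _ (Zbounded_A_cb N 0)).
    apply ZSeries_ext. intros k. ring. }
  rewrite E in H1. rewrite Cmod_minus_sym in H1.
  pose proof (Cmod_tri3 (ZSeries A) (ZSeries (pint N 0) / ci N) (ZSeries (fun n => phi (IZR n)))). lra.
Qed.
End Poisson.

Lemma RtoC_neq0 (r : R) : r <> 0 -> RtoC r <> 0.
Proof. intros H E. injection E. exact H. Qed.

Lemma Ci_neq0 : Ci <> 0.
Proof. intros E. injection E. lra. Qed.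

(** As Re (sg^2) > 0, the line i sg (X + be) ends inside a sector around i R_+, where
    [Gp_limit_rate] applies. *)
Lemma Gp_line_limit (sg be : C) : 0 < Re sg -> 0 < Re (sg * sg) -> forall eps, 0 < eps ->
  exists X0, forall X : R, X0 <= X -> Cmod (Gp (Ci * (sg * (X + be))) - Ci / 2) <= eps.
Proof.
  intros Hs Ha eps He. pose proof PI_RGT_0 as Hpi.
  set (al := (sg * sg)%C) in *. set (a := Re al) in *.
  assert (Hs0 : 0 < Cmod sg) by (pose proof (Re_le_Cmod sg); lra).
  assert (Eal : Cmod al = Cmod sg * Cmod sg) by (unfold al; apply Cmod_mult).
  assert (Hal : 0 < Cmod al) by nra.
  set (kap := a / (4 * Cmod al)).
  assert (Hkap : 0 < kap) by (apply Rdiv_lt_0_compat; lra).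
  set (b2 := Im be). set (al2 := Im al).
  (* Beyond q1 the real part of sg^2 (X + be)^2 is at least a U^2 / 2, hence a / 4 times |X + be|^2;
     beyond q2 the point lies in the upper half-plane; beyond q3 its modulus makes the rate at most
     eps. *)
  set (q1 := (2 * a * b2 ^ 2 + 4 * Rabs (al2 * b2)) / a).
  set (q2 := (Rabs (Im sg * b2) + 1) / Re sg).
  set (q3 := (1 + 2 / (PI * kap) / eps) / Cmod sg).
  assert (Hq0 : 0 <= 2 / (PI * kap) / eps).
  { apply Rlt_le. apply Rdiv_lt_0_compat; auto. apply Rdiv_lt_0_compat. lra. nra. }
  assert (H1 : 0 <= q1).
  { apply Rdiv_le_0_compat; auto. pose proof (Rabs_pos (al2 * b2)). pose proof (pow2_ge_0 b2). nra. }
  assert (H2 : 0 <= q2).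
  { apply Rdiv_le_0_compat; auto. pose proof (Rabs_pos (Im sg * b2)). lra. }
  assert (H3 : 0 <= q3).
  { apply Rdiv_le_0_compat; auto. lra. }
  exists (- Re be + (1 + Rabs b2 + q1 + q2 + q3)). intros X HX.
  set (U := X + Re be).
  assert (HU : 1 + Rabs b2 + q1 + q2 + q3 <= U) by (unfold U; lra).
  pose proof (Rabs_pos b2) as Hb2.
  set (Z := (X + be)%C). assert (EZ : Z = (U, b2)).
  { unfold Z, U, b2. apply C_ext; repeat progress reim; ring. }
  set (T := (Ci * (sg * Z))%C).
  assert (ET : (T * T = - (al * (Z * Z)))%C).
  { unfold T, al. replace (Ci * (sg * Z) * (Ci * (sg * Z)))%C with ((Ci * Ci) * (sg * sg * (Z * Z)))%C by ring.
    rewrite Ci2. ring. }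
  assert (EmT : Cmod T = Cmod sg * Cmod Z).
  { unfold T. rewrite !Cmod_mult, Cmod_Ci. ring. }
  assert (EmZ : Cmod Z ^ 2 = U ^ 2 + b2 ^ 2) by (rewrite Cmod_sqr, EZ; reflexivity).
  assert (HZU : U <= Cmod Z) by (pose proof (Re_le_Cmod Z) as E; rewrite EZ in E at 1; exact E).
  assert (Hb2U : b2 ^ 2 <= U ^ 2) by (rewrite <- (pow2_abs b2); apply pow_incr; lra).
  assert (Hre : a / 2 * U ^ 2 <= Re (al * (Z * Z))).
  { rewrite EZ. repeat progress reim. fold a al2.
    assert (E1 : a * q1 = 2 * a * b2 ^ 2 + 4 * Rabs (al2 * b2)) by (unfold q1; field; lra).
    pose proof (Rle_abs (al2 * b2)). pose proof (pow2_ge_0 b2) as Hb.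
    assert (E2 : U * (a * q1) <= a * U ^ 2).
    { replace (U * (a * q1)) with (a * U * q1) by ring. replace (a * U ^ 2) with (a * U * U) by ring.
      apply Rmult_le_compat_l. apply Rmult_le_pos; lra. lra. }
    assert (E3 : U * (2 * a * b2 ^ 2) >= 2 * a * b2 ^ 2).
    { assert (0 <= 2 * a * b2 ^ 2) by nra. nra. }
    assert (E4 : U * (4 * Rabs (al2 * b2)) >= 4 * (al2 * b2) * U) by nra.
    rewrite E1 in E2. nra. }
  assert (HTi : 0 < Im T).
  { unfold T. rewrite EZ. repeat progress reim.
    assert (E1 : Re sg * q2 = Rabs (Im sg * b2) + 1) by (unfold q2; field; lra).
    pose proof (Rle_abs (Im sg * b2)). assert (Re sg * q2 <= Re sg * U) by nra. lra. }
  assert (HTs : Re (T * T) <= - kap * Cmod T ^ 2).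
  { rewrite ET, Re_opp. assert (kap * Cmod T ^ 2 <= Re (al * (Z * Z))). 2: lra.
    apply Rle_trans with (2 := Hre). rewrite EmT.
    replace (kap * (Cmod sg * Cmod Z) ^ 2) with (a / 4 * Cmod Z ^ 2).
    rewrite EmZ. nra. unfold kap. rewrite Eal. field. lra. }
  assert (E3 : Cmod sg * q3 = 1 + 2 / (PI * kap) / eps) by (unfold q3; field; lra).
  assert (HT3 : 1 + 2 / (PI * kap) / eps <= Cmod T).
  { rewrite <- E3, EmT. apply Rmult_le_compat_l; lra. }
  apply Rle_trans with (1 := Gp_limit_rate T kap Hkap HTi HTs ltac:(lra)).
  apply Rle_div_l. lra. assert (E5 : 2 / (PI * kap) = eps * (2 / (PI * kap) / eps)) by (field; repeat split; nra).
  rewrite E5. apply Rmult_le_compat_l; lra.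
Qed.

(** The partial sums telescope to F (N - 1/2) - F (- N - 1/2), so the values of a primitive at both
    infinities give the sum of the cell integrals. *)
Lemma ZSeries_cells (F f : R -> C) (K : R) (Lp Lm : C) :
  (forall x, Cderiv F x (f x)) -> (forall x, Ccont f x) ->
  (forall n x, - (1 / 2) <= x <= 1 / 2 -> Cmod (f (IZR n + x)) <= K * Zb n) ->
  (forall eps, 0 < eps -> exists X0, forall X, X0 <= X -> Cmod (F X - Lp) <= eps) ->
  (forall eps, 0 < eps -> exists X0, forall X, X0 <= X -> Cmod (F (- X) - Lm) <= eps) ->
  ZSeries (fun n => CInt (fun x => f (IZR n + x)) (- (1 / 2)) (1 / 2)) = (Lp - Lm)%C.
Proof.
  intros HF Hf Hb Hp Hm.
  assert (HI : forall n : Z, is_CInt (fun x => f (IZR n + x)) (- (1 / 2)) (1 / 2) (F (IZR n + 1 / 2)%R - F (IZR n + - (1 / 2))%R)%C).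
  { intros n. apply (is_CInt_derive (fun x => F (IZR n + x))).
    - intros x _. now apply Cderiv_shift.
    - intros x _. destruct (Hf (IZR n + x)) as [H1 H2].
      assert (Hc : continuous (fun x => IZR n + x) x).
      { rap (ex_derive_continuous _ _ _). auto_derive. auto. }
      split. apply (continuous_comp (fun x => IZR n + x) (fun x => Re (f x))); auto.
      apply (continuous_comp (fun x => IZR n + x) (fun x => Im (f x))); auto. }
  assert (HB : Zbounded (fun n => CInt (fun x => f (IZR n + x)) (- (1 / 2)) (1 / 2)) K).
  { intros n. rewrite (is_CInt_unique _ _ _ _ (HI n)).
    refine (is_CInt_norm_le _ (fun x => K * Zb n) _ _ _ _ _ _ (HI n) _). lra.
    intros t Ht. apply Hb. lra. evar_last. apply rInt_const. toR. field. }
  apply (ZSeries_unique _ _ _ HB). intros eps He.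
  assert (E : forall N, Zpart (fun n => CInt (fun x => f (IZR n + x)) (- (1 / 2)) (1 / 2)) N
                = (F (INR N + - (1 / 2))%R - F (- (INR N + 1 / 2))%R)%C).
  { induction N as [|N IH].
    - simpl. replace (0 + - (1 / 2)) with (- (0 + 1 / 2)) by ring. ring.
    - cbn [Zpart]. rewrite IH, !(is_CInt_unique _ _ _ _ (HI _)).
      rewrite minus_IZR, opp_IZR, <- INR_IZR_INZ, S_INR.
      replace (- INR N - 1 + 1 / 2) with (- (INR N + 1 / 2)) by field.
      replace (- INR N - 1 + - (1 / 2)) with (- (INR N + 1 + 1 / 2)) by field.
      replace (INR N + 1 + - (1 / 2)) with (INR N + 1 / 2) by field. ring. }
  destruct (Hp (eps / 2)) as [X1 A1]. lra. destruct (Hm (eps / 2)) as [X2 A2]. lra.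
  destruct (INR_unbounded (X1 + 1)) as [N1 HN1]. destruct (INR_unbounded (X2 + 1)) as [N2 HN2].
  exists (max N1 N2). intros N HN. rewrite E.
  assert (I1 : INR N1 <= INR N) by (apply le_INR; lia). assert (I2 : INR N2 <= INR N) by (apply le_INR; lia).
  specialize (A1 (INR N + - (1 / 2)) ltac:(lra)). specialize (A2 (INR N + 1 / 2) ltac:(lra)).
  match goal with |- Cmod (?p - ?q - (?r - ?s)) <= _ =>
    replace (p - q - (r - s))%C with ((p - r) - (q - s))%C by ring;
    pose proof (Cmod_triangle_minus (p - r) (q - s)) end. lra.
Qed.

Section GaussianPoisson.
Variables (al sg : C) (t eta : R).
Hypothesis Hsg : 0 < Re sg.
Hypothesis Eal : (sg * sg = al)%C.
Hypothesis Hal : 0 < Re al.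

Definition gphi (x : R) : C :=
  ((x + t)%R * Cexp (- (PI * al * ((x + t) ^ 2)%R) + 2 * PI * Ci * eta * x))%C.

Definition gphi' (x : R) : C :=
  ((1 + (x + t)%R * (- (2 * PI * al * (x + t)%R) + 2 * PI * Ci * eta))
   * Cexp (- (PI * al * ((x + t) ^ 2)%R) + 2 * PI * Ci * eta * x))%C.

Lemma Cderiv_shift_t x : Cderiv (fun x => RtoC (x + t)) x 1.
Proof. apply Cderiv_RtoC. auto_derive. auto. ring. Qed.

Lemma Cderiv_shift_sqr x : Cderiv (fun x => RtoC ((x + t) ^ 2)) x (2 * (x + t)%R).
Proof.
  eapply Cderiv_eq. apply Cderiv_RtoC. auto_derive. auto. reflexivity. rewrite <- RtoC_mult. f_equal. ring.
Qed.

Lemma Cderiv_gphi x : Cderiv gphi x (gphi' x).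
Proof.
  unfold gphi, gphi'. eapply Cderiv_eq.
  apply Cderiv_mult. apply Cderiv_shift_t. apply Cderiv_exp. apply Cderiv_plus. apply Cderiv_opp. apply Cderiv_scal. apply Cderiv_shift_sqr.
  apply Cderiv_scal. apply Cderiv_id. cbv beta. ring.
Qed.

Lemma gphi_exp_mod x :
  Cmod (Cexp (- (PI * al * ((x + t) ^ 2)%R) + 2 * PI * Ci * eta * x)) = exp (- (PI * Re al * (x + t) ^ 2)).
Proof. rewrite Cmod_Cexp. f_equal. repeat progress reim. ring. Qed.

Lemma gphi_bound : exists K, (forall n x, - (1 / 2) <= x <= 1 / 2 -> Cmod (gphi (IZR n + x)) <= K * Zb n) /\
  (forall n x, - (1 / 2) <= x <= 1 / 2 -> Cmod (gphi' (IZR n + x)) <= K * Zb n).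
Proof.
  pose proof PI_RGT_0 as Hpi.
  destruct (gaussian_dominated (Rabs t + 1 / 2) (PI * Re al)) as [K [HK H]]. nra.
  set (c := 1 + 2 * PI * (Cmod al + Rabs eta)).
  assert (Hc : 1 <= c). { unfold c. pose proof (Cmod_ge_0 al). pose proof (Rabs_pos eta). nra. }
  exists (c * K). split; intros n x Hx.
  - specialize (H (x + t) n). assert (Hxt : Rabs (x + t) <= Rabs t + 1 / 2).
    { apply Rle_trans with (1 := Rabs_triang _ _). assert (Rabs x <= 1 / 2) by (apply Rabs_le; lra). lra. }
    specialize (H Hxt). unfold gphi. rewrite Cmod_mult, gphi_exp_mod, Cmod_R, Rplus_assoc.
    pose proof (Zb_pos n). pose proof (Rabs_pos (IZR n + (x + t))).
    apply Rle_trans with (K * Zb n). 2: { rewrite Rmult_assoc. assert (0 < K * Zb n) by nra. nra. }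
    apply Rle_trans with (2 := H).
    apply Rmult_le_compat_r. left; apply exp_pos. set (y := Rabs (IZR n + (x + t))) in *.
    assert (0 <= y ^ 2) by nra. assert (0 <= y ^ 3) by (apply pow_le; lra). simpl in *. nra.
  - specialize (H (x + t) n). assert (Hxt : Rabs (x + t) <= Rabs t + 1 / 2).
    { apply Rle_trans with (1 := Rabs_triang _ _). assert (Rabs x <= 1 / 2) by (apply Rabs_le; lra). lra. }
    specialize (H Hxt). unfold gphi'. rewrite Cmod_mult, gphi_exp_mod, Rplus_assoc.
    set (X := IZR n + (x + t)) in *. pose proof (Rabs_pos X) as HX. set (y := Rabs X) in *.
    apply Rle_trans with (c * ((1 + y) ^ 3 * exp (- (PI * Re al * X ^ 2)))).
    2: { rewrite (Rmult_assoc c K). apply Rmult_le_compat_l; lra. }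
    rewrite <- Rmult_assoc. apply Rmult_le_compat_r. left; apply exp_pos.
    apply Rle_trans with (1 := Cmod_triangle _ _). rewrite Cmod_1, Cmod_mult, Cmod_R. fold y.
    assert (Hm : Cmod (- (2 * PI * al * X) + 2 * PI * Ci * eta) <= 2 * PI * Cmod al * y + 2 * PI * Rabs eta).
    { apply Rle_trans with (1 := Cmod_triangle _ _).
      rewrite Cmod_opp, !Cmod_mult, !Cmod_R, Cmod_Ci, (Rabs_pos_eq 2), (Rabs_pos_eq PI) by lra. fold y. lra. }
    pose proof (Cmod_ge_0 al) as Ha. pose proof (Rabs_pos eta) as Hn.
    apply Rle_trans with (1 + y * (2 * PI * Cmod al * y + 2 * PI * Rabs eta)).
    { apply Rplus_le_compat_l. apply Rmult_le_compat_l; lra. }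
    unfold c. set (A := 2 * PI * Cmod al). set (B := 2 * PI * Rabs eta).
    assert (HA : 0 <= A) by (unfold A; nra). assert (HB : 0 <= B) by (unfold B; nra).
    replace (1 + 2 * PI * (Cmod al + Rabs eta)) with (1 + A + B) by (unfold A, B; ring).
    assert (0 <= y ^ 2) by nra. assert (0 <= y ^ 3) by (apply pow_le; lra).
    assert ((1 + y) ^ 3 = 1 + 3 * y + 3 * y ^ 2 + y ^ 3) by ring.
    set (p := (1 + y) ^ 3) in *. assert (1 <= p) by lra. assert (y <= p) by lra. assert (y ^ 2 <= p) by lra. nra.
Qed.

(** Fourier transform of [gphi] at k: that of X e^(-pi al X^2) at xi is -i xi al^(-3/2) e^(-pi xi^2
    / al), with 1 / (al sg) in the role of al^(-3/2). *)
Definition gA (k : Z) : C :=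
  let xi := IZR k - eta in
  (- (Ci * xi / (al * sg)) * Cexp (2 * PI * Ci * xi * t - PI * (xi ^ 2)%R / al))%C.

(** Primitive of [gphi] * [ek k]: X e^(-pi al X^2) is integrated by parts, and completing the square
    turns what remains into [Gp]. *)
Definition gPhi (k : Z) (x : R) : C :=
  let xi := IZR k - eta in
  (Cexp (2 * PI * Ci * xi * t) *
   (- / (2 * PI * al) * Cexp (- (PI * al * ((x + t) ^ 2)%R) - 2 * PI * Ci * xi * (x + t)%R)
    - Ci * xi / al * Cexp (- (PI * (xi ^ 2)%R / al)) / (Ci * sg)
      * Gp (Ci * (sg * (x + (t + Ci * xi / al))))))%C.

Lemma al_neq0 : al <> 0.
Proof. intros E. rewrite E in Hal. simpl in Hal. lra. Qed.

Lemma sg_neq0 : sg <> 0.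
Proof. intros E. rewrite E in Hsg. simpl in Hsg. lra. Qed.

Lemma Cderiv_gPhi k x : Cderiv (gPhi k) x (gphi x * ek k x).
Proof.
  pose proof al_neq0 as Ha. pose proof sg_neq0 as Hs. pose proof Ci_neq0 as Hi. pose proof PI_RGT_0 as Hpi.
  assert (Hp : RtoC PI <> 0) by (apply RtoC_neq0; lra).
  set (xi := IZR k - eta). unfold gPhi. fold xi.
  set (X := (x + t)%R).
  assert (EG : E2 (Ci * (sg * (x + (t + Ci * xi / al)))) =
    (Cexp (- (PI * al * (X ^ 2)%R) - 2 * PI * Ci * xi * X) * / Cexp (- (PI * (xi ^ 2)%R / al)))%C).
  { rewrite <- Cexp_opp, <- Cexp_plus. unfold E2. f_equal.
    replace (x + (t + Ci * xi / al))%C with (X + Ci * xi / al)%C by (unfold X; rewrite RtoC_plus; ring).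
    replace (Ci * (sg * (X + Ci * xi / al)) * (Ci * (sg * (X + Ci * xi / al))))%C
      with ((Ci * Ci) * (sg * sg) * ((X + Ci * xi / al) * (X + Ci * xi / al)))%C by ring.
    rewrite Eal. rewrite !RtoC_pow.
    replace (PI * (Ci * Ci * al * ((X + Ci * xi / al) * (X + Ci * xi / al))))%C
      with (PI * (Ci * Ci) * (al * X ^ 2 + 2 * Ci * xi * X + (Ci * Ci) * xi ^ 2 / al))%C by (field; auto).
    rewrite Ci2. field. auto. }
  eapply Cderiv_eq.
  - apply Cderiv_scal. apply Cderiv_minus. apply Cderiv_scal. apply Cderiv_exp. apply Cderiv_minus. apply Cderiv_opp. apply Cderiv_scal. apply Cderiv_shift_sqr.
    apply Cderiv_scal. apply Cderiv_shift_t.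
    apply Cderiv_scal. apply (holo_deriv_Gp (Ci * (sg * (x + (t + Ci * xi / al))))%C (fun x => Ci * (sg * (x + (t + Ci * xi / al))))%C). reflexivity.
    apply Cderiv_scal. apply Cderiv_scal. apply Cderiv_plus. apply Cderiv_id. apply Cderiv_const.
  - cbv beta. rewrite EG. fold X.
    set (E := Cexp (- (PI * al * (X ^ 2)%R) - 2 * PI * Ci * xi * X)).
    assert (HE : (gphi x * ek k x = X * (Cexp (2 * PI * Ci * xi * t) * E))%C).
    { unfold gphi, ek, E. rewrite <- Cmult_assoc, <- !Cexp_plus. fold X. f_equal. f_equal.
      unfold X, xi. rewrite RtoC_minus, !RtoC_plus. ring. }
    rewrite HE. field. repeat split; auto. apply Cexp_neq0.
Qed.

Lemma gexp_small (e : R) : 0 < e -> exists X0, forall X, X0 <= Rabs X -> exp (- (PI * Re al * X ^ 2)) <= e.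
Proof.
  intros He. pose proof PI_RGT_0. set (c := PI * Re al). assert (Hc : 0 < c) by (unfold c; nra).
  exists (1 + / (c * e)). intros X HX. assert (Hce : 0 < / (c * e)) by (apply Rinv_0_lt_compat; nra).
  rewrite <- (pow2_abs X). set (y := Rabs X) in *.
  assert (Hy2 : 0 <= c * y ^ 2) by nra.
  apply Rle_trans with (1 := exp_opp_le _ Hy2).
  apply Rmult_le_reg_l with (1 + c * y ^ 2). lra. rewrite Rinv_r by lra.
  assert (c * e * / (c * e) = 1) by (apply Rinv_r; nra).
  assert (1 <= c * e * y) by nra. assert (c * e * y <= c * e * y ^ 2). 2: nra.
  apply Rmult_le_compat_l. nra. nra.
Qed.

Lemma gPhi_limits k :
  let xi := IZR k - eta in
  let L := (Cexp (2 * PI * Ci * xi * t) * (Ci * xi / al * Cexp (- (PI * (xi ^ 2)%R / al)) / (Ci * sg)))%C in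
  (forall eps, 0 < eps -> exists X0, forall X, X0 <= X -> Cmod (gPhi k X - - L * (Ci / 2)) <= eps) /\
  (forall eps, 0 < eps -> exists X0, forall X, X0 <= X -> Cmod (gPhi k (- X) - L * (Ci / 2)) <= eps).
Proof.
  intros xi L. pose proof al_neq0 as Ha. pose proof sg_neq0 as Hs.
  set (M := (Cexp (2 * PI * Ci * xi * t) * - / (2 * PI * al))%C).
  assert (EPhi : forall x, gPhi k x = (M * Cexp (- (PI * al * ((x + t) ^ 2)%R) - 2 * PI * Ci * xi * (x + t)%R)
                 - L * Gp (Ci * (sg * (x + (t + Ci * xi / al)))))%C).
  { intros x. unfold gPhi. fold xi. unfold M, L. ring. }
  assert (Emod : forall x, Cmod (Cexp (- (PI * al * ((x + t) ^ 2)%R) - 2 * PI * Ci * xi * (x + t)%R)) = exp (- (PI * Re al * (x + t) ^ 2))).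
  { intros x. rewrite Cmod_Cexp. f_equal. repeat progress reim. ring. }
  pose proof (Cmod_ge_0 M) as HM. pose proof (Cmod_ge_0 L) as HL.
  assert (Hgen : forall (z g ll : C) e1, Cmod z <= e1 / (2 * (Cmod M + 1)) -> Cmod (g - ll) <= e1 / (2 * (Cmod L + 1)) -> 0 < e1 ->
    Cmod (M * z - L * g - - L * ll) <= e1).
  { intros z g ll e1 Hz Hg He1.
    replace (M * z - L * g - - L * ll)%C with (M * z - L * (g - ll))%C by ring.
    apply Rle_trans with (1 := Cmod_triangle_minus _ _). rewrite !Cmod_mult.
    assert (Cmod M * Cmod z <= (Cmod M + 1) * (e1 / (2 * (Cmod M + 1)))) by (apply Rmult_le_compat; try apply Cmod_ge_0; lra).
    assert (Cmod L * Cmod (g - ll) <= (Cmod L + 1) * (e1 / (2 * (Cmod L + 1)))) by (apply Rmult_le_compat; try apply Cmod_ge_0; lra).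
    replace ((Cmod M + 1) * (e1 / (2 * (Cmod M + 1)))) with (e1 / 2) in * by (field; lra).
    replace ((Cmod L + 1) * (e1 / (2 * (Cmod L + 1)))) with (e1 / 2) in * by (field; lra). lra. }
  assert (Hal' : 0 < Re (sg * sg)) by (rewrite Eal; exact Hal).
  split; intros eps He.
  - destruct (gexp_small (eps / (2 * (Cmod M + 1)))) as [X1 H1]. apply Rdiv_lt_0_compat; lra.
    destruct (Gp_line_limit sg (t + Ci * xi / al)%C Hsg Hal' (eps / (2 * (Cmod L + 1)))) as [X2 H2]. apply Rdiv_lt_0_compat; lra.
    exists (Rmax (X1 + Rabs t) X2). intros X HX.
    pose proof (Rmax_l (X1 + Rabs t) X2). pose proof (Rmax_r (X1 + Rabs t) X2).
    rewrite EPhi. apply Hgen; auto.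
    + rewrite Emod. apply H1. apply Rle_trans with (2 := Rle_abs _).
      pose proof (Rle_abs (- t)). rewrite Rabs_Ropp in *. lra.
    + apply H2. lra.
  - destruct (gexp_small (eps / (2 * (Cmod M + 1)))) as [X1 H1]. apply Rdiv_lt_0_compat; lra.
    destruct (Gp_line_limit sg (- (t + Ci * xi / al))%C Hsg Hal' (eps / (2 * (Cmod L + 1)))) as [X2 H2]. apply Rdiv_lt_0_compat; lra.
    exists (Rmax (X1 + Rabs t) X2). intros X HX.
    pose proof (Rmax_l (X1 + Rabs t) X2). pose proof (Rmax_r (X1 + Rabs t) X2).
    rewrite EPhi. replace (L * (Ci / 2))%C with (- L * - (Ci / 2))%C by ring. apply Hgen; auto.
    + rewrite Emod. apply H1. rewrite <- Rabs_Ropp. apply Rle_trans with (2 := Rle_abs _).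
      pose proof (Rle_abs t). lra.
    + replace (Ci * (sg * ((- X)%R + (t + Ci * xi / al))))%C with (- (Ci * (sg * (X + - (t + Ci * xi / al)))))%C
        by (rewrite RtoC_opp; ring).
      rewrite Gp_opp. rewrite <- Cmod_opp.
      match goal with |- Cmod ?e <= _ => replace e with (Gp (Ci * (sg * (X + - (t + Ci * xi / al)))) - Ci / 2)%C by ring end.
      apply H2. lra.
Qed.

Lemma gA_integral k : gA k = ZSeries (fun n => CInt (fun x => gphi (IZR n + x) * ek k x)%C (- (1 / 2)) (1 / 2)).
Proof.
  destruct gphi_bound as [K [HK _]]. destruct (gPhi_limits k) as [Lp Lm]. cbv zeta in Lp, Lm.
  rewrite (ZSeries_ext _ (fun n => CInt (fun x => (fun y => gphi y * ek k y)%C (IZR n + x)) (- (1 / 2)) (1 / 2))).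
  2: { intros n. f_equal. apply functional_extensionality. intros x. now rewrite ek_int. }
  set (S0 := ZSeries _).
  match type of Lp with forall e, _ -> exists X0, forall X, _ -> Cmod (_ - ?l1) <= _ =>
  match type of Lm with forall e, _ -> exists X0, forall X, _ -> Cmod (_ - ?l2) <= _ =>
    assert (E : S0 = (l1 - l2)%C) end end.
  { apply (ZSeries_cells (gPhi k) (fun y => gphi y * ek k y)%C K). apply Cderiv_gPhi.
    intros x. apply Ccont_mult. eapply Cderiv_cC, Cderiv_gphi. apply Ccont_ek.
    intros n x Hx. rewrite Cmod_mult, Cmod_ek, Rmult_1_r. now apply HK.
    exact Lp. exact Lm. }
  rewrite E. pose proof al_neq0. pose proof sg_neq0. pose proof Ci_neq0. clear - H H0 H1.
  unfold gA. unfold Cminus. rewrite Cexp_plus.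
  field. auto.
Qed.

Lemma gA_bound : exists K, Zbounded gA K.
Proof.
  pose proof al_neq0 as Ha. pose proof sg_neq0 as Hs. pose proof PI_RGT_0 as Hpi.
  assert (Hinv : 0 < Re (/ al)).
  { unfold Cinv. simpl. fold (Re al). fold (Im al). apply Rdiv_lt_0_compat; auto.
    pose proof (Cmod_neq0_sqr al Ha). pose proof (pow2_ge_0 (Re al)). pose proof (pow2_ge_0 (Im al)). simpl in *. lra. }
  destruct (gaussian_dominated (Rabs (- eta)) (PI * Re (/ al))) as [K [HK H]]. nra.
  exists (Cmod (/ (al * sg)) * K). intros k. specialize (H (- eta) k (Rle_refl _)).
  unfold gA. set (xi := IZR k - eta).
  replace (IZR k + - eta) with xi in H by reflexivity.
  rewrite Cmod_mult, Cmod_Cexp, Cmod_opp. unfold Cdiv at 1. rewrite !Cmod_mult, Cmod_Ci, Cmod_R.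
  assert (E : Re (2 * PI * Ci * xi * t - PI * (xi ^ 2)%R / al) = - (PI * Re (/ al) * xi ^ 2)).
  { unfold Cdiv. rewrite Re_minus. rewrite !Re_mult, !Im_mult. repeat progress reim. ring. }
  rewrite E.
  apply Rle_trans with (Cmod (/ (al * sg)) * ((1 + Rabs xi) ^ 3 * exp (- (PI * Re (/ al) * xi ^ 2)))).
  2: { rewrite (Rmult_assoc _ K). apply Rmult_le_compat_l. apply Cmod_ge_0. exact H. }
  replace (1 * Rabs xi * Cmod (/ (al * sg)) * exp (- (PI * Re (/ al) * xi ^ 2)))
    with (Cmod (/ (al * sg)) * (Rabs xi * exp (- (PI * Re (/ al) * xi ^ 2)))) by ring.
  apply Rmult_le_compat_l. apply Cmod_ge_0. apply Rmult_le_compat_r. left; apply exp_pos.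
  pose proof (Rabs_pos xi). set (y := Rabs xi) in *.
  assert (0 <= y ^ 2) by nra. assert (0 <= y ^ 3) by (apply pow_le; lra). simpl in *. nra.
Qed.

Lemma gaussian_poisson : ZSeries gA = ZSeries (fun n => gphi (IZR n)).
Proof.
  destruct gphi_bound as [K [H1 H2]]. destruct gA_bound as [K' H3].
  exact (poisson_summation gphi gphi' K Cderiv_gphi H1 H2 gA K' H3 gA_integral).
Qed.
End GaussianPoisson.

(** * The weight 3/2 theta series *)

Lemma Cexp_2PI_Z (k : Z) : Cexp (2 * PI * Ci * IZR k) = 1.
Proof.
  unfold Cexp.
  assert (E1 : Re (2 * PI * Ci * IZR k) = 0) by (repeat progress reim; ring).
  assert (E2 : Im (2 * PI * Ci * IZR k) = 2 * PI * IZR k) by (repeat progress reim; ring).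
  rewrite E1, E2, exp_0, cos_2PI_Z, sin_2PI_Z. apply C_ext; simpl; ring.
Qed.

Lemma Cexp_shift_2PI (a b : C) (k : Z) : (a = b + 2 * PI * Ci * IZR k)%C -> Cexp a = Cexp b.
Proof. intros ->. rewrite Cexp_plus, Cexp_2PI_Z. ring. Qed.

Lemma Cexp_PI : Cexp (PI * Ci) = (- 1)%C.
Proof.
  unfold Cexp.
  assert (E1 : Re (PI * Ci) = 0) by (repeat progress reim; ring).
  assert (E2 : Im (PI * Ci) = PI) by (repeat progress reim; ring).
  rewrite E1, E2, exp_0, cos_PI, sin_PI. apply C_ext; simpl; ring.
Qed.

Lemma Cexp_PI2 : Cexp (PI * Ci / 2) = Ci.
Proof.
  replace (PI * Ci / 2)%C with (Ci * (PI / 2)%R)%C by (rewrite RtoC_div by lra; field).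
  unfold Cexp.
  assert (E1 : Re (Ci * (PI / 2)%R) = 0) by (repeat progress reim; ring).
  assert (E2 : Im (Ci * (PI / 2)%R) = PI / 2) by (repeat progress reim; ring).
  rewrite E1, E2, exp_0, cos_PI2, sin_PI2. apply C_ext; simpl; ring.
Qed.

Lemma powerRZ_m1_sqr (q : Z) : powerRZ (-1) q * powerRZ (-1) q = 1.
Proof.
  rewrite <- powerRZ_mult. replace (-1 * -1) with 1 by ring. apply powerRZ_R1.
Qed.

Lemma powerRZ_m1 (n : Z) : RtoC (powerRZ (-1) n) = Cexp (PI * Ci * IZR n).
Proof.
  destruct (Z.Even_or_Odd n) as [[q ->]|[q ->]].
  - replace (2 * q)%Z with (q + q)%Z by lia. rewrite powerRZ_add by lra. rewrite powerRZ_m1_sqr.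
    rewrite <- (Cexp_2PI_Z q). f_equal. rewrite plus_IZR, RtoC_plus. ring.
  - replace (2 * q + 1)%Z with (q + q + 1)%Z by lia. rewrite !powerRZ_add by lra. rewrite powerRZ_m1_sqr.
    rewrite (Cexp_shift_2PI _ (PI * Ci) q). rewrite Cexp_PI. simpl. f_equal. ring.
    rewrite !plus_IZR, !RtoC_plus. ring.
Qed.

Definition theta_term (u v : R) (w : C) (n : Z) : C :=
  (powerRZ (-1) n * (half n + u)%R
   * Cexp (PI * Ci * ((half n + u) ^ 2)%R * w + 2 * PI * Ci * half n * v))%C.

Definition theta (u v : R) (w : C) : C := ZSeries (theta_term u v w).

Lemma Rabs_powerRZ_m1 n : Rabs (powerRZ (-1) n) = 1.
Proof.
  pose proof (powerRZ_m1_sqr n) as H. pose proof (Rabs_pos (powerRZ (-1) n)).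
  apply (f_equal Rabs) in H. rewrite Rabs_mult, Rabs_R1 in H. nra.
Qed.

Lemma Cmod_theta_term u v w n : Cmod (theta_term u v w n) = Rabs (half n + u) * exp (- (PI * Im w * (half n + u) ^ 2)).
Proof.
  unfold theta_term. rewrite !Cmod_mult, !Cmod_R, Rabs_powerRZ_m1, Rmult_1_l, Cmod_Cexp. f_equal. f_equal.
  repeat progress reim. ring.
Qed.

Lemma half_shift n u : half n + u = IZR n + (1 / 2 + u).
Proof. unfold half. ring. Qed.

Lemma cube_dom y : 0 <= y -> y <= (1 + y) ^ 3 /\ y ^ 2 <= (1 + y) ^ 3 /\ y ^ 3 <= (1 + y) ^ 3 /\ 1 <= (1 + y) ^ 3.
Proof.
  intros H. assert (0 <= y ^ 2) by nra. assert (0 <= y ^ 3) by (apply pow_le; lra).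
  replace ((1 + y) ^ 3) with (1 + 3 * y + 3 * y ^ 2 + y ^ 3) by ring. lra.
Qed.

Lemma theta_term_bounded u v w : 0 < Im w -> exists K, Zbounded (theta_term u v w) K.
Proof.
  intros Hw. pose proof PI_RGT_0.
  destruct (gaussian_dominated (Rabs (1 / 2 + u)) (PI * Im w)) as [K [HK H1]]. nra.
  exists K. intros n. rewrite Cmod_theta_term, half_shift. apply Rle_trans with (2 := H1 (1 / 2 + u) n (Rle_refl _)).
  apply Rmult_le_compat_r. left; apply exp_pos. apply cube_dom, Rabs_pos.
Qed.

(** With m = n + 1/2, m^2 = n (n + 1) + 1/4 and n (n + 1) is even; this leaves the eighth root e^(pi
    i k / 4), the same for all n. *)
Lemma theta_translate u v w (k : Z) : 0 < Im w ->
  theta u v (w + IZR k) = (Cexp (PI * Ci * IZR k / 4) * Cexp (PI * Ci * IZR k * (u * u)) * theta u (v + IZR k * u) w)%C.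
Proof.
  intros Hw. unfold theta. destruct (theta_term_bounded u (v + IZR k * u) w Hw) as [K HK].
  rewrite <- (ZSeries_scal _ _ _ HK). apply ZSeries_ext. intros n. unfold theta_term.
  assert (E : exists q, (n * (n + 1) = 2 * q)%Z).
  { destruct (Z.Even_or_Odd n) as [[q ->]|[q ->]]. exists (q * (2 * q + 1))%Z; ring. exists ((2 * q + 1) * (q + 1))%Z; ring. }
  destruct E as [q E].
  replace (Cexp (PI * Ci * ((half n + u) ^ 2)%R * (w + IZR k) + 2 * PI * Ci * half n * v)) with
    (Cexp (PI * Ci * IZR k / 4) * Cexp (PI * Ci * IZR k * (u * u)) *
     Cexp (PI * Ci * ((half n + u) ^ 2)%R * w + 2 * PI * Ci * half n * (v + IZR k * u)%R))%C. ring.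
  rewrite <- !Cexp_plus. symmetry. apply (Cexp_shift_2PI _ _ (k * q)).
  assert (E2 : (IZR n * (IZR n + 1) = 2 * IZR q)%C).
  { rewrite <- RtoC_plus, <- !RtoC_mult, <- plus_IZR, <- !mult_IZR. now rewrite E. }
  unfold half. rewrite mult_IZR, !RtoC_pow, !RtoC_plus, !RtoC_mult, RtoC_div by lra.
  replace (2 * PI * Ci * (IZR k * IZR q))%C with (PI * Ci * IZR k * (2 * IZR q))%C by ring.
  rewrite <- E2. field.
Qed.

Lemma powerRZ_m1_reflect n : powerRZ (-1) (- n - 1) = - powerRZ (-1) n.
Proof.
  assert (E : RtoC (powerRZ (-1) (- n - 1)) = RtoC (- powerRZ (-1) n)).
  { rewrite RtoC_opp, !powerRZ_m1. replace (- Cexp (PI * Ci * IZR n))%C with (Cexp (PI * Ci) * Cexp (PI * Ci * IZR n))%C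
      by (rewrite Cexp_PI; ring).
    rewrite <- Cexp_plus. apply (Cexp_shift_2PI _ _ (- n - 1)). rewrite minus_IZR, opp_IZR, RtoC_minus, RtoC_opp. ring. }
  now injection E.
Qed.

Lemma half_reflect n : half (- n - 1) = - half n.
Proof. unfold half. rewrite minus_IZR, opp_IZR. field. Qed.

(** Under m -> -m both the sign (-1)^(m - 1/2) and the linear factor change sign. *)
Lemma theta_even u v w : theta (- u) (- v) w = theta u v w.
Proof.
  unfold theta. rewrite <- (ZSeries_reflect (theta_term u v w)). apply ZSeries_ext. intros n. unfold theta_term.
  rewrite powerRZ_m1_reflect, half_reflect.
  replace (- half n + u) with (- (half n + - u)) by ring.
  replace ((- (half n + - u)) ^ 2) with ((half n + - u) ^ 2) by ring.
  rewrite !RtoC_opp. replace (2 * PI * Ci * - half n * v)%C with (2 * PI * Ci * half n * - v)%C by ring. ring.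
Qed.

(** The first root has argument in (-pi/4, pi/4) and the second in (0, pi/2), so their product
    satisfies Re + Im > 0, which excludes the opposite root. *)
Lemma Csqrt_quarter_turn (c : R) (j : C) : 0 < c -> 0 < Im j ->
  (Csqrt (Ci / (c * j)) * Csqrt j = Csqrt (Ci / c))%C.
Proof.
  intros Hc Hj. assert (Hj0 : j <> 0) by (apply slit_neq0; right; lra).
  assert (Hc0 : RtoC c <> 0) by (apply RtoC_neq0; lra).
  assert (HQ : 0 < Re (Ci / (c * j))).
  { replace (Ci / (c * j))%C with (/ c * (Ci * / j))%C by (field; auto).
    rewrite <- RtoC_inv, Re_mult, Im_RtoC, Re_RtoC by lra. rewrite Rmult_0_l, Rminus_0_r.
    apply Rmult_lt_0_compat. now apply Rinv_0_lt_compat. unfold Cinv. repeat progress reim.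
    pose proof (Cmod_neq0_sqr j Hj0). pose proof (pow2_ge_0 (Re j)). pose proof (pow2_ge_0 (Im j)).
    unfold Re, Im in *.
    replace (0 * (fst j / (fst j ^ 2 + snd j ^ 2)) - 1 * (- snd j / (fst j ^ 2 + snd j ^ 2))) with (snd j / (fst j ^ 2 + snd j ^ 2)) by (field; auto).
    apply Rdiv_lt_0_compat; lra. }
  set (Q := (Ci / (c * j))%C) in *. assert (HQ0 : Q <> 0) by (apply slit_neq0; now left).
  set (A := Csqrt Q). set (B := Csqrt j).
  pose proof (Csqrt_Re_pos Q (or_introl HQ)) as HA. fold A in HA.
  destruct (Csqrt_upper j Hj) as [HB1 HB2]. fold B in HB1, HB2.
  pose proof (Csqrt_sqr Q HQ0) as EA. fold A in EA. pose proof (Csqrt_sqr j Hj0) as EB. fold B in EB.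
  assert (EP : ((A * B) * (A * B) = Ci / c)%C).
  { replace (A * B * (A * B))%C with ((A * A) * (B * B))%C by ring. rewrite EA, EB. unfold Q. field. auto. }
  symmetry. apply Csqrt_unique; auto.
  assert (HA2 : Im A ^ 2 < Re A ^ 2).
  { assert (E := f_equal Re EA). rewrite Re_mult in E. nra. }
  assert (HA3 : - Re A < Im A < Re A) by (split; nra).
  set (p := Re (A * B)). set (q := Im (A * B)).
  assert (E1 : p * p - q * q = 0).
  { assert (E := f_equal Re EP). rewrite Re_mult in E. fold p q in E. rewrite E.
    replace (Ci / c)%C with (Ci * (/ c)%R)%C by (rewrite RtoC_inv by lra; reflexivity).
    repeat progress reim. ring. }
  assert (E2 : 0 < p * q + q * p).
  { assert (E := f_equal Im EP). rewrite Im_mult in E. fold p q in E. rewrite E.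
    replace (Ci / c)%C with (Ci * (/ c)%R)%C by (rewrite RtoC_inv by lra; reflexivity).
    repeat progress reim. pose proof (Rinv_0_lt_compat c Hc). lra. }
  assert (E3 : 0 < p + q).
  { unfold p, q. rewrite Re_mult, Im_mult. nra. }
  nra.
Qed.

Lemma Csqrt_Ci : Csqrt Ci = Cexp (PI * Ci / 4).
Proof.
  apply Csqrt_unique.
  - rewrite <- Cexp_plus. transitivity (Cexp (PI * Ci / 2)). f_equal; field. apply Cexp_PI2.
  - rewrite Re_Cexp. apply Rmult_lt_0_compat. apply exp_pos.
    replace (PI * Ci / 4)%C with (Ci * (PI / 4)%R)%C by (rewrite RtoC_div by lra; field).
    repeat progress reim. replace (0 * 0 + 1 * (PI / 4)) with (PI / 4) by ring.
    pose proof PI_RGT_0. apply cos_gt_0; lra.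
Qed.

(** Poisson summation with al = i / w. The alternating sign (-1)^n is the 1/2 in eta = v + 1/2, so
    at k = -n the dual variable is -(m + v) with m again a half-integer: theta reproduces itself
    with exchanged characteristics, and w sqrt w comes from 1 / (al sg). *)
Lemma theta_inversion u v w : 0 < Im w ->
  theta u v (- / w) = (Cexp (- (3 * PI * Ci / 4)) * Cexp (- (2 * PI * Ci * u * v)) * (w * Csqrt w) * theta v (- u) w)%C.
Proof.
  intros Hw. assert (Hw0 : w <> 0) by (apply slit_neq0; right; lra).
  pose proof Ci_neq0 as Hi.
  set (al := (Ci / w)%C). set (sg := Csqrt al).
  assert (Hsq : (sg * Csqrt w = Cexp (PI * Ci / 4))%C).
  { rewrite <- Csqrt_Ci. pose proof (Csqrt_quarter_turn 1 w ltac:(lra) Hw) as E.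
    replace (Ci / 1%R)%C with Ci in E by field. rewrite <- E. unfold sg, al. f_equal. f_equal. field. auto. }
  assert (Hal : 0 < Re al).
  { unfold al, Cdiv, Cinv. repeat progress reim.
    pose proof (Cmod_neq0_sqr w Hw0). pose proof (pow2_ge_0 (Re w)). pose proof (pow2_ge_0 (Im w)).
    unfold Re, Im in *.
    replace (0 * (fst w / (fst w ^ 2 + snd w ^ 2)) - 1 * (- snd w / (fst w ^ 2 + snd w ^ 2))) with (snd w / (fst w ^ 2 + snd w ^ 2)) by (field; auto).
    apply Rdiv_lt_0_compat; lra. }
  assert (Hal0 : al <> 0) by (apply slit_neq0; now left).
  assert (Hsg : 0 < Re sg) by (apply Csqrt_Re_pos; now left).
  assert (Hsg0 : sg <> 0) by (apply Csqrt_neq0).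
  assert (Esg : (sg * sg = al)%C) by (now apply Csqrt_sqr).
  pose proof (gaussian_poisson al sg (1 / 2 + u) (v + 1 / 2) Hsg Esg Hal) as HP.
  destruct (gphi_bound al (1 / 2 + u) (v + 1 / 2) Hal) as [K1 [HK1 _]].
  assert (HK1' : Zbounded (fun n => gphi al (1 / 2 + u) (v + 1 / 2) (IZR n)) K1).
  { intros n. rewrite <- (Rplus_0_r (IZR n)). apply HK1. lra. }
  assert (E1 : theta u v (- / w) = (Cexp (PI * Ci * v) * ZSeries (fun n => gphi al (1 / 2 + u) (v + 1 / 2) (IZR n)))%C).
  { rewrite <- (ZSeries_scal _ _ _ HK1'). apply ZSeries_ext. intros n. unfold theta_term, gphi.
    rewrite powerRZ_m1, half_shift. set (X := IZR n + (1 / 2 + u)).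
    replace (Cexp (PI * Ci * IZR n) * X * Cexp (PI * Ci * (X ^ 2)%R * - / w + 2 * PI * Ci * half n * v))%C
      with (X * (Cexp (PI * Ci * IZR n) * Cexp (PI * Ci * (X ^ 2)%R * - / w + 2 * PI * Ci * half n * v)))%C by ring.
    replace (Cexp (PI * Ci * v) * (X * Cexp (- (PI * al * (X ^ 2)%R) + 2 * PI * Ci * (v + 1 / 2)%R * IZR n)))%C
      with (X * (Cexp (PI * Ci * v) * Cexp (- (PI * al * (X ^ 2)%R) + 2 * PI * Ci * (v + 1 / 2)%R * IZR n)))%C by ring.
    rewrite <- !Cexp_plus. f_equal. f_equal. unfold al, half. rewrite !RtoC_plus, RtoC_div by lra. field. auto. }
  destruct (gA_bound al sg (1 / 2 + u) (v + 1 / 2) Hsg Hal) as [K2 HK2].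
  destruct (theta_term_bounded v (- u) w Hw) as [K3 HK3].
  assert (E2 : ZSeries (gA al sg (1 / 2 + u) (v + 1 / 2)) =
     (/ (al * sg) * Cexp (- (PI * Ci * v) - 2 * PI * Ci * u * v) * theta v (- u) w)%C).
  { rewrite <- (ZSeries_opp _ _ HK2). unfold theta. rewrite <- (ZSeries_scal _ _ _ HK3). apply ZSeries_ext.
    intros n. unfold gA, theta_term. rewrite powerRZ_m1.
    assert (Exi : IZR (- n) - (v + 1 / 2) = - (half n + v)) by (unfold half; rewrite opp_IZR; ring).
    rewrite Exi. set (X := half n + v). replace ((- X) ^ 2) with (X ^ 2) by ring.
    assert (Ee : (Cexp (2 * PI * Ci * (- X)%R * (1 / 2 + u)%R - PI * (X ^ 2)%R / al) =
      - Ci * (Cexp (- (PI * Ci * v) - 2 * PI * Ci * u * v) * (Cexp (PI * Ci * IZR n) *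
       Cexp (PI * Ci * (X ^ 2)%R * w + 2 * PI * Ci * half n * (- u)%R))))%C).
    { replace (- Ci)%C with (Cexp (- (PI * Ci / 2))).
      2: { rewrite Cexp_opp, Cexp_PI2. apply Ci_inv. }
      rewrite <- !Cexp_plus. apply (Cexp_shift_2PI _ _ (- n)).
      replace (PI * (X ^ 2)%R / al)%C with (- (PI * Ci * (X ^ 2)%R * w))%C.
      2: { unfold al. replace (PI * (X ^ 2)%R / (Ci / w))%C with (PI * (X ^ 2)%R * w * / Ci)%C by (field; auto).
           rewrite Ci_inv. ring. }
      rewrite opp_IZR. unfold X, half. rewrite !RtoC_opp, !RtoC_plus, RtoC_div by lra. field. }
    rewrite Ee, RtoC_opp. field_simplify; auto.
    replace (Ci ^ 2)%C with (Ci * Ci)%C by ring. rewrite Ci2. field. auto. }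
  rewrite E1, <- HP, E2.
  assert (E3 : (/ (al * sg) = Cexp (- (3 * PI * Ci / 4)) * (w * Csqrt w))%C).
  { assert (Hs2 : Csqrt w = (Cexp (PI * Ci / 4) * / sg)%C) by (rewrite <- Hsq; field; auto).
    rewrite Hs2. replace (- (3 * PI * Ci / 4))%C with (- (PI * Ci / 2) + - (PI * Ci / 4))%C by field.
    rewrite Cexp_plus, !Cexp_opp, Cexp_PI2. unfold al. field. repeat split; auto. apply Cexp_neq0. }
  rewrite E3. unfold Cminus. rewrite Cexp_plus.
  replace (Cexp (PI * Ci * v) * (Cexp (- (3 * PI * Ci / 4)) * (w * Csqrt w) *
    (Cexp (- (PI * Ci * v)) * Cexp (- (2 * PI * Ci * u * v))) * theta v (- u) w))%C
    with ((Cexp (- (PI * Ci * v)) * Cexp (PI * Ci * v)) * (Cexp (- (3 * PI * Ci / 4)) * Cexp (- (2 * PI * Ci * u * v)) * (w * Csqrt w) * theta v (- u) w))%C by ring.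
  rewrite Cexp_opp_l. ring.
Qed.

(** * The multiplier system *)

(** The characteristics move by the row action (u, v) = (u', v') times the matrix. The exponent u v
    - u' v' telescopes under composition, so one constant [mu] serves all u', v' and s. *)
Definition theta_multiplier (a b c d : Z) (mu : C) : Prop :=
  forall (u' v' : R) (s : C), 0 < Im s ->
  let p := (IZR c * s + IZR d)%C in
  let u := IZR a * u' + IZR c * v' in
  let v := IZR b * u' + IZR d * v' in
  theta u' v' ((IZR a * s + IZR b) / p) =
  (mu * Cexp (PI * Ci * (u * v - u' * v')%R) * (p * Csqrt p) * theta u v s)%C.

Lemma Im_affine (c d : Z) (s : C) : Im (IZR c * s + IZR d) = IZR c * Im s.
Proof. repeat progress reim. ring. Qed.

Lemma affine_neq0 (c d : Z) (s : C) : (0 < c)%Z -> 0 < Im s -> (IZR c * s + IZR d)%C <> 0.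
Proof.
  intros Hc Hs. apply slit_neq0. right. rewrite Im_affine. apply IZR_lt in Hc. nra.
Qed.

Lemma Im_inv_upper (s : C) : 0 < Im s -> 0 < Im (- / s).
Proof.
  intros Hs. unfold Cinv. repeat progress reim.
  assert (H0 : s <> 0) by (apply slit_neq0; right; lra).
  pose proof (Cmod_neq0_sqr s H0). pose proof (pow2_ge_0 (Re s)). pose proof (pow2_ge_0 (Im s)).
  unfold Re, Im in *. replace (- (- snd s / (fst s ^ 2 + snd s ^ 2))) with (snd s / (fst s ^ 2 + snd s ^ 2)) by (field; auto).
  apply Rdiv_lt_0_compat; lra.
Qed.

Lemma multiplier_T (a b c d k : Z) (mu : C) : theta_multiplier a b c d mu -> (0 < c)%Z ->
  theta_multiplier a (b + k * a) c (d + k * c) (mu * Cexp (PI * Ci * IZR k / 4)).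
Proof.
  intros H Hc u' v' s Hs p u v. unfold p, u, v. clear p u v.
  specialize (H u' v' (s + IZR k)%C). cbv zeta in H.
  assert (Hs' : 0 < Im (s + IZR k)) by (rewrite Im_plus, Im_RtoC; lra).
  specialize (H Hs').
  replace (IZR c * (s + IZR k) + IZR d)%C with (IZR c * s + IZR (d + k * c))%C in H
    by (rewrite plus_IZR, mult_IZR, RtoC_plus, RtoC_mult; ring).
  replace (IZR a * (s + IZR k) + IZR b)%C with (IZR a * s + IZR (b + k * a))%C in H
    by (rewrite plus_IZR, mult_IZR, RtoC_plus, RtoC_mult; ring).
  rewrite H, theta_translate by auto.
  set (u := IZR a * u' + IZR c * v').
  replace (IZR b * u' + IZR d * v' + IZR k * u) with (IZR (b + k * a) * u' + IZR (d + k * c) * v')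
    by (unfold u; rewrite !plus_IZR, !mult_IZR; ring).
  set (p := (IZR c * s + IZR (d + k * c))%C).
  replace (PI * Ci * (u * (IZR (b + k * a) * u' + IZR (d + k * c) * v') - u' * v')%R)%C
    with (PI * Ci * (u * (IZR b * u' + IZR d * v') - u' * v')%R + PI * Ci * IZR k * (u * u))%C.
  - rewrite Cexp_plus. ring.
  - unfold u. rewrite !plus_IZR, !mult_IZR. repeat (rewrite ?RtoC_minus, ?RtoC_plus, ?RtoC_mult). ring.
Qed.

Lemma multiplier_base (a : Z) :
  theta_multiplier a (-1) 1 0 (Cexp (PI * Ci * IZR a / 4) * Cexp (- (3 * PI * Ci / 4))).
Proof.
  intros u' v' s Hs p u v. assert (H0 : s <> 0) by (apply slit_neq0; right; lra).
  replace ((IZR a * s + IZR (-1)) / p)%C with (- / s + IZR a)%C.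
  2: { unfold p. replace (IZR (-1) : C) with (- (1))%C by (rewrite <- RtoC_opp; reflexivity). field. auto. }
  rewrite theta_translate by now apply Im_inv_upper.
  rewrite theta_inversion by auto.
  replace p with s by (unfold p; ring).
  replace u with (v' + IZR a * u') by (unfold u; ring). replace v with (- u') by (unfold v; ring).
  replace (PI * Ci * ((v' + IZR a * u') * - u' - u' * v')%R)%C
    with (PI * Ci * IZR a * (u' * u') + - (2 * PI * Ci * u' * (v' + IZR a * u')%R))%C.
  - rewrite Cexp_plus. ring.
  - repeat (rewrite ?RtoC_minus, ?RtoC_plus, ?RtoC_mult, ?RtoC_opp). ring.
Qed.

(** Composition with s -> -1/s. For d > 0 the automorphy factor is p = - Q s with Q and s in the
    upper half-plane, and the branch contributes sqrt Q sqrt s = i sqrt p. For d < 0 one has p = Q s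
    and the roots simply multiply. This is the difference between the constants e^(3 pi i / 4) and
    e^(-3 pi i / 4). *)
Lemma multiplier_S_pos (a b c d : Z) (mu : C) : theta_multiplier b (- a) d (- c) mu ->
  (0 < c)%Z -> (0 < d)%Z -> theta_multiplier a b c d (mu * Cexp (3 * PI * Ci / 4)).
Proof.
  intros H Hc Hd u' v' s Hs p u v.
  assert (H0 : s <> 0) by (apply slit_neq0; right; lra).
  assert (Hp : p <> 0) by now apply affine_neq0.
  pose proof (Im_inv_upper s Hs) as Hs1.
  specialize (H u' v' (- / s)%C Hs1). cbv zeta in H.
  set (Q := (IZR d * - / s + IZR (- c))%C) in H.
  assert (HQ : 0 < Im Q).
  { unfold Q. rewrite Im_affine. apply IZR_lt in Hd. nra. }
  assert (EQ : p = (- (Q * s))%C).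
  { unfold p, Q. rewrite opp_IZR, RtoC_opp. field. auto. }
  assert (Ew : ((IZR b * - / s + IZR (- a)) / Q)%C = ((IZR a * s + IZR b) / p)%C).
  { rewrite EQ. assert (Q <> 0) by (apply slit_neq0; right; lra). rewrite opp_IZR, RtoC_opp. field. auto. }
  rewrite Ew in H. rewrite H. rewrite (theta_inversion _ _ s) by auto.
  replace (IZR b * u' + IZR d * v') with v by reflexivity.
  replace (IZR (- a) * u' + IZR (- c) * v') with (- u) by (unfold u; rewrite !opp_IZR; ring).
  rewrite theta_even.
  assert (Esq : (Csqrt Q * Csqrt s = Ci * Csqrt p)%C).
  { rewrite EQ, Csqrt_opp_mult_upper by auto.
    replace (Ci * (- Ci * (Csqrt Q * Csqrt s)))%C with (- (Ci * Ci) * (Csqrt Q * Csqrt s))%C by ring. rewrite Ci2. ring. }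
  replace (PI * Ci * (u * v - u' * v')%R)%C with (PI * Ci * (v * - u - u' * v')%R + - (2 * PI * Ci * v * (- u)%R))%C
    by (repeat (rewrite ?RtoC_minus, ?RtoC_plus, ?RtoC_mult, ?RtoC_opp); ring).
  rewrite Cexp_plus.
  assert (E3 : (Cexp (3 * PI * Ci / 4) = Cexp (- (3 * PI * Ci / 4)) * - Ci)%C).
  { replace (- Ci)%C with (Cexp (- (PI * Ci / 2))) by (rewrite Cexp_opp, Cexp_PI2; apply Ci_inv).
    rewrite <- Cexp_plus. apply (Cexp_shift_2PI _ _ 1). field. }
  rewrite E3.
  match goal with |- (mu * ?e1 * (Q * Csqrt Q) * (?e2 * ?e3 * (s * Csqrt s) * ?t))%C = _ =>
    replace (mu * e1 * (Q * Csqrt Q) * (e2 * e3 * (s * Csqrt s) * t))%C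
      with (mu * e1 * e2 * e3 * (Q * s) * (Csqrt Q * Csqrt s) * t)%C by ring end.
  rewrite Esq. replace (Q * s)%C with (- p)%C by (rewrite EQ; ring). ring.
Qed.

Lemma multiplier_S_neg (a b c d : Z) (mu : C) : theta_multiplier (- b) a (- d) c mu ->
  (0 < c)%Z -> (d < 0)%Z -> theta_multiplier a b c d (mu * Cexp (- (3 * PI * Ci / 4))).
Proof.
  intros H Hc Hd u' v' s Hs p u v.
  assert (H0 : s <> 0) by (apply slit_neq0; right; lra).
  assert (Hp : p <> 0) by now apply affine_neq0.
  pose proof (Im_inv_upper s Hs) as Hs1.
  specialize (H u' v' (- / s)%C Hs1). cbv zeta in H.
  set (Q := (IZR (- d) * - / s + IZR c)%C) in H.
  assert (HQ : 0 < Im Q).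
  { unfold Q. rewrite Im_affine, opp_IZR. apply IZR_lt in Hd. nra. }
  assert (EQ : p = (Q * s)%C).
  { unfold p, Q. rewrite opp_IZR, RtoC_opp. field. auto. }
  assert (Ew : ((IZR (- b) * - / s + IZR a) / Q)%C = ((IZR a * s + IZR b) / p)%C).
  { rewrite EQ. assert (Q <> 0) by (apply slit_neq0; right; lra). rewrite opp_IZR, RtoC_opp. field. auto. }
  rewrite Ew in H. rewrite H. rewrite (theta_inversion _ _ s) by auto.
  replace (IZR (- b) * u' + IZR (- d) * v') with (- v) by (unfold v; rewrite !opp_IZR; ring).
  replace (IZR a * u' + IZR c * v') with u by reflexivity.
  replace (- - v) with v by ring.
  assert (Hpi : 0 < Im (Q * s)).
  { rewrite <- EQ. unfold p. rewrite Im_affine. apply IZR_lt in Hc. nra. }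
  assert (Esq : (Csqrt Q * Csqrt s = Csqrt p)%C).
  { rewrite EQ, Csqrt_mult_upper by auto. ring. }
  replace (PI * Ci * (u * v - u' * v')%R)%C with (PI * Ci * (- v * u - u' * v')%R + - (2 * PI * Ci * (- v)%R * u))%C
    by (repeat (rewrite ?RtoC_minus, ?RtoC_plus, ?RtoC_mult, ?RtoC_opp); ring).
  rewrite Cexp_plus.
  match goal with |- (mu * ?e1 * (Q * Csqrt Q) * (?e2 * ?e3 * (s * Csqrt s) * ?t))%C = _ =>
    replace (mu * e1 * (Q * Csqrt Q) * (e2 * e3 * (s * Csqrt s) * t))%C
      with (mu * e1 * e2 * e3 * (Q * s) * (Csqrt Q * Csqrt s) * t)%C by ring end.
  rewrite Esq, <- EQ. ring.
Qed.

(** * Eighth roots of unity and congruences modulo 8 *)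

Definition e8 (n : Z) : C := Cexp (PI * Ci / 4 * IZR n).

Lemma e8_plus m n : e8 (m + n) = (e8 m * e8 n)%C.
Proof. unfold e8. rewrite <- Cexp_plus, plus_IZR, RtoC_plus. f_equal. ring. Qed.

Lemma e8_mod m n : (m mod 8 = n mod 8)%Z -> e8 m = e8 n.
Proof.
  intros H. pose proof (Z.div_mod m 8 ltac:(lia)). pose proof (Z.div_mod n 8 ltac:(lia)).
  unfold e8. apply (Cexp_shift_2PI _ _ (m / 8 - n / 8)).
  replace m with (n + 8 * (m / 8 - n / 8))%Z at 1 by lia.
  rewrite plus_IZR, mult_IZR, RtoC_plus, RtoC_mult. field.
Qed.

Lemma e8_4 : e8 4 = (- 1)%C.
Proof. unfold e8. rewrite <- Cexp_PI. f_equal. field. Qed.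

Lemma e8_0 : e8 0 = 1.
Proof. unfold e8. rewrite Cmult_0_r. apply Cexp_0. Qed.

(** Signs as exponents of [e8], with 4 standing for -1: [s4] is the symbol (-1/n) and [s44] the
    reciprocity sign. *)
Definition s4 (n : Z) : Z := if (n mod 4 =? 3)%Z then 4%Z else 0%Z.
Definition s44 (m n : Z) : Z := if ((m mod 4 =? 3)%Z && (n mod 4 =? 3)%Z)%bool then 4%Z else 0%Z.

Lemma mod8_mod4 n : ((n mod 8) mod 4 = n mod 4)%Z.
Proof.
  rewrite (Z.div_mod n 8) at 2 by lia.
  replace (8 * (n / 8) + n mod 8)%Z with (n mod 8 + (2 * (n / 8)) * 4)%Z by ring. now rewrite Z_mod_plus_full.
Qed.

Definition cong8 (x y : Z) : Prop := exists k, (x = y + 8 * k)%Z.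

Lemma cong8_refl x : cong8 x x. Proof. exists 0%Z. ring. Qed.
Lemma cong8_mod x : cong8 x (x mod 8).
Proof. exists (x / 8)%Z. pose proof (Z.div_mod x 8 ltac:(lia)). lia. Qed.
Lemma cong8_add x y x' y' : cong8 x x' -> cong8 y y' -> cong8 (x + y) (x' + y').
Proof. intros [k ->] [l ->]. exists (k + l)%Z. ring. Qed.
Lemma cong8_sub x y x' y' : cong8 x x' -> cong8 y y' -> cong8 (x - y) (x' - y').
Proof. intros [k ->] [l ->]. exists (k - l)%Z. ring. Qed.
Lemma cong8_opp x x' : cong8 x x' -> cong8 (- x) (- x').
Proof. intros [k ->]. exists (- k)%Z. ring. Qed.
Lemma cong8_mul x y x' y' : cong8 x x' -> cong8 y y' -> cong8 (x * y) (x' * y').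
Proof. intros [k ->] [l ->]. exists (x' * l + k * y' + 8 * k * l)%Z. ring. Qed.
Lemma cong8_eq x y : cong8 x y -> (x mod 8 = y mod 8)%Z.
Proof. intros [k ->]. rewrite Z.mul_comm. apply Z_mod_plus_full. Qed.

Ltac cong8 := apply cong8_eq; repeat first [ apply cong8_mod | apply cong8_refl
  | apply cong8_add | apply cong8_sub | apply cong8_mul | apply cong8_opp ].

Lemma mod8_odd n : Z.odd (n mod 8) = Z.odd n.
Proof.
  rewrite (Z.div_mod n 8) at 2 by lia. rewrite Z.odd_add, Z.odd_mul. simpl. now destruct (Z.odd (n mod 8)).
Qed.

Definition residues : list Z := (0 :: 1 :: 2 :: 3 :: 4 :: 5 :: 6 :: 7 :: nil)%Z.

Lemma in_residues n : In (n mod 8)%Z residues.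
Proof.
  pose proof (Z.mod_pos_bound n 8 ltac:(lia)). unfold residues. simpl. lia.
Qed.

Lemma odd_sqr_mod8 (c : Z) : Z.odd c = true -> exists q, (c * c = 1 + 8 * q)%Z.
Proof.
  intros oc. exists ((c * c) / 8)%Z. assert (Ec : (c * c mod 8 = 1)%Z).
  { pose proof (in_residues c) as Hr. rewrite <- (mod8_odd c) in oc. rewrite Zmult_mod.
    set (r := (c mod 8)%Z) in *. clearbody r.
    simpl in Hr. decompose [or] Hr; subst; try discriminate; try reflexivity; contradiction. }
  pose proof (Z.div_mod (c * c) 8 ltac:(lia)). lia.
Qed.

(** The comparison of exponents in a descent step with d > 0. It depends only on residues modulo 8,
    and the determinant condition modulo 8 is enough, so 8^4 cases decide it. [check_neg] is the
    case d < 0. *)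
Definition check_pos : bool :=
  forallb (fun a => forallb (fun b => forallb (fun c => forallb (fun d =>
    implb ((a * d - b * c) mod 8 =? 1)%Z (implb (Z.odd c && Z.odd d)
      ((s44 c d + c * (a + d - 3)) mod 8 =? (s4 d + (d * (b - c - 3) + 3)) mod 8)%Z))
    residues) residues) residues) residues.

Definition check_neg : bool :=
  forallb (fun a => forallb (fun b => forallb (fun c => forallb (fun d =>
    implb ((a * d - b * c) mod 8 =? 1)%Z (implb (Z.odd c && Z.odd d)
      ((s4 c + (s44 c (- d) + c * (a + d - 3))) mod 8 =? (- d * (- b + c - 3) - 3) mod 8)%Z))
    residues) residues) residues) residues.

Lemma check_pos_ok : check_pos = true. Proof. vm_compute. reflexivity. Qed.
Lemma check_neg_ok : check_neg = true. Proof. vm_compute. reflexivity. Qed.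

Lemma s4_mod8 n : s4 (n mod 8) = s4 n.
Proof. unfold s4. now rewrite mod8_mod4. Qed.
Lemma s44_mod8 m n : s44 (m mod 8) (n mod 8) = s44 m n.
Proof. unfold s44. now rewrite !mod8_mod4. Qed.

Lemma congruence_pos (a b c d : Z) : (a * d - b * c = 1)%Z -> Z.odd c = true -> Z.odd d = true ->
  ((s44 c d + c * (a + d - 3)) mod 8 = (s4 d + (d * (b - c - 3) + 3)) mod 8)%Z.
Proof.
  intros Hdet Hc Hd. pose proof check_pos_ok as H. unfold check_pos in H.
  rewrite forallb_forall in H. specialize (H _ (in_residues a)).
  rewrite forallb_forall in H. specialize (H _ (in_residues b)).
  rewrite forallb_forall in H. specialize (H _ (in_residues c)).
  rewrite forallb_forall in H. specialize (H _ (in_residues d)).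
  rewrite !mod8_odd, Hc, Hd, s44_mod8, s4_mod8 in H.
  assert (E1 : ((a mod 8 * (d mod 8) - b mod 8 * (c mod 8)) mod 8 = 1)%Z).
  { transitivity ((a * d - b * c) mod 8)%Z. symmetry; cong8. now rewrite Hdet. }
  rewrite E1 in H. simpl implb in H. apply Z.eqb_eq in H.
  etransitivity. 2: etransitivity. 2: exact H. cong8. symmetry; cong8.
Qed.

Lemma congruence_neg (a b c d : Z) : (a * d - b * c = 1)%Z -> Z.odd c = true -> Z.odd d = true ->
  ((s4 c + (s44 c (- d) + c * (a + d - 3))) mod 8 = (- d * (- b + c - 3) - 3) mod 8)%Z.
Proof.
  intros Hdet Hc Hd. pose proof check_neg_ok as H. unfold check_neg in H.
  rewrite forallb_forall in H. specialize (H _ (in_residues a)).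
  rewrite forallb_forall in H. specialize (H _ (in_residues b)).
  rewrite forallb_forall in H. specialize (H _ (in_residues c)).
  rewrite forallb_forall in H. specialize (H _ (in_residues d)).
  assert (E2 : s44 (c mod 8) (- (d mod 8)) = s44 c (- d)).
  { rewrite <- (s44_mod8 (c mod 8)), <- (s44_mod8 c (- d)). f_equal. now rewrite Zmod_mod.
    symmetry. cong8. }
  rewrite !mod8_odd, Hc, Hd, E2, s4_mod8 in H.
  assert (E1 : ((a mod 8 * (d mod 8) - b mod 8 * (c mod 8)) mod 8 = 1)%Z).
  { transitivity ((a * d - b * c) mod 8)%Z. symmetry; cong8. now rewrite Hdet. }
  rewrite E1 in H. simpl implb in H. apply Z.eqb_eq in H.
  etransitivity. 2: etransitivity. 2: exact H. cong8. symmetry; cong8.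
Qed.

Lemma gcd_of_det (a b c d : Z) : (a * d - b * c = 1)%Z -> Z.gcd c d = 1%Z.
Proof.
  intros H. apply Z.bezout_1_gcd. exists (- b)%Z, a. lia.
Qed.

(* A multiple of the bottom added to the top makes it odd and positive. *)
Lemma kronecker_sqr (d c : Z) : (0 < c)%Z -> Z.odd c = true -> Z.gcd d c = 1%Z ->
  (kronecker d c * kronecker d c = 1)%Z.
Proof.
  intros Hc Hodd Hg.
  assert (Hex : exists k, (0 < d + k * c)%Z /\ Z.odd (d + k * c) = true).
  { destruct (Z.odd (d + (Z.abs d + 1) * c)) eqn:E.
    - exists (Z.abs d + 1)%Z. split; auto. nia.
    - exists (Z.abs d + 2)%Z. split. nia.
      replace (d + (Z.abs d + 2) * c)%Z with (d + (Z.abs d + 1) * c + c)%Z by ring. now rewrite Z.odd_add, E, Hodd. }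
  destruct Hex as [k [H1 H2]].
  rewrite (kronecker_mod_top d (d + k * c) c) by (auto; now rewrite Z_mod_plus_full).
  assert (Hg' : Z.gcd (d + k * c) c = 1%Z).
  { now rewrite Z.gcd_comm, Z.gcd_add_mult_diag_r, Z.gcd_comm. }
  pose proof (kronecker_reciprocity (d + k * c) c H1 Hc H2 Hodd Hg') as H.
  set (x := kronecker (d + k * c) c) in *. set (y := kronecker c (d + k * c)) in *.
  assert (x * y = 1 \/ x * y = -1)%Z by (destruct (_ && _)%bool in H; auto).
  assert (x = 1 \/ x = -1)%Z as [->| ->]; auto.
  destruct H0. apply Z.eq_mul_1 with y; auto. apply Z.eq_mul_1 with (- y)%Z. lia.
Qed.

Lemma IZR_sgn (b : bool) (x : Z) :
  RtoC (IZR ((if b then -1 else 1) * x)) = (e8 (if b then 4 else 0) * IZR x)%C.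
Proof.
  rewrite mult_IZR, RtoC_mult. f_equal. destruct b. now rewrite e8_4. now rewrite e8_0.
Qed.

Lemma kronecker_swap (c d : Z) : (0 < c)%Z -> (0 < d)%Z -> Z.odd c = true -> Z.odd d = true -> Z.gcd c d = 1%Z ->
  RtoC (IZR (kronecker d c)) = (e8 (s44 c d) * IZR (kronecker c d))%C.
Proof.
  intros Hc Hd oc od Hg. unfold s44. rewrite <- IZR_sgn. f_equal. f_equal.
  rewrite <- (kronecker_reciprocity c d Hc Hd oc od Hg).
  pose proof (kronecker_sqr c d Hd od Hg) as H.
  replace (kronecker c d * kronecker d c * kronecker c d)%Z with (kronecker c d * kronecker c d * kronecker d c)%Z by ring.
  rewrite H. ring.
Qed.

Theorem multiplier_odd (c : Z) : (0 < c)%Z -> Z.odd c = true -> forall a b d, (a * d - b * c = 1)%Z ->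
  theta_multiplier a b c d (IZR (kronecker d c) * e8 (c * (a + d - 3)))%C.
Proof.
  induction c as [c IH] using (well_founded_induction (Z.lt_wf 0)).
  assert (IH' : forall y, (y < c)%Z -> (0 < y)%Z -> Z.odd y = true -> forall a b d, (a * d - b * y = 1)%Z ->
    theta_multiplier a b y d (IZR (kronecker d y) * e8 (y * (a + d - 3)))%C).
  { intros y Hy Hy0. apply IH; lia. }
  clear IH. rename IH' into IH. intros Hc oc a b d Hdet.
  (* For c = 1 the matrix is the base matrix followed on the right by the translation by d. *)
  destruct (Z.eq_dec c 1) as [->|Hc1].
  - pose proof (multiplier_T a (-1) 1 0 d _ (multiplier_base a) ltac:(lia)) as H.
    replace (-1 + d * a)%Z with b in H by lia. replace (0 + d * 1)%Z with d in H by lia.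
    replace (IZR (kronecker d 1) * e8 (1 * (a + d - 3)))%C with
      (Cexp (PI * Ci * IZR a / 4) * Cexp (- (3 * PI * Ci / 4)) * Cexp (PI * Ci * IZR d / 4))%C. exact H.
    change (kronecker d 1) with 1%Z. unfold e8. rewrite <- !Cexp_plus, Cmult_1_l. f_equal.
    rewrite Z.mul_1_l, minus_IZR, plus_IZR, RtoC_minus, RtoC_plus. field.
  - assert (Hd1 : exists k d1, (d = d1 + k * c /\ Z.odd d1 = true /\ - c < d1 < c /\ d1 <> 0)%Z).
    { pose proof (Z.div_mod d c ltac:(lia)) as E. pose proof (Z.mod_pos_bound d c Hc) as B.
      destruct (Z.odd (d mod c)) eqn:Eo.
      - exists (d / c)%Z, (d mod c)%Z. repeat split; auto; try lia. intros E0. rewrite E0 in Eo. discriminate.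
      - exists (d / c + 1)%Z, (d mod c - c)%Z. repeat split; try lia.
        + unfold Z.sub. now rewrite Z.odd_add, Z.odd_opp, Eo, oc.
        + enough (d mod c <> 0)%Z by lia. intros E0. rewrite E0 in E.
          assert (c * (a * (d / c) - b) = 1)%Z by nia. assert (c = 1 \/ c = -1)%Z by (eapply Z.mul_eq_1; eauto). lia. }
    destruct Hd1 as [k [d1 [Ed [od1 [Bd1 Hd0]]]]].
    set (b1 := (b - k * a)%Z). assert (Hdet1 : (a * d1 - b1 * c = 1)%Z) by (unfold b1; nia).
    pose proof (gcd_of_det _ _ _ _ Hdet1) as Hg.
    assert (Hmain : theta_multiplier a b1 c d1 (IZR (kronecker d1 c) * e8 (c * (a + d1 - 3)))%C).
    { destruct (Z.lt_trichotomy d1 0) as [Hneg|[H0|Hpos]]; [|lia|].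
      - pose proof (IH (- d1)%Z ltac:(lia) ltac:(lia) ltac:(now rewrite Z.odd_opp) (- b1)%Z a c ltac:(lia)) as H.
        apply multiplier_S_neg in H; [|lia|lia].
        replace (IZR (kronecker d1 c) * e8 (c * (a + d1 - 3)))%C
          with (IZR (kronecker c (- d1)) * e8 (- d1 * (- b1 + c - 3)) * Cexp (- (3 * PI * Ci / 4)))%C. exact H.
        replace (Cexp (- (3 * PI * Ci / 4))) with (e8 (-3)) by (unfold e8; f_equal; field).
        rewrite <- Cmult_assoc, <- e8_plus.
        replace d1 with (- - d1)%Z at 3 by lia. rewrite (kronecker_opp_top (- d1) c Hc oc), IZR_sgn.
        rewrite (kronecker_swap c (- d1)); auto; try lia. 2: now rewrite Z.odd_opp. 2: now rewrite Z.gcd_opp_r.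
        fold (s4 c).
        replace (e8 (s4 c) * (e8 (s44 c (- d1)) * IZR (kronecker c (- d1))) * e8 (c * (a + d1 - 3)))%C
          with (IZR (kronecker c (- d1)) * (e8 (s4 c) * (e8 (s44 c (- d1)) * e8 (c * (a + d1 - 3)))))%C by ring.
        rewrite <- !e8_plus. f_equal. symmetry. apply e8_mod.
        rewrite (congruence_neg a b1 c d1 Hdet1 oc od1). f_equal.
      - pose proof (IH d1 ltac:(lia) ltac:(lia) od1 b1 (- a)%Z (- c)%Z ltac:(rewrite <- Hdet1; ring)) as H.
        apply multiplier_S_pos in H; [|lia|lia].
        replace (IZR (kronecker d1 c) * e8 (c * (a + d1 - 3)))%C
          with (IZR (kronecker (- c) d1) * e8 (d1 * (b1 + - c - 3)) * Cexp (3 * PI * Ci / 4))%C. exact H.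
        replace (Cexp (3 * PI * Ci / 4)) with (e8 3) by (unfold e8; f_equal; field).
        rewrite <- Cmult_assoc, <- e8_plus.
        rewrite (kronecker_opp_top c d1 Hpos od1), IZR_sgn. fold (s4 d1).
        rewrite (kronecker_swap c d1); auto.
        replace (e8 (s4 d1) * IZR (kronecker c d1) * e8 (d1 * (b1 + - c - 3) + 3))%C
          with (IZR (kronecker c d1) * (e8 (s4 d1) * e8 (d1 * (b1 + - c - 3) + 3)))%C by ring.
        replace (e8 (s44 c d1) * IZR (kronecker c d1) * e8 (c * (a + d1 - 3)))%C
          with (IZR (kronecker c d1) * (e8 (s44 c d1) * e8 (c * (a + d1 - 3))))%C by ring.
        rewrite <- !e8_plus. f_equal. symmetry. apply e8_mod.
        rewrite (congruence_pos a b1 c d1 Hdet1 oc od1). f_equal. }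
    pose proof (multiplier_T _ _ _ _ k _ Hmain Hc) as H.
    replace (b1 + k * a)%Z with b in H by (unfold b1; lia). rewrite <- Ed in H.
    replace (IZR (kronecker d c) * e8 (c * (a + d - 3)))%C
      with (IZR (kronecker d1 c) * e8 (c * (a + d1 - 3)) * Cexp (PI * Ci * IZR k / 4))%C. exact H.
    replace (Cexp (PI * Ci * IZR k / 4)) with (e8 k) by (unfold e8; f_equal; field).
    rewrite <- Cmult_assoc, <- e8_plus. f_equal.
    + rewrite (kronecker_mod_top d d1 c Hc oc). reflexivity. rewrite Ed. now rewrite Z_mod_plus_full.
    + apply e8_mod. rewrite Ed.
      (* Replacing d1 by d1 + k c adds k c^2 to the exponent, which is k modulo 8: exactly the
         factor of the translation by k. *)
      destruct (odd_sqr_mod8 c oc) as [q Hq].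
      replace (c * (a + (d1 + k * c) - 3))%Z with (c * (a + d1 - 3) + k + (k * q) * 8)%Z by nia.
      now rewrite Z_mod_plus_full.
Qed.

Lemma det_parity (a b c d : Z) : (a * d - b * c = 1)%Z -> Z.odd c = false -> Z.odd d = true.
Proof.
  intros H Hc. apply (f_equal Z.odd) in H. rewrite Z.odd_sub, !Z.odd_mul, Hc in H.
  destruct (Z.odd d); auto. now rewrite !Bool.andb_false_r in H.
Qed.

Lemma kronecker_neg_bottom (c d : Z) : (0 < c)%Z -> (d < 0)%Z -> kronecker c d = kronecker c (- d).
Proof.
  intros Hc Hd. unfold kronecker.
  rewrite (proj2 (Z.eqb_neq d 0)), (proj2 (Z.eqb_neq (- d) 0)) by lia.
  rewrite (proj2 (Z.ltb_ge c 0)) by lia. rewrite !Bool.andb_false_r.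
  replace (Z.abs_nat (- d)) with (Z.abs_nat d) by lia. reflexivity.
Qed.

(** When c is even d is odd, so one inversion leads to the odd case with lower left entry |d|. *)
Theorem multiplier_even (a b c d : Z) : (0 < c)%Z -> Z.odd c = false -> (a * d - b * c = 1)%Z ->
  theta_multiplier a b c d (IZR (kronecker c d) * e8 (d * (b - c + 3) - 3))%C.
Proof.
  intros Hc oc Hdet. pose proof (det_parity a b c d Hdet oc) as od.
  destruct (Z.lt_trichotomy d 0) as [Hneg|[H0|Hpos]].
  - pose proof (multiplier_odd (- d)%Z ltac:(lia) ltac:(now rewrite Z.odd_opp) (- b)%Z a c ltac:(lia)) as H.
    apply multiplier_S_neg in H; [|lia|lia].
    rewrite kronecker_neg_bottom by auto.
    replace (IZR (kronecker c (- d)) * e8 (d * (b - c + 3) - 3))%C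
      with (IZR (kronecker c (- d)) * e8 (- d * (- b + c - 3)) * Cexp (- (3 * PI * Ci / 4)))%C. exact H.
    replace (Cexp (- (3 * PI * Ci / 4))) with (e8 (-3)) by (unfold e8; f_equal; field).
    rewrite <- Cmult_assoc, <- e8_plus. f_equal. f_equal. lia.
  - subst d. discriminate.
  - pose proof (multiplier_odd d Hpos od b (- a)%Z (- c)%Z ltac:(lia)) as H.
    apply multiplier_S_pos in H; [|lia|lia].
    replace (IZR (kronecker c d) * e8 (d * (b - c + 3) - 3))%C
      with (IZR (kronecker (- c) d) * e8 (d * (b + - c - 3)) * Cexp (3 * PI * Ci / 4))%C. exact H.
    replace (Cexp (3 * PI * Ci / 4)) with (e8 3) by (unfold e8; f_equal; field).
    rewrite (kronecker_opp_top c d Hpos od), IZR_sgn. fold (s4 d).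
    replace (e8 (s4 d) * IZR (kronecker c d) * e8 (d * (b + - c - 3)) * e8 3)%C
      with (IZR (kronecker c d) * (e8 (s4 d) * (e8 (d * (b + - c - 3)) * e8 3)))%C by ring.
    rewrite <- !e8_plus. f_equal. apply e8_mod.
    (* The two exponents differ by 6 d - 6, which for odd d is 4 modulo 8 exactly when d = 3 modulo
       4: the sign between (-c/d) and (c/d). *)
    assert (E : ((6 * d - 6) mod 8 = (s4 d) mod 8)%Z).
    { pose proof (in_residues d) as Hr. rewrite <- (mod8_odd d) in od. rewrite <- s4_mod8.
      rewrite Zminus_mod, Zmult_mod.
      set (r := (d mod 8)%Z) in *. clearbody r.
      simpl in Hr. decompose [or] Hr; subst; try discriminate; try reflexivity; contradiction. }
    replace (d * (b - c + 3) - 3)%Z with (d * (b + - c - 3) + 3 + (6 * d - 6))%Z by ring.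
    rewrite Z.add_comm. rewrite Zplus_mod, <- E, <- Zplus_mod. f_equal.
Qed.

Lemma Cpow3_kron (k : Z) (x : C) : (k * k = 1)%Z -> ((IZR k * x) ^ 3 = IZR k * (x * x * x))%C.
Proof.
  intros H. assert (H1 : (IZR k * IZR k = 1)%C) by (rewrite <- RtoC_mult, <- mult_IZR, H; reflexivity).
  replace ((IZR k * x) ^ 3)%C with ((IZR k * IZR k) * IZR k * (x * x * x))%C by ring. rewrite H1. ring.
Qed.

Lemma Cexp_twelfth_cube (n : Z) : (Cexp (PI * Ci / 12 * IZR n) * Cexp (PI * Ci / 12 * IZR n) * Cexp (PI * Ci / 12 * IZR n) = e8 n)%C.
Proof. rewrite <- !Cexp_plus. unfold e8. f_equal. field. Qed.

(** A sign is its own cube and e^(pi i n / 12) cubes to [e8 n]. The terms with c^2 - 1 for c odd, or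
    1 - d^2 for c even, vanish modulo 8 because odd squares are 1 there. *)
Theorem multiplier_chi (a b c d : Z) : (0 < c)%Z -> (a * d - b * c = 1)%Z ->
  theta_multiplier a b c d (chi a b c d ^ 3)%C /\ chi a b c d <> 0.
Proof.
  intros Hc Hdet. pose proof (gcd_of_det _ _ _ _ Hdet) as Hg.
  assert (Hnz : forall (k : Z) (x : C), (k * k = 1)%Z -> (IZR k * Cexp x)%C <> 0).
  { intros k x Hk. apply Cmult_neq_0. 2: apply Cexp_neq0. apply RtoC_neq0. apply not_0_IZR. lia. }
  unfold chi. destruct (Z.odd c) eqn:oc.
  - rewrite (Z.abs_eq c) by lia.
    assert (Hk : (kronecker d c * kronecker d c = 1)%Z) by (apply kronecker_sqr; auto; now rewrite Z.gcd_comm).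
    split; [|now apply Hnz]. rewrite Cpow3_kron, Cexp_twelfth_cube by auto.
    replace (e8 ((a + d) * c - b * d * (c ^ 2 - 1) - 3 * c)) with (e8 (c * (a + d - 3))).
    now apply multiplier_odd.
    apply e8_mod. destruct (odd_sqr_mod8 c oc) as [q Hq].
    replace ((a + d) * c - b * d * (c ^ 2 - 1) - 3 * c)%Z with (c * (a + d - 3) + (- b * d * q) * 8)%Z by nia.
    now rewrite Z_mod_plus_full.
  - pose proof (det_parity a b c d Hdet oc) as od.
    assert (Hk : (kronecker c d * kronecker c d = 1)%Z).
    { destruct (Z.lt_trichotomy d 0) as [Hneg|[H0|Hpos]].
      - rewrite kronecker_neg_bottom by auto. apply kronecker_sqr. lia. now rewrite Z.odd_opp. now rewrite Z.gcd_opp_r.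
      - subst d. discriminate.
      - now apply kronecker_sqr. }
    split; [|now apply Hnz]. rewrite Cpow3_kron, Cexp_twelfth_cube by auto.
    replace (e8 (a * c * (1 - d ^ 2) + d * (b - c + 3) - 3)) with (e8 (d * (b - c + 3) - 3)).
    now apply multiplier_even.
    apply e8_mod. destruct (odd_sqr_mod8 d od) as [q Hq].
    replace (a * c * (1 - d ^ 2) + d * (b - c + 3) - 3)%Z with (d * (b - c + 3) - 3 + (- a * c * q) * 8)%Z by nia.
    now rewrite Z_mod_plus_full.
Qed.

(** * The primitive of the Eichler integrand *)

Definition ampl (u v : R) (tau : C) (n : Z) : C :=
  (powerRZ (-1) n * Cexp (PI * Ci * ((half n + u) ^ 2)%R * tau + 2 * PI * Ci * half n * v))%C.

Definition Hterm (u v : R) (tau : C) (n : Z) (y : C) : C :=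
  (ampl u v tau n * Gp ((half n + u)%R * y))%C.

(* The primitive, in the coordinate y = sqrt (i (w - tau)), of theta / sqrt (i (w - tau)) up to the factor -2i. *)
Definition Hprim (u v : R) (tau y : C) : C := ZSeries (fun n => Hterm u v tau n y).

(** The limit of -2i [Hprim] in a sector around i R_+; [psi_Slim] identifies it with the false theta
    function up to an explicit exponential. *)
Definition Slim (u v : R) (tau : C) : C := ZSeries (fun n => ampl u v tau n * sign (half n + u))%C.

Lemma Cmod_ampl u v tau n : Cmod (ampl u v tau n) = exp (- (PI * Im tau * (half n + u) ^ 2)).
Proof.
  unfold ampl. rewrite Cmod_mult, Cmod_R, Rabs_powerRZ_m1, Rmult_1_l, Cmod_Cexp. f_equal.
  repeat progress reim. ring.
Qed.

Lemma Im_lift (tau y : C) : Im (tau - Ci * (y * y)) = Im tau - Re (y * y).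
Proof. repeat progress reim. ring. Qed.

Lemma theta_term_ampl u v tau n y :
  theta_term u v (tau - Ci * (y * y)) n = (ampl u v tau n * ((half n + u)%R * E2 ((half n + u)%R * y)))%C.
Proof.
  unfold theta_term, ampl, E2. set (x := half n + u).
  replace (PI * Ci * (x ^ 2)%R * (tau - Ci * (y * y)) + 2 * PI * Ci * half n * v)%C
    with (PI * Ci * (x ^ 2)%R * tau + 2 * PI * Ci * half n * v + PI * (x * y * (x * y)))%C.
  - rewrite (Cexp_plus _ (PI * (x * y * (x * y)))). ring.
  - rewrite !RtoC_pow. replace (PI * Ci * (x ^ 2) * (tau - Ci * (y * y)))%C
      with (PI * Ci * x ^ 2 * tau - (Ci * Ci) * (PI * x ^ 2 * (y * y)))%C by ring. rewrite Ci2. ring.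
Qed.

Lemma Cmod_Gp_le (z : C) : Cmod (Gp z) <= exp (PI * Rmax 0 (Re (z * z))) * Cmod z.
Proof.
  pose proof PI_RGT_0.
  replace (Gp z) with (Gp (0 + z) - Gp 0)%C by (rewrite Gp_0; replace (0 + z)%C with z by ring; ring).
  apply holo_deriv_mvt with E2. intros; apply holo_deriv_Gp. intros t Ht. rewrite Cmod_E2. apply exp_le_mono.
  apply Rmult_le_compat_l. lra. repeat progress reim.
  replace ((0 + (t * Re z - 0 * Im z)) ^ 2 - (0 + (t * Im z + 0 * Re z)) ^ 2)
    with (t ^ 2 * (Re z * Re z - Im z * Im z)) by ring.
  pose proof (Rmax_l 0 (Re z * Re z - Im z * Im z)). pose proof (Rmax_r 0 (Re z * Re z - Im z * Im z)).
  assert (t ^ 2 <= 1) by nra. pose proof (pow2_ge_0 t). nra.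
Qed.

(** [Gp (x y)] grows at most like e^(pi x^2 max (0, Re (y^2))), up to a linear factor, and the
    amplitude decays like e^(-pi x^2 Im tau); the hypotheses make the decay win. *)
Lemma Hterm_bounded u v tau y : 0 < Im tau -> Re (y * y) < Im tau -> exists K, Zbounded (fun n => Hterm u v tau n y) K.
Proof.
  intros Ht Hy. pose proof PI_RGT_0 as Hpi. set (m := Rmax 0 (Re (y * y))).
  assert (Hm : m < Im tau) by (unfold m; apply Rmax_lub_lt; auto).
  destruct (gaussian_dominated (Rabs (1 / 2 + u)) (PI * (Im tau - m))) as [K [HK H]]. nra.
  exists (Cmod y * K). intros n. specialize (H (1 / 2 + u) n (Rle_refl _)). rewrite <- half_shift in H.
  unfold Hterm. rewrite Cmod_mult, Cmod_ampl. set (x := half n + u) in *.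
  apply Rle_trans with (exp (- (PI * Im tau * x ^ 2)) * (exp (PI * (m * x ^ 2)) * Cmod (x * y))).
  - apply Rmult_le_compat_l. left; apply exp_pos. apply Rle_trans with (1 := Cmod_Gp_le _).
    apply Rmult_le_compat_r. apply Cmod_ge_0. apply exp_le_mono. apply Rmult_le_compat_l. lra.
    replace (Re (x * y * (x * y))) with (Re (y * y) * x ^ 2) by (repeat progress reim; ring).
    pose proof (pow2_ge_0 x). pose proof (Rmax_l 0 (Re (y * y))) as R1. pose proof (Rmax_r 0 (Re (y * y))) as R2. fold m in R1, R2.
    apply Rmax_lub; nra.
  - rewrite <- Rmult_assoc, <- exp_plus, Cmod_mult, Cmod_R.
    replace (- (PI * Im tau * x ^ 2) + PI * (m * x ^ 2)) with (- (PI * (Im tau - m) * x ^ 2)) by ring.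
    rewrite (Rmult_assoc (Cmod y)).
    replace (exp (- (PI * (Im tau - m) * x ^ 2)) * (Rabs x * Cmod y)) with (Cmod y * (Rabs x * exp (- (PI * (Im tau - m) * x ^ 2)))) by ring.
    apply Rmult_le_compat_l. apply Cmod_ge_0. apply Rle_trans with (2 := H). apply Rmult_le_compat_r.
    left; apply exp_pos. apply cube_dom, Rabs_pos.
Qed.

Lemma holo_deriv_Hprim u v tau y : 0 < Im tau -> Re (y * y) < Im tau ->
  holo_deriv (Hprim u v tau) y (theta u v (tau - Ci * (y * y))).
Proof.
  intros Ht Hy. pose proof PI_RGT_0 as Hpi. pose proof (Cmod_ge_0 y) as Hy0.
  set (eta := (Im tau - Re (y * y)) / 2). assert (He : 0 < eta) by (unfold eta; lra).
  (* For |k| < delta, |k| |2 y + k| <= delta (2 |y| + 1) <= eta, so half of the gap Im tau - Re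
     (y^2) survives at y + k. *)
  set (delta := Rmin 1 (eta / (2 * Cmod y + 1))).
  assert (Hd : 0 < delta) by (unfold delta; apply Rmin_glb_lt; [lra|apply Rdiv_lt_0_compat; lra]).
  assert (Hd1 : delta <= 1) by apply Rmin_l. assert (Hd2 : delta * (2 * Cmod y + 1) <= eta).
  { apply Rle_trans with (eta / (2 * Cmod y + 1) * (2 * Cmod y + 1)). apply Rmult_le_compat_r. lra. apply Rmin_r.
    right; field; lra. }
  assert (Hk : forall k, Cmod k < delta -> Re ((y + k) * (y + k)) <= Im tau - eta /\ Cmod (y + k) <= Cmod y + 1).
  { intros k Hk. pose proof (Cmod_ge_0 k). split.
    - replace ((y + k) * (y + k))%C with (y * y + k * (2 * y + k))%C by ring. rewrite Re_plus.
      assert (Re (k * (2 * y + k)) <= eta).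
      { apply Rle_trans with (1 := Re_le_Cmod _). rewrite Cmod_mult. apply Rle_trans with (2 := Hd2).
        apply Rmult_le_compat; try apply Cmod_ge_0. lra. apply Rle_trans with (1 := Cmod_triangle _ _).
        rewrite Cmod_mult, Cmod_R, Rabs_pos_eq; lra. }
      unfold eta in *. lra.
    - apply Rle_trans with (1 := Cmod_triangle _ _). lra. }
  destruct (gaussian_dominated (Rabs (1 / 2 + u)) (PI * eta)) as [K [HK H]]. nra.
  apply (holo_deriv_ZSeries (Hterm u v tau) (fun n y => theta_term u v (tau - Ci * (y * y)) n) y (2 * PI * (Cmod y + 1) * K) delta Hd).
  - intros k Hkd. apply Hterm_bounded; auto. destruct (Hk k Hkd). lra.
  - apply theta_term_bounded. rewrite Im_lift. lra.
  - intros k n Hkd. specialize (H (1 / 2 + u) n (Rle_refl _)). rewrite <- half_shift in H.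
    set (x := half n + u) in *. set (A := ampl u v tau n).
    apply (holo_deriv_taylor2 (Hterm u v tau n) (fun y => theta_term u v (tau - Ci * (y * y)) n)
      (fun y => A * (2 * PI * x * x * x * y * E2 (x * y)))%C).
    + intros t Hti. unfold Hterm. fold A x. eapply holo_deriv_eq. apply holo_deriv_scal.
      apply (holo_deriv_comp Gp (fun w => x * w)%C). apply holo_deriv_scal. apply holo_deriv_id. apply holo_deriv_Gp.
      rewrite theta_term_ampl. fold A x. ring.
    + intros t Hti. replace (fun y0 : C => theta_term u v (tau - Ci * (y0 * y0)) n) with (fun y0 : C => (A * (x * E2 (x * y0)))%C).
      2: { apply functional_extensionality. intros y0. now rewrite theta_term_ampl. }
      eapply holo_deriv_eq. apply holo_deriv_scal. apply holo_deriv_scal. apply holo_deriv_E2_scal. ring.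
    + intros t Hti.
      assert (Htk : Cmod (t * k) < delta).
      { rewrite Cmod_mult, Cmod_R, Rabs_pos_eq by lra. pose proof (Cmod_ge_0 k). nra. }
      destruct (Hk _ Htk) as [H1 H2]. set (w := (y + t * k)%C) in *.
      rewrite Cmod_mult. unfold A. rewrite Cmod_ampl. fold x.
      rewrite !Cmod_mult, !Cmod_R, Cmod_E2, (Rabs_pos_eq 2), (Rabs_pos_eq PI) by lra.
      assert (Hexp : exp (- (PI * Im tau * x ^ 2)) * exp (PI * (Re (x * w) ^ 2 - Im (x * w) ^ 2)) <= exp (- (PI * eta * x ^ 2))).
      { rewrite <- exp_plus. apply exp_le_mono.
        replace (Re (x * w) ^ 2 - Im (x * w) ^ 2) with (Re (w * w) * x ^ 2) by (repeat progress reim; ring).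
        pose proof (pow2_ge_0 x). assert (PI * x ^ 2 * Re (w * w) <= PI * x ^ 2 * (Im tau - eta)) by (apply Rmult_le_compat_l; nra). lra. }
      set (e1 := exp (- (PI * Im tau * x ^ 2))) in *. set (e2 := exp (PI * (Re (x * w) ^ 2 - Im (x * w) ^ 2))) in *.
      assert (0 <= e1 * e2) by (apply Rmult_le_pos; left; apply exp_pos).
      replace (e1 * (2 * PI * Rabs x * Rabs x * Rabs x * Cmod w * e2)) with (2 * PI * Cmod w * (Rabs x ^ 3 * (e1 * e2))) by ring.
      replace (2 * PI * (Cmod y + 1) * K * Zb n) with (2 * PI * (Cmod y + 1) * (K * Zb n)) by ring.
      apply Rmult_le_compat.
      * apply Rmult_le_pos. lra. apply Cmod_ge_0.
      * apply Rmult_le_pos; auto. apply pow_le, Rabs_pos.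
      * apply Rmult_le_compat_l; lra.
      * apply Rle_trans with (2 := H). apply Rmult_le_compat; auto. apply pow_le, Rabs_pos. apply cube_dom, Rabs_pos.
Qed.

Lemma sign_cases (x : R) : (0 < x /\ sign x = 1) \/ (x = 0 /\ sign x = 0) \/ (x < 0 /\ sign x = -1).
Proof.
  destruct (Rtotal_order x 0) as [H|[H|H]].
  - right; right. split; auto. now apply sign_eq_m1.
  - right; left. split; auto. rewrite H. apply sign_0.
  - left. split; auto. now apply sign_eq_1.
Qed.

Definition sector (kap : R) (y : C) : Prop := 0 < Im y /\ Re (y * y) <= - kap * Cmod y ^ 2.

Lemma sector_scal kap (x : R) y : 0 < x -> sector kap y -> sector kap (x * y).
Proof.
  intros Hx [H1 H2]. split. repeat progress reim. nra.
  replace (Re (x * y * (x * y))) with (x ^ 2 * Re (y * y)) by (repeat progress reim; ring).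
  rewrite Cmod_mult, Cmod_R, Rabs_pos_eq by lra. rewrite Rpow_mult_distr. pose proof (pow2_ge_0 x). nra.
Qed.

Lemma Gp_sign_reduce kap (x : R) y : x <> 0 -> sector kap y -> exists t, sector kap t /\ Cmod t = Rabs x * Cmod y /\
  Cmod (Gp (x * y) - Ci / 2 * sign x) = Cmod (Gp t - Ci / 2).
Proof.
  intros Hx Hs. destruct (sign_cases x) as [[H E]|[[H E]|[H E]]]; [| contradiction |].
  - exists (x * y)%C. split; [now apply sector_scal|]. split. now rewrite Cmod_mult, Cmod_R.
    rewrite E. f_equal. ring.
  - exists ((- x)%R * y)%C. split; [apply sector_scal; auto; lra|]. split. now rewrite Cmod_mult, Cmod_R, Rabs_Ropp.
    rewrite E, RtoC_opp. replace (x * y)%C with (- (- x * y))%C by ring. rewrite Gp_opp.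
    replace (RtoC (-1)) with (- (1))%C by (rewrite <- RtoC_opp; f_equal; ring).
    rewrite <- Cmod_opp. f_equal. ring.
Qed.

Lemma Hprim_limit {T : Type} (F : (T -> Prop) -> Prop) {FF : Filter F} (Y : T -> C) (kap u v : R) (tau : C) :
  0 < Im tau -> 0 < kap -> F (fun t => sector kap (Y t)) -> (forall M, F (fun t => M <= Cmod (Y t))) ->
  forall eps, 0 < eps -> F (fun t => Cmod (Hprim u v tau (Y t) - Ci / 2 * Slim u v tau) <= eps).
Proof.
  intros Ht Hk Hs HM eps He. pose proof PI_RGT_0 as Hpi.
  assert (HPk : 0 < PI * kap) by nra. pose proof (Rinv_0_lt_compat _ HPk) as HPi.
  (* 2 + 1/(pi kap) bounds the distance of [Gp] to its limit in the sector and 1/2 bounds the limit,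
     so B dominates both. *)
  set (B := 2 + / (PI * kap) + 1 / 2).
  destruct (gaussian_dominated (Rabs (1 / 2 + u)) (PI * Im tau)) as [K [HK H]]. nra.
  assert (Hdom : forall n, Cmod (ampl u v tau n) <= K * Zb n).
  { intros n. specialize (H (1 / 2 + u) n (Rle_refl _)). rewrite <- half_shift in H. rewrite Cmod_ampl.
    apply Rle_trans with (2 := H). rewrite <- (Rmult_1_l (exp _)) at 1. apply Rmult_le_compat_r.
    left; apply exp_pos. apply cube_dom, Rabs_pos. }
  assert (Hsg : forall x, Cmod (Ci / 2 * sign x) <= 1 / 2).
  { intros x. rewrite Cmod_mult, Cmod_R. replace (Ci / 2)%C with (Ci * (1 / 2)%R)%C by (rewrite RtoC_div by lra; field).
    rewrite Cmod_mult, Cmod_Ci, Cmod_R, (Rabs_pos_eq (1 / 2)) by lra.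
    destruct (sign_cases x) as [[_ ->]|[[_ ->]|[_ ->]]];
    [rewrite Rabs_R1 | rewrite Rabs_R0 | rewrite Rabs_left by lra]; lra. }
  assert (HSb : Zbounded (fun n => ampl u v tau n * sign (half n + u))%C K).
  { intros n. rewrite Cmod_mult, Cmod_R. apply Rle_trans with (2 := Hdom n).
    rewrite <- (Rmult_1_r (Cmod (ampl u v tau n))) at 2. apply Rmult_le_compat_l. apply Cmod_ge_0.
    destruct (sign_cases (half n + u)) as [[_ ->]|[[_ ->]|[_ ->]]];
    [rewrite Rabs_R1 | rewrite Rabs_R0 | rewrite Rabs_left by lra]; lra. }
  unfold Slim. rewrite <- (ZSeries_scal _ _ _ HSb).
  apply (ZSeries_tannery F (fun t n => Hterm u v tau n (Y t)) (fun n => Ci / 2 * (ampl u v tau n * sign (half n + u)))%C (K * B)); auto.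
  - eapply filter_imp. 2: exact Hs. intros t Hst n. unfold Hterm. rewrite Cmod_mult.
    replace (K * B * Zb n) with (K * Zb n * B) by ring.
    apply Rmult_le_compat; try apply Cmod_ge_0. apply Hdom.
    set (x := half n + u). destruct (Req_dec x 0) as [->|Hx].
    + replace (0 * Y t)%C with (RtoC 0) by ring. rewrite Gp_0, Cmod_0. unfold B. lra.
    + destruct (Gp_sign_reduce kap x (Y t) Hx Hst) as [s [[S1 S2] [E1 E2]]].
      replace (Gp (x * Y t)) with ((Gp (x * Y t) - Ci / 2 * sign x) + Ci / 2 * sign x)%C by ring.
      apply Rle_trans with (1 := Cmod_triangle _ _). rewrite E2. unfold B. apply Rplus_le_compat.
      now apply Gp_limit_bound. apply Hsg.
  - intros n. replace (Ci / 2 * (ampl u v tau n * sign (half n + u)))%C with (ampl u v tau n * (Ci / 2 * sign (half n + u)))%C by ring.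
    rewrite Cmod_mult. replace (K * B * Zb n) with (K * Zb n * B) by ring.
    apply Rmult_le_compat; try apply Cmod_ge_0. apply Hdom. apply Rle_trans with (1 := Hsg _). unfold B. lra.
  - intros n e Hpe. set (x := half n + u). unfold Hterm. fold x.
    destruct (Req_dec x 0) as [Hx|Hx].
    (* A term with m + u = 0 is identically zero on both sides: [sign 0 = 0] matches [Gp 0 = 0]. *)
    + apply filter_forall. intros t. rewrite Hx, sign_0. replace (0 * Y t)%C with (RtoC 0) by ring. rewrite Gp_0.
      match goal with |- Cmod ?z <= _ => replace z with (RtoC 0) by ring end. rewrite Cmod_0. lra.
    + set (A := ampl u v tau n). pose proof (Cmod_ge_0 A) as HA. pose proof (Rabs_pos_lt x Hx) as Hax.
      set (M := (1 + (Cmod A + 1) * (2 / (PI * kap)) / e) / Rabs x).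
      eapply filter_imp. 2: apply (filter_and _ _ Hs (HM M)). intros t [Hst HMt].
      destruct (Gp_sign_reduce kap x (Y t) Hx Hst) as [s [[S1 S2] [E1 E2]]].
      replace (A * Gp (x * Y t) - Ci / 2 * (A * sign x))%C with (A * (Gp (x * Y t) - Ci / 2 * sign x))%C by ring.
      rewrite Cmod_mult, E2.
      assert (Hq : 0 < (Cmod A + 1) * (2 / (PI * kap))) by (apply Rmult_lt_0_compat; [lra|apply Rdiv_lt_0_compat; lra]).
      assert (Hqe : 0 < (Cmod A + 1) * (2 / (PI * kap)) / e) by (apply Rdiv_lt_0_compat; lra).
      assert (Hs1 : 1 + (Cmod A + 1) * (2 / (PI * kap)) / e <= Cmod s).
      { rewrite E1. apply Rle_trans with (Rabs x * M). right; unfold M; field; repeat split; lra. apply Rmult_le_compat_l; lra. }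
      apply Rle_trans with ((Cmod A + 1) * (2 / (PI * kap) / Cmod s)).
      * apply Rmult_le_compat; try apply Cmod_ge_0. lra. apply Gp_limit_rate; auto. lra.
      * unfold Rdiv at 1. rewrite <- Rmult_assoc. apply Rle_div_l. lra.
        assert (E3 : (Cmod A + 1) * (2 / (PI * kap)) = e * ((Cmod A + 1) * (2 / (PI * kap)) / e)) by (field; split; lra).
        rewrite E3 at 1. apply Rmult_le_compat_l; lra.
Qed.

Lemma Hprim_0 u v tau : Hprim u v tau 0 = 0.
Proof.
  unfold Hprim. rewrite (ZSeries_single 0).
  - unfold Hterm. rewrite Cmult_0_r, Gp_0. ring.
  - intros n _. unfold Hterm. rewrite Cmult_0_r, Gp_0. ring.
Qed.

(** Completing the square: m^2 tau + 2 m z = (m + u)^2 tau + 2 m v - u^2 tau when z = u tau + v. *)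
Lemma psi_Slim (z tau : C) (u v : R) : 0 < Im tau -> u = Im z / Im tau -> (z = u * tau + v)%C ->
  psi z tau = (Ci * Cexp (- (PI * Ci * (u ^ 2)%R * tau)) * Slim u v tau)%C.
Proof.
  intros Ht Hu Hz.
  assert (HSb : exists K, Zbounded (fun n => ampl u v tau n * sign (half n + u))%C K).
  { pose proof PI_RGT_0. destruct (gaussian_dominated (Rabs (1 / 2 + u)) (PI * Im tau)) as [K [HK H1]]. nra.
    exists K. intros n. specialize (H1 (1 / 2 + u) n (Rle_refl _)). rewrite <- half_shift in H1.
    rewrite Cmod_mult, Cmod_R, Cmod_ampl, Rmult_comm. apply Rle_trans with (2 := H1). apply Rmult_le_compat_r.
    left; apply exp_pos. apply Rle_trans with 1. 2: apply cube_dom, Rabs_pos.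
    destruct (sign_cases (half n + u)) as [[_ ->]|[[_ ->]|[_ ->]]];
    [rewrite Rabs_R1 | rewrite Rabs_R0 | rewrite Rabs_left by lra]; lra. }
  destruct HSb as [K HK]. unfold psi, Slim. rewrite <- Hu, <- (Cmult_assoc Ci (Cexp _)), <- (ZSeries_scal _ _ _ HK). f_equal.
  apply ZSeries_ext. intros n. cbv zeta. unfold ampl. set (m := half n).
  rewrite <- (Cmult_assoc _ (Cexp _) (Cexp _)), <- Cexp_plus.
  replace (PI * Ci * (m ^ 2)%R * tau + 2 * PI * Ci * m * z)%C
    with (- (PI * Ci * (u ^ 2)%R * tau) + (PI * Ci * ((m + u) ^ 2)%R * tau + 2 * PI * Ci * m * v))%C.
  - rewrite Cexp_plus. ring.
  - rewrite Hz, !RtoC_pow, RtoC_plus. ring.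
Qed.

Lemma eichler_integrand_theta (z tau w : C) (u v : R) : 0 < Im w -> u = Im z / Im tau -> (z = u * tau + v)%C ->
  eichler_integrand z tau w = (theta u v w / Csqrt (Ci * (w - tau)))%C.
Proof.
  intros Hw Hu Hz. unfold eichler_integrand. cbv zeta. rewrite <- Hu.
  unfold Cdiv. rewrite Cmult_assoc. f_equal.
  destruct (theta_term_bounded u v w Hw) as [K HK].
  assert (E : forall n, (powerRZ (-1) n * (half n + u)%R *
     Cexp (PI * Ci * ((half n ^ 2)%R * w + 2 * half n * (z + (w - tau) * u))))%C
     = (Cexp (- (PI * Ci * (u ^ 2)%R * w)) * theta_term u v w n)%C).
  { intros n. unfold theta_term. set (m := half n).
    replace (PI * Ci * ((m ^ 2)%R * w + 2 * m * (z + (w - tau) * u)))%C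
      with (- (PI * Ci * (u ^ 2)%R * w) + (PI * Ci * ((m + u) ^ 2)%R * w + 2 * PI * Ci * m * v))%C.
    rewrite Cexp_plus. ring. rewrite Hz, !RtoC_pow, RtoC_plus. ring. }
  rewrite (ZSeries_ext _ _ E), (ZSeries_scal _ _ _ HK), Cmult_assoc.
  rewrite (Cmult_comm (Cexp (PI * Ci * (u ^ 2)%R * w))), Cexp_opp_l. unfold theta. ring.
Qed.

(** * Transfer of the primitive by the modular group *)

Section Transfer.
Variables (a b c d : Z) (tau mu : C) (u' v' : R).
Hypothesis Hc : (0 < c)%Z.
Hypothesis Hdet : (a * d - b * c = 1)%Z.
Hypothesis Htau : 0 < Im tau.
Hypothesis Hmu : theta_multiplier a b c d mu.

Let j : C := (IZR c * tau + IZR d)%C.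
Let tau' : C := ((IZR a * tau + IZR b) / j)%C.
Let u : R := IZR a * u' + IZR c * v'.
Let v : R := IZR b * u' + IZR d * v'.

Lemma det_C : (IZR a * IZR d - IZR b * IZR c = 1)%C.
Proof. rewrite <- !RtoC_mult, <- RtoC_minus, <- !mult_IZR, <- minus_IZR, Hdet. reflexivity. Qed.

Lemma lower_left_neq0 : RtoC (IZR c) <> 0.
Proof. apply RtoC_neq0. apply not_0_IZR. lia. Qed.

Lemma lower_left_pos : 0 < IZR c.
Proof. now apply IZR_lt. Qed.

Lemma j_upper : 0 < Im j.
Proof. unfold j. rewrite Im_affine. pose proof lower_left_pos. nra. Qed.

Lemma j_neq0 : j <> 0.
Proof. apply slit_neq0. right. pose proof j_upper. lra. Qed.

Lemma cusp_minus_tau' : (IZR a / IZR c - tau' = / (IZR c * j))%C.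
Proof.
  pose proof lower_left_neq0. pose proof j_neq0 as Hj. unfold tau'.
  transitivity ((IZR a * IZR d - IZR b * IZR c) / (IZR c * j))%C.
  unfold j in *. field. auto. rewrite det_C. unfold Cdiv. ring.
Qed.

Lemma Im_neg_inv_upper (D : C) : 0 < Im D -> 0 < Im (- / (IZR c * D)).
Proof.
  intros HD. apply Im_inv_upper. rewrite Im_mult, Re_RtoC, Im_RtoC. pose proof lower_left_pos. nra.
Qed.

(** The automorphy factor c s + d at the preimage s of w under the matrix; see [gamma_inv]. *)
Definition pcoord (w : C) : C := (- / (IZR c * (w - IZR a / IZR c)))%C.

Lemma w_shift_upper w : 0 < Im w -> 0 < Im (w - IZR a / IZR c).
Proof.
  intros H. rewrite <- RtoC_div by (pose proof lower_left_pos; lra). rewrite Im_minus, Im_RtoC. lra.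
Qed.

Lemma pcoord_upper w : 0 < Im w -> 0 < Im (pcoord w).
Proof. intros H. apply Im_neg_inv_upper. now apply w_shift_upper. Qed.

Lemma pcoord_lift y : 0 < Im (tau' - Ci * (y * y)) ->
  (1 + Ci * IZR c * j * (y * y))%C <> 0 /\
  pcoord (tau' - Ci * (y * y)) = (j / (1 + Ci * IZR c * j * (y * y)))%C.
Proof.
  intros H. pose proof lower_left_neq0 as H1. pose proof j_neq0 as H2.
  set (D := (tau' - Ci * (y * y) - IZR a / IZR c)%C).
  assert (HD : D <> 0) by (apply slit_neq0; right; pose proof (w_shift_upper _ H); unfold D; lra).
  assert (E : (1 + Ci * IZR c * j * (y * y) = - (IZR c * j * D))%C).
  { unfold D. replace (tau' - Ci * (y * y) - IZR a / IZR c)%C with (- (IZR a / IZR c - tau') - Ci * (y * y))%C by ring.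
    rewrite cusp_minus_tau'. field. auto. }
  split.
  - rewrite E. intros E0. apply (Cmult_neq_0 (IZR c * j) D). apply Cmult_neq_0; auto. auto.
    replace (IZR c * j * D)%C with (- - (IZR c * j * D))%C by ring. rewrite E0. ring.
  - unfold pcoord. fold D. rewrite E. field. auto.
Qed.

Lemma gamma_inv (w : C) : 0 < Im w ->
  let p := pcoord w in let s := ((p - IZR d) / IZR c)%C in
  0 < Im s /\ (IZR c * s + IZR d = p)%C /\ ((IZR a * s + IZR b) / p = w)%C.
Proof.
  intros Hw p s. pose proof lower_left_neq0 as H1. pose proof lower_left_pos as H2.
  pose proof (pcoord_upper w Hw) as Hp. fold p in Hp.
  assert (HD : (w - IZR a / IZR c)%C <> 0) by (apply slit_neq0; right; pose proof (w_shift_upper _ Hw); lra).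
  assert (Hp0 : p <> 0) by (apply slit_neq0; right; lra).
  assert (E1 : (IZR c * s + IZR d = p)%C) by (unfold s; field; auto).
  split; [|split; auto].
  - assert (E2 := f_equal Im E1). rewrite Im_affine in E2. nra.
  - transitivity (IZR a / IZR c - / (IZR c * p))%C.
    + transitivity ((IZR a * p - (IZR a * IZR d - IZR b * IZR c)) / (IZR c * p))%C.
      unfold s. field. auto. rewrite det_C. field. auto.
    + unfold p, pcoord. field. split; auto. intros E. apply HD.
      replace (w - IZR a / IZR c)%C with ((w * IZR c - IZR a) * / IZR c)%C by (field; auto).
      rewrite E. ring.
Qed.

(** The coordinate of the preimage s relative to tau. For w = tau' - i y^2 one has w - tau' = (s -
    tau) / (p j), so y sqrt j sqrt p is a square root of i (s - tau). Taking roots only of j and p,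
    both in the upper half-plane, keeps it differentiable where s - tau meets the cut. *)
Definition ycoord (y : C) : C := (y * Csqrt j * Csqrt (pcoord (tau' - Ci * (y * y))))%C.

Lemma ycoord_sqr y : 0 < Im (tau' - Ci * (y * y)) ->
  (tau - Ci * (ycoord y * ycoord y) = (pcoord (tau' - Ci * (y * y)) - IZR d) / IZR c)%C.
Proof.
  intros H. destruct (pcoord_lift y H) as [H0 E]. pose proof lower_left_neq0 as H1. pose proof j_neq0 as H2.
  pose proof (pcoord_upper _ H) as Hp.
  assert (Hp0 : pcoord (tau' - Ci * (y * y)) <> 0) by (apply slit_neq0; right; lra).
  unfold ycoord. set (p := pcoord (tau' - Ci * (y * y))) in *.
  replace (y * Csqrt j * Csqrt p * (y * Csqrt j * Csqrt p))%C with (y * y * (Csqrt j * Csqrt j) * (Csqrt p * Csqrt p))%C by ring.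
  rewrite !Csqrt_sqr by auto. rewrite E. unfold j in *. field. auto.
Qed.

(** Along the ray t y, which stays in the domain because Re ((t y)^2) = t^2 Re (y^2), the difference
    of the two sides has derivative 0: the factor p sqrt p of theta cancels against the derivative
    of [ycoord]. At t = 0 both sides vanish. *)
Lemma Hprim_transfer (y : C) : 0 < Im (tau' - Ci * (y * y)) -> 0 < Im tau' ->
  Hprim u' v' tau' y = (mu * Cexp (PI * Ci * (u * v - u' * v')%R) * Csqrt j * Hprim u v tau (ycoord y))%C.
Proof.
  intros Hy Ht'. set (K := (mu * Cexp (PI * Ci * (u * v - u' * v')%R) * Csqrt j)%C).
  pose proof lower_left_neq0 as Hc0. pose proof j_neq0 as Hj0. pose proof (Csqrt_neq0 j) as Hsj.
  pose proof (Csqrt_sqr j Hj0) as Esj.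
  set (D := fun t : R => (Hprim u' v' tau' (t * y) - K * Hprim u v tau (ycoord (t * y)))%C).
  assert (HD : D 1 = D 0).
  { apply Cderiv_zero_const. intros t Ht.
    assert (Hty : 0 < Im (tau' - Ci * (t * y * (t * y)))).
    { rewrite Im_lift in *. replace (Re (t * y * (t * y))) with (t ^ 2 * Re (y * y)) by (repeat progress reim; ring).
      assert (0 <= t ^ 2 <= 1) by nra. destruct (Rle_or_lt 0 (Re (y * y))); nra. }
    destruct (pcoord_lift _ Hty) as [Hn Ep]. pose proof (pcoord_upper _ Hty) as Hp.
    destruct (gamma_inv _ Hty) as [Hs [Ecs Eas]]. cbv zeta in Hs, Ecs, Eas.
    set (w := (tau' - Ci * (t * y * (t * y)))%C) in *. set (p := pcoord w) in *.
    set (s := ((p - IZR d) / IZR c)%C) in *.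
    assert (Hp0 : p <> 0) by (apply slit_neq0; right; lra). pose proof (Csqrt_neq0 p) as Hsp.
    pose proof (Csqrt_sqr p Hp0) as Esp.
    assert (D1 : Cderiv (fun t : R => t * y)%C t y).
    { eapply Cderiv_eq. apply Cderiv_mult. apply Cderiv_id. apply Cderiv_const. cbv beta. ring. }
    assert (D2 : Cderiv (fun t : R => Hprim u' v' tau' (t * y)) t (theta u' v' w * y)).
    { apply (holo_deriv_Hprim u' v' tau' (t * y)%C Ht') with (Y := fun t : R => (t * y)%C); auto.
      pose proof Hty as Q. unfold w in Q. rewrite Im_lift in Q. lra. }
    assert (D3 : Cderiv (fun t : R => pcoord (tau' - Ci * (t * y * (t * y)))) t (- (2 * Ci * IZR c * (t * y) * y) * (p * p))).
    { eapply Cderiv_eq. unfold pcoord. apply Cderiv_opp. apply Cderiv_inv.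
      apply Cderiv_scal. apply Cderiv_minus. apply Cderiv_minus. apply Cderiv_const. apply Cderiv_scal. apply Cderiv_mult; exact D1. apply Cderiv_const.
      - fold w. apply Cmult_neq_0; auto. apply slit_neq0. right. pose proof (w_shift_upper w Hty). lra.
      - cbv beta. fold w. unfold p, pcoord. assert ((w - IZR a / IZR c)%C <> 0). apply slit_neq0. right. pose proof (w_shift_upper w Hty). lra.
        assert (E : forall q x : C, q <> 0 -> (- (- x / (q * q)) = x * (/ q * / q))%C) by (intros; field; auto).
        rewrite E by (apply Cmult_neq_0; auto).
        replace (- / (IZR c * (w - IZR a / IZR c)) * - / (IZR c * (w - IZR a / IZR c)))%C
          with (/ (IZR c * (w - IZR a / IZR c)) * / (IZR c * (w - IZR a / IZR c)))%C by ring. ring. }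
    (* The product rule leaves 1 - i c (t y)^2 p as a factor, and this is p / j. *)
    assert (D4 : Cderiv (fun t : R => ycoord (t * y)) t (y * (p * Csqrt p) / Csqrt j)).
    { unfold ycoord. eapply Cderiv_eq. apply Cderiv_mult. apply Cderiv_mult. exact D1. apply Cderiv_const.
      assert (Hsl : slit p) by (right; lra).
      apply (holo_deriv_Csqrt p Hsl (fun t : R => pcoord (tau' - Ci * (t * y * (t * y))))); [reflexivity|exact D3].
      cbv beta. fold w. fold p.
      assert (E1 : (p / j = 1 - Ci * IZR c * (t * y * (t * y)) * p)%C).
      { rewrite Ep. field. auto. }
      transitivity (y * Csqrt j * Csqrt p * (1 - Ci * IZR c * (t * y * (t * y)) * p))%C.
      - replace (p * p)%C with (Csqrt p * Csqrt p * p)%C by (rewrite Esp; reflexivity). field. auto.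
      - rewrite <- E1. replace (p / j)%C with (p / (Csqrt j * Csqrt j))%C by (rewrite Esj; reflexivity).
        field. auto. }
    assert (D5 : Cderiv (fun t : R => Hprim u v tau (ycoord (t * y))) t (theta u v s * (y * (p * Csqrt p) / Csqrt j))).
    { pose proof (ycoord_sqr (t * y) Hty) as E. fold w p s in E. rewrite <- E.
      apply (holo_deriv_Hprim u v tau (ycoord (t * y)) Htau) with (Y := fun t : R => ycoord (t * y)); auto.
      rewrite <- E, Im_lift in Hs. lra. }
    eapply Cderiv_eq. apply Cderiv_minus. exact D2. apply Cderiv_scal. exact D5.
    pose proof (Hmu u' v' s Hs) as E. cbv zeta in E. rewrite Ecs, Eas in E. fold u v in E.
    rewrite E. unfold K. field. auto. }
  assert (H0 : D 0 = 0).
  { unfold D. replace (0 * y)%C with (RtoC 0) by ring. rewrite Hprim_0. unfold ycoord.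
    replace (0 * Csqrt j * Csqrt (pcoord (tau' - Ci * (0 * 0))))%C with (RtoC 0) by ring. rewrite Hprim_0. ring. }
  rewrite H0 in HD. unfold D in HD. replace (1 * y)%C with y in HD by ring.
  replace (Hprim u' v' tau' y) with (Hprim u' v' tau' y - K * Hprim u v tau (ycoord y) + K * Hprim u v tau (ycoord y))%C by ring.
  rewrite HD. ring.
Qed.
End Transfer.

(** * Continuity of theta along paths and gluing of local integrals *)

Lemma Ccont_eps (f : R -> C) t : (forall eps, 0 < eps -> locally t (fun s => Cmod (f s - f t) <= eps)) -> Ccont f t.
Proof.
  intros H. split; apply filterlim_locally; intros eps;
  (eapply filter_imp; [|apply (H (eps / 2)); pose proof (cond_pos eps); lra]);
  intros s Hs; pose proof (cond_pos eps); unfold ball; simpl; unfold AbsRing_ball, abs, minus, plus, opp; simpl.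
  - pose proof (Rabs_Re_le (f s - f t)) as E. rewrite Re_minus in E. unfold Rminus in E. lra.
  - pose proof (Rabs_Im_le (f s - f t)) as E. rewrite Im_minus in E. unfold Rminus in E. lra.
Qed.

Lemma Ccont_eps_inv (f : R -> C) t : Ccont f t -> forall eps, 0 < eps -> locally t (fun s => Cmod (f s - f t) <= eps).
Proof.
  intros [H1 H2] eps He. assert (He2 : 0 < eps / 2) by lra.
  apply (proj1 (filterlim_locally _ _)) with (eps := mkposreal _ He2) in H1.
  apply (proj1 (filterlim_locally _ _)) with (eps := mkposreal _ He2) in H2.
  eapply filter_imp. 2: apply (filter_and _ _ H1 H2). intros s [A B].
  unfold ball in A, B; simpl in A, B; unfold AbsRing_ball, abs, minus, plus, opp in A, B; simpl in A, B.
  apply Rle_trans with (1 := Cmod_le_ReIm _). rewrite Re_minus, Im_minus. unfold Rminus. lra.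
Qed.

Lemma Ccont_Cexp (f : R -> C) t : Ccont f t -> Ccont (fun s => Cexp (f s)) t.
Proof.
  intros [H1 H2].
  assert (E : forall x, continuous exp x) by (intros; rap (ex_derive_continuous _ _ _); auto_derive; auto).
  split; repeat progress reim.
  - apply (continuous_mult (fun s => exp (Re (f s))) (fun s => cos (Im (f s)))).
    apply (continuous_comp (fun s => Re (f s)) exp); auto.
    apply (continuous_comp (fun s => Im (f s)) cos); auto. apply continuous_cos.
  - apply (continuous_mult (fun s => exp (Re (f s))) (fun s => sin (Im (f s)))).
    apply (continuous_comp (fun s => Re (f s)) exp); auto.
    apply (continuous_comp (fun s => Im (f s)) sin); auto. apply continuous_sin.
Qed.

Lemma Ccont_theta u v (W : R -> C) t : Ccont W t -> 0 < Im (W t) -> Ccont (fun s => theta u v (W s)) t.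
Proof.
  intros HW Hi. pose proof PI_RGT_0 as Hpi. apply Ccont_eps. unfold theta.
  destruct (gaussian_dominated (Rabs (1 / 2 + u)) (PI * (Im (W t) / 2))) as [K [HK H]]. nra.
  assert (Hb : forall w, Im (W t) / 2 <= Im w -> Zbounded (theta_term u v w) K).
  { intros w Hw n. specialize (H (1 / 2 + u) n (Rle_refl _)). rewrite <- half_shift in H.
    rewrite Cmod_theta_term. apply Rle_trans with (2 := H). apply Rmult_le_compat. apply Rabs_pos. left; apply exp_pos.
    apply cube_dom, Rabs_pos. apply exp_le_mono. pose proof (pow2_ge_0 (half n + u)).
    assert (PI * (half n + u) ^ 2 * (Im (W t) / 2) <= PI * (half n + u) ^ 2 * Im w) by (apply Rmult_le_compat_l; nra). lra. }
  apply (ZSeries_tannery (locally t) (fun s => theta_term u v (W s)) (theta_term u v (W t)) K).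
  - eapply filter_imp. 2: apply (Ccont_eps_inv W t HW (Im (W t) / 2)); lra. intros s Hs. apply Hb.
    pose proof (Rabs_Im_le (W s - W t)) as E. rewrite Im_minus in E.
    pose proof (Rle_abs (- (Im (W s) - Im (W t)))) as E1. rewrite Rabs_Ropp in E1. lra.
  - apply Hb. lra.
  - intros n. apply Ccont_eps_inv. unfold theta_term. apply Ccont_mult. apply Ccont_const. apply Ccont_Cexp.
    apply Ccont_plus; [|apply Ccont_const]. apply Ccont_mult. apply Ccont_const. exact HW.
Qed.

Lemma Cderiv_of_is_derive (h : R -> C) t l :
  is_derive (K := R_AbsRing) (V := C_R_NormedModule) h t l -> Cderiv h t l.
Proof.
  intros H. split.
  - exact (filterdiff_comp' h (fun z : C_R_NormedModule => fst z) t (fun y => scal y l) (fun z => fst z) H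
      (filterdiff_linear _ is_linear_fst)).
  - exact (filterdiff_comp' h (fun z : C_R_NormedModule => snd z) t (fun y => scal y l) (fun z => snd z) H
      (filterdiff_linear _ is_linear_snd)).
Qed.

Lemma Ccont_of_continuous (h : R -> C) t : continuous (U := C_R_NormedModule) h t -> Ccont h t.
Proof.
  intros H. split.
  - apply (continuous_comp h (fun z : C_R_NormedModule => fst z)). exact H. apply continuous_fst.
  - apply (continuous_comp h (fun z : C_R_NormedModule => snd z)). exact H. apply continuous_snd.
Qed.

(** Only one-sided formulas near each point are assumed, since the path may have corners. Take the
    supremum of the x up to which the formula holds: the left formula reaches it and the right one
    passes it unless it is b. *)
Lemma is_CInt_local_global (f Phi : R -> C) :
  (forall t, 0 < t -> exists delta, 0 < delta /\
     (forall s, 0 < s -> t - delta < s <= t -> is_CInt f s t (Phi t - Phi s)) /\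
     (forall s, t <= s < t + delta -> is_CInt f t s (Phi s - Phi t))) ->
  forall a b, 0 < a -> a <= b -> is_CInt f a b (Phi b - Phi a).
Proof.
  intros H a b Ha Hab.
  set (E := fun x => a <= x <= b /\ is_CInt f a x (Phi x - Phi a)).
  assert (Ea : E a).
  { split. lra. destruct (H a Ha) as [dl [Hd [_ H2]]]. apply H2. lra. }
  destruct (completeness E) as [m [Hub Hlub]].
  { exists b. intros x [Hx _]. lra. }
  { exists a. exact Ea. }
  assert (Ham : a <= m) by (apply Hub; exact Ea).
  assert (Hmb : m <= b) by (apply Hlub; intros x [Hx _]; lra).
  destruct (H m ltac:(lra)) as [dl [Hd [H1 H2]]].
  assert (Hx : exists x, E x /\ m - dl < x <= m).
  { destruct (Classical_Prop.classic (exists x, E x /\ m - dl < x)) as [[x [Ex Hx]]|Hn].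
    - exists x. split; [exact Ex|]. split; [exact Hx | now apply Hub].
    - exfalso. assert (m <= m - dl); [|lra]. apply Hlub. intros x Ex.
      destruct (Rle_or_lt x (m - dl)); auto. exfalso. apply Hn. now exists x. }
  destruct Hx as [x [[Hx1 Hx2] Hx3]].
  assert (Em : E m).
  { split. lra. replace (Phi m - Phi a)%C with ((Phi x - Phi a) + (Phi m - Phi x))%C by ring.
    apply is_CInt_Chasles with x; auto. apply H1; lra. }
  destruct (Req_dec m b) as [<-|Hne]. apply Em.
  exfalso. set (s := Rmin b (m + dl / 2)).
  assert (Hs : m < s <= b /\ s < m + dl).
  { unfold s. pose proof (Rmin_l b (m + dl / 2)). pose proof (Rmin_r b (m + dl / 2)).
    split; [split|]; try lra. apply Rmin_glb_lt; lra. }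
  assert (Es : E s).
  { split. lra. replace (Phi s - Phi a)%C with ((Phi m - Phi a) + (Phi s - Phi m))%C by ring.
    apply is_CInt_Chasles with m. apply Em. apply H2; lra. }
  apply Hub in Es. lra.
Qed.

(** * Integration along the path *)

Lemma slit_off_cut (w tau : C) : ~ (Re w = Re tau /\ Im tau <= Im w) -> slit (Ci * (w - tau)).
Proof.
  intros H. unfold slit. repeat progress reim.
  destruct (Req_dec (Re w) (Re tau)) as [E|E].
  - left. destruct (Rlt_or_le (Im w) (Im tau)); [lra|]. exfalso. now apply H.
  - right. lra.
Qed.

Lemma lift_back (w tau : C) : (tau - Ci * (Ci * (w - tau)) = w)%C.
Proof. replace (tau - Ci * (Ci * (w - tau)))%C with (tau - (Ci * Ci) * (w - tau))%C by ring. rewrite Ci2. ring. Qed.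

Section PathPrimitive.
Variables (x : R) (tau : C) (g : R -> C) (u v : R).
Hypothesis Htau : 0 < Im tau.
Hypothesis Hg : eichler_path x tau g.

Definition ypath (t : R) : C := Csqrt (Ci * (g t - tau)).
Definition path_primitive (t : R) : C := (- (2 * Ci) * Hprim u v tau (ypath t))%C.
Definition path_integrand (t : R) : C := (theta u v (g t) / Csqrt (Ci * (g t - tau)) * path_derive g t)%C.

Lemma path_piece (h : R -> C) s t : C1_path h -> 0 < s -> s <= t -> (forall r, s <= r <= t -> g r = h r) ->
  is_CInt path_integrand s t (path_primitive t - path_primitive s).
Proof.
  intros [dh Hh] Hs Hst Hgh.
  assert (HD : forall r, Cderiv h r (dh r)) by (intros r; apply Cderiv_of_is_derive, Hh).
  assert (HCd : forall r, Ccont dh r) by (intros r; apply Ccont_of_continuous, Hh).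
  set (Y := fun r => Csqrt (Ci * (h r - tau))).
  assert (Hsl : forall r, s <= r <= t -> slit (Ci * (h r - tau)) /\ 0 < Im (h r)).
  { intros r Hr. rewrite <- (Hgh r Hr). split.
    - apply slit_off_cut. apply (eichler_path_cut _ _ _ Hg). lra.
    - apply (eichler_path_upper _ _ _ Hg). lra. }
  assert (HY : forall r, s <= r <= t -> Cderiv Y r (/ (2 * Y r) * (Ci * dh r))).
  { intros r Hr. destruct (Hsl r Hr) as [Hs1 _].
    apply (holo_deriv_Csqrt _ Hs1 (fun r => Ci * (h r - tau))%C). reflexivity.
    eapply Cderiv_eq. apply Cderiv_scal. apply Cderiv_minus. apply HD. apply Cderiv_const. ring. }
  assert (HI : is_CInt (fun r => theta u v (h r) / Y r * dh r)%C s t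
    (- (2 * Ci) * Hprim u v tau (Y t) - - (2 * Ci) * Hprim u v tau (Y s))%C).
  { apply (is_CInt_derive (fun r => - (2 * Ci) * Hprim u v tau (Y r))%C).
    - rewrite Rmin_left, Rmax_right by lra. intros r Hr. destruct (Hsl r Hr) as [Hs1 Hi].
      assert (EY : (Y r * Y r = Ci * (h r - tau))%C) by (apply Csqrt_sqr, slit_neq0, Hs1).
      assert (HYn : Y r <> 0) by apply Csqrt_neq0.
      eapply Cderiv_eq. apply Cderiv_scal.
      apply (holo_deriv_Hprim u v tau (Y r) Htau) with (Y := Y); [|reflexivity|apply HY; auto].
      + rewrite EY. repeat progress reim. lra.
      + rewrite EY, lift_back.
        transitivity (- (Ci * Ci) * (theta u v (h r) / Y r * dh r))%C. field. auto. rewrite Ci2. ring.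
    - rewrite Rmin_left, Rmax_right by lra. intros r Hr. destruct (Hsl r Hr) as [Hs1 Hi].
      apply Ccont_mult; auto. apply Ccont_mult. apply Ccont_theta; auto. eapply Cderiv_cC, HD.
      eapply Cderiv_cC. apply Cderiv_inv. apply HY; auto. apply Csqrt_neq0. }
  unfold path_primitive, ypath. rewrite (Hgh t), (Hgh s) by lra.
  (* Equality is needed on the open interval only: at its ends g may have a corner, where
     [path_derive] need not agree with the derivative of the piece h. *)
  eapply is_CInt_ext. 2: exact HI.
  rewrite Rmin_left, Rmax_right by lra. intros r Hr. unfold path_integrand, Y.
  rewrite (Hgh r) by lra. f_equal.
  assert (Hloc : locally r (fun q => h q = g q)).
  { assert (Hp : 0 < Rmin (r - s) (t - r)) by (apply Rmin_glb_lt; lra).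
    exists (mkposreal _ Hp). intros q Hq. symmetry. apply Hgh.
    unfold ball in Hq; simpl in Hq; unfold AbsRing_ball, abs, minus, plus, opp in Hq; simpl in Hq.
    apply Rabs_lt_between in Hq. pose proof (Rmin_l (r - s) (t - r)). pose proof (Rmin_r (r - s) (t - r)). lra. }
  destruct (Cderiv_ext_loc _ _ _ _ Hloc (HD r)) as [D1 D2].
  unfold path_derive. apply C_ext; simpl; symmetry; apply is_derive_unique; assumption.
Qed.

Lemma path_FTC a b : 0 < a -> a <= b -> is_CInt path_integrand a b (path_primitive b - path_primitive a).
Proof.
  apply is_CInt_local_global. intros t Ht.
  destruct (eichler_path_C1 _ _ _ Hg t Ht) as [dl [hl [hr [Hd [Cl [Cr [El Er]]]]]]].
  exists dl. split; auto. split.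
  - intros s Hs Hst. apply path_piece with hl; auto. lra. intros r Hr. apply El. lra.
  - intros s Hs. apply path_piece with hr; auto. lra. intros r Hr. apply Er. lra.
Qed.

Lemma path_integral_limits (f : C -> C) (l1 l2 : C) :
  (forall w, 0 < Im w -> f w = (theta u v w / Csqrt (Ci * (w - tau)))%C) ->
  (forall eps, 0 < eps -> at_right 0 (fun t => Cmod (path_primitive t - l1) <= eps)) ->
  (forall eps, 0 < eps -> Rbar_locally p_infty (fun t => Cmod (path_primitive t - l2) <= eps)) ->
  path_integral f g = (l2 - l1)%C.
Proof.
  intros Hf H1 H2. unfold path_integral.
  refine (is_RInt_gen_unique (V := C_R_CompleteNormedModule) _ _ _).
  intros P [eps HP].
  assert (He : 0 < eps / 3) by (pose proof (cond_pos eps); lra).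
  exists (fun a => 0 < a < 1 /\ Cmod (path_primitive a - l1) <= eps / 3)
         (fun b => 1 < b /\ Cmod (path_primitive b - l2) <= eps / 3).
  - apply filter_and; [|now apply H1].
    exists (mkposreal 1 Rlt_0_1). intros r Hr Hr0.
    unfold ball in Hr; simpl in Hr; unfold AbsRing_ball, abs, minus, plus, opp in Hr; simpl in Hr.
    apply Rabs_lt_between in Hr. lra.
  - apply filter_and; [|now apply H2]. exists 1. auto.
  - intros a b [[Ha1 Ha2] Ha3] [Hb1 Hb2]. simpl fst; simpl snd.
    exists (path_primitive b - path_primitive a)%C. split.
    + assert (HI : is_CInt (fun t => f (g t) * path_derive g t)%C a b (path_primitive b - path_primitive a)%C).
      { eapply is_CInt_ext. 2: apply path_FTC; lra. rewrite Rmin_left, Rmax_right by lra. intros r Hr.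
        unfold path_integrand. rewrite Hf. reflexivity. apply (eichler_path_upper _ _ _ Hg). lra. }
      destruct HI as [I1 I2].
      exact (is_RInt_fct_extend_pair (U := R_NormedModule) (V := R_NormedModule) _ a b _ _ I1 I2).
    + apply HP.
      assert (Hm : Cmod ((path_primitive b - path_primitive a) - (l2 - l1)) < eps).
      { replace ((path_primitive b - path_primitive a) - (l2 - l1))%C
          with ((path_primitive b - l2) - (path_primitive a - l1))%C by ring.
        apply Rle_lt_trans with (1 := Cmod_triangle_minus _ _). lra. }
      split.
      * apply Rle_lt_trans with (2 := Hm). apply (Rabs_Re_le (path_primitive b - path_primitive a - (l2 - l1))%C).
      * apply Rle_lt_trans with (2 := Hm). apply (Rabs_Im_le (path_primitive b - path_primitive a - (l2 - l1))%C).
Qed.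

Lemma path_primitive_of_Hprim {T : Type} (F : (T -> Prop) -> Prop) {FF : Filter F} (t : T -> R) (l : C) :
  (forall eps, 0 < eps -> F (fun r => Cmod (Hprim u v tau (ypath (t r)) - l) <= eps)) ->
  forall eps, 0 < eps -> F (fun r => Cmod (path_primitive (t r) - - (2 * Ci) * l) <= eps).
Proof.
  intros H eps He. eapply filter_imp. 2: apply (H (eps / 2)); lra. intros r Hr. unfold path_primitive.
  replace (- (2 * Ci) * Hprim u v tau (ypath (t r)) - - (2 * Ci) * l)%C
    with (- (2 * Ci) * (Hprim u v tau (ypath (t r)) - l))%C by ring.
  rewrite Cmod_mult, Cmod_opp, Cmod_mult, Cmod_R, Cmod_Ci, Rabs_pos_eq by lra. lra.
Qed.

Lemma limit_at_top : forall eps, 0 < eps ->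
  Rbar_locally p_infty (fun t => Cmod (path_primitive t - Slim u v tau) <= eps).
Proof.
  intros eps He.
  replace (Slim u v tau) with (- (2 * Ci) * (Ci / 2 * Slim u v tau))%C.
  2: { transitivity (- (Ci * Ci) * Slim u v tau)%C. field. rewrite Ci2. ring. }
  revert eps He. apply (path_primitive_of_Hprim (Rbar_locally p_infty) (fun t => t)).
  destruct (eichler_path_vertical _ _ _ Hg) as [e [He0 Hv]].
  pose proof (eichler_path_end _ _ _ Hg) as Hend.
  assert (Hbig : forall M, Rbar_locally p_infty (fun t => M < Im (g t))).
  { intros M. apply Hend. exists M. auto. }
  assert (Hpos : Rbar_locally p_infty (fun t => 0 < t)) by (exists 0; auto).
  apply (Hprim_limit (Rbar_locally p_infty) ypath (1 / 2)); auto. lra.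
  (* On the vertical part W = -T + i e with T = Im w - Im tau. As e > 0 its root has positive
     imaginary part, and T > e gives |W| <= 2 T, which is the sector constant 1/2. *)
  - eapply filter_imp. 2: apply (filter_and _ _ Hpos (filter_and _ _ Hv (Hbig (Im tau + e)))).
    intros t [Ht [Hre Him]].
    set (W := (Ci * (g t - tau))%C).
    assert (Hsl : slit W) by (apply slit_off_cut, (eichler_path_cut _ _ _ Hg); auto).
    assert (ERe : Re W = - (Im (g t) - Im tau)) by (unfold W; repeat progress reim; ring).
    assert (EIm : Im W = e) by (unfold W; repeat progress reim; lra).
    assert (EY : (ypath t * ypath t = W)%C) by (apply Csqrt_sqr, slit_neq0, Hsl).
    pose proof (Csqrt_Re_pos W Hsl) as HR.
    split.
    + pose proof (f_equal Im EY) as E. rewrite Im_mult, EIm in E. unfold ypath in *. fold W in E |- *. nra.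
    + rewrite EY, ERe. replace (Cmod (ypath t) ^ 2) with (Cmod W) by (rewrite <- EY, Cmod_mult; ring).
      pose proof (Cmod_le_ReIm W) as HW. rewrite ERe, EIm, Rabs_Ropp, !Rabs_pos_eq in HW by lra. lra.
  - intros M. eapply filter_imp. 2: apply (filter_and _ _ Hpos (Hbig (Im tau + M ^ 2))).
    intros t [Ht Him]. set (W := (Ci * (g t - tau))%C).
    assert (Hsl : slit W) by (apply slit_off_cut, (eichler_path_cut _ _ _ Hg); auto).
    assert (EY : (ypath t * ypath t = W)%C) by (apply Csqrt_sqr, slit_neq0, Hsl).
    assert (HW : M ^ 2 <= Cmod (ypath t) ^ 2).
    { replace (Cmod (ypath t) ^ 2) with (Cmod W) by (rewrite <- EY, Cmod_mult; ring).
      apply Rle_trans with (2 := Rabs_Re_le W).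
      replace (Re W) with (- (Im (g t) - Im tau)) by (unfold W; repeat progress reim; ring).
      rewrite Rabs_Ropp. apply Rle_trans with (2 := Rle_abs _). lra. }
    pose proof (Cmod_ge_0 (ypath t)). destruct (Rle_or_lt M (Cmod (ypath t))); auto. nra.
Qed.
End PathPrimitive.

(** * Behaviour of the transformed coordinate at the cusp *)

Lemma locally_Cmod (f : R -> C) (F : (R -> Prop) -> Prop) {FF : Filter F} (l : C) :
  filterlim f F (locally l) -> forall eps, 0 < eps -> F (fun t => Cmod (f t - l) <= eps).
Proof.
  intros H eps He. assert (He2 : 0 < eps / 2) by lra.
  pose proof (proj1 (filterlim_locally f l) H (mkposreal _ He2)) as H1.
  eapply filter_imp. 2: exact H1. intros t [A B].
  unfold ball in A, B; simpl in A, B; unfold AbsRing_ball, abs, minus, plus, opp in A, B; simpl in A, B.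
  apply Rle_trans with (1 := Cmod_le_ReIm _). rewrite Re_minus, Im_minus. unfold Re, Im, Rminus in *. lra.
Qed.

Section Cusp.
Variables (a b c d : Z) (tau mu : C) (u' v' : R) (g : R -> C).
Hypothesis Hc : (0 < c)%Z.
Hypothesis Hdet : (a * d - b * c = 1)%Z.
Hypothesis Htau : 0 < Im tau.
Hypothesis Hmu : theta_multiplier a b c d mu.
Let j : C := (IZR c * tau + IZR d)%C.
Let tau' : C := ((IZR a * tau + IZR b) / j)%C.
Let u : R := IZR a * u' + IZR c * v'.
Let v : R := IZR b * u' + IZR d * v'.
Hypothesis Htau' : 0 < Im tau'.
Hypothesis Hg : eichler_path (IZR a / IZR c) tau' g.

(** The factor p = -1 / (c (w - a/c)) tends to infinity, and the Stolz condition becomes |p| <= K1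
    Im p. Up to bounded terms [ycoord]^2 is i p / c, so its real part is negative and comparable to
    its modulus. That determines the sector up to sign only. The sign comes from the limit of
    [ypath] times sqrt j, which is sqrt (i/c) in the open first quadrant: sqrt p lies there as well,
    so their product has positive imaginary part. *)
Lemma cusp_sector : exists kap, 0 < kap /\
  at_right 0 (fun t => sector kap (ycoord a b c d tau (ypath tau' g t))) /\
  (forall M, at_right 0 (fun t => M <= Cmod (ycoord a b c d tau (ypath tau' g t)))).
Proof.
  pose proof (lower_left_pos c Hc) as Hcr. pose proof (lower_left_neq0 c Hc) as Hc0.
  pose proof (j_upper c d tau Hc Htau) as Hj. pose proof (j_neq0 c d tau Hc Htau) as Hj0. fold j in Hj, Hj0.
  assert (EX : RtoC (IZR a / IZR c) = (IZR a / IZR c)%C) by (apply RtoC_div; lra).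
  assert (Ht : at_right 0 (fun t => 0 < t)) by (exists (mkposreal 1 Rlt_0_1); auto).
  destruct (eichler_path_stolz _ _ _ Hg) as [K HK].
  pose proof (locally_Cmod g (at_right 0) _ (eichler_path_start _ _ _ Hg)) as H0. rewrite EX in H0.
  assert (Hup : at_right 0 (fun t => 0 < Im (g t))).
  { eapply filter_imp. 2: exact Ht. intros t Htt. apply (eichler_path_upper _ _ _ Hg); auto. }
  (* |w - a/c| <= |Re (w - a/c)| + Im w <= (K + 1) Im w; the maximum with 0 ensures K1 >= 1. *)
  set (K1 := Rmax K 0 + 1).
  assert (HK1 : 1 <= K1) by (unfold K1; pose proof (Rmax_r K 0); lra).
  set (p := fun t => pcoord a c (g t)).
  assert (Hp : at_right 0 (fun t => 0 < Im (p t) /\ Cmod (p t) <= K1 * Im (p t) /\ Cmod (p t) * (IZR c * Cmod (g t - IZR a / IZR c)) = 1)).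
  { eapply filter_imp. 2: apply (filter_and _ _ HK Hup). intros t [Hst Hi].
    set (D := (g t - IZR a / IZR c)%C).
    assert (HDi : Im D = Im (g t)) by (unfold D; rewrite <- EX, Im_minus, Im_RtoC; ring).
    assert (HDr : Re D = Re (g t) - IZR a / IZR c) by (unfold D; rewrite <- EX, Re_minus, Re_RtoC; ring).
    assert (HD0 : D <> 0) by (apply slit_neq0; right; lra).
    assert (HDm : 0 < Cmod D) by (now apply Cmod_gt_0).
    assert (Ep : p t = (- / (IZR c * D))%C) by reflexivity.
    assert (Em : Cmod (p t) * (IZR c * Cmod D) = 1).
    { rewrite Ep, Cmod_opp, Cmod_inv, Cmod_mult, Cmod_R, Rabs_pos_eq by (try apply Cmult_neq_0; auto; lra). field. split; lra. }
    assert (Ei : Im (p t) * (IZR c * Cmod D ^ 2) = Im D).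
    { rewrite Ep. replace (- / (IZR c * D))%C with (- ((/ IZR c)%R * / D))%C by (rewrite RtoC_inv by lra; field; auto).
      rewrite Im_opp, Im_mult, Re_RtoC, Im_RtoC, Cmod_sqr. unfold Cinv. rewrite Re_pair, Im_pair.
      pose proof (Cmod_neq0_sqr D HD0). unfold Re, Im in *. field. split; auto. lra. }
    assert (HDK : Cmod D <= K1 * Im D).
    { apply Rle_trans with (1 := Cmod_le_ReIm D). rewrite HDr, HDi, (Rabs_pos_eq (Im (g t))) by lra.
      unfold K1. pose proof (Rmax_l K 0). nra. }
    split; [now apply pcoord_upper|]. split; auto.
    assert (Hq : 0 < IZR c * Cmod D ^ 2) by (apply Rmult_lt_0_compat; [lra|apply pow_lt; lra]).
    apply Rmult_le_reg_r with (IZR c * Cmod D ^ 2); auto.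
    replace (Cmod (p t) * (IZR c * Cmod D ^ 2)) with (Cmod (p t) * (IZR c * Cmod D) * Cmod D) by ring. rewrite Em.
    replace (K1 * Im (p t) * (IZR c * Cmod D ^ 2)) with (K1 * (Im (p t) * (IZR c * Cmod D ^ 2))) by ring. rewrite Ei. lra. }
  assert (Hpbig : forall M, at_right 0 (fun t => M <= Cmod (p t))).
  { intros M. set (M1 := Rabs M + 1). pose proof (Rabs_pos M). pose proof (Rle_abs M).
    assert (HM1 : 0 < M1) by (unfold M1; lra).
    eapply filter_imp. 2: apply (filter_and _ _ Hp (H0 (/ (IZR c * M1)) ltac:(apply Rinv_0_lt_compat; nra))).
    intros t [[P1 [P2 P3]] Hd]. set (D := Cmod (g t - IZR a / IZR c)) in *.
    pose proof (Cmod_ge_0 (p t)) as Hp0.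
    apply Rle_trans with M1; [unfold M1; lra|].
    assert (IZR c * D <= / M1).
    { apply Rle_trans with (IZR c * / (IZR c * M1)). apply Rmult_le_compat_l; lra. right; field; lra. }
    assert (1 <= Cmod (p t) * / M1) by (rewrite <- P3; apply Rmult_le_compat_l; auto).
    apply Rmult_le_reg_r with (/ M1). now apply Rinv_0_lt_compat. rewrite Rinv_r; lra. }
  assert (Hsq : at_right 0 (fun t => (tau - Ci * (ycoord a b c d tau (ypath tau' g t) * ycoord a b c d tau (ypath tau' g t))
      = (p t - IZR d) / IZR c)%C /\ ycoord a b c d tau (ypath tau' g t) = (ypath tau' g t * Csqrt j * Csqrt (p t))%C)).
  { eapply filter_imp. 2: apply (filter_and _ _ Ht Hup). intros t [Htt Hi].
    assert (Hsl : slit (Ci * (g t - tau'))) by (apply slit_off_cut, (eichler_path_cut _ _ _ Hg); auto).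
    assert (EY : (ypath tau' g t * ypath tau' g t = Ci * (g t - tau'))%C) by (apply Csqrt_sqr, slit_neq0, Hsl).
    assert (Ew : (tau' - Ci * (ypath tau' g t * ypath tau' g t) = g t)%C) by (rewrite EY; apply lift_back).
    assert (Hi2 : 0 < Im (tau' - Ci * (ypath tau' g t * ypath tau' g t))) by (rewrite Ew; auto).
    split.
    - pose proof (ycoord_sqr a b c d tau Hc Hdet Htau (ypath tau' g t) Hi2) as E. fold j in E. fold tau' in E.
      rewrite Ew in E. exact E.
    - unfold ycoord. fold j. fold tau'. rewrite Ew. reflexivity. }
  set (Y0 := Csqrt (Ci / (IZR c * j))).
  assert (HQ0 : slit (Ci / (IZR c * j))).
  { left. replace (Ci / (IZR c * j))%C with (- (Ci * - / (IZR c * j)))%C by (unfold Cdiv; ring).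
    pose proof (Im_neg_inv_upper c Hc j Hj) as E. repeat progress reim. rewrite Im_opp in E. lra. }
  assert (EQ0 : (Ci * (IZR a / IZR c - tau') = Ci / (IZR c * j))%C).
  { pose proof (cusp_minus_tau' a b c d tau Hc Hdet Htau) as E. fold j in E. fold tau' in E. rewrite E. reflexivity. }
  assert (HY0 : 0 < Re (Y0 * Csqrt j) /\ 0 < Im (Y0 * Csqrt j)).
  { unfold Y0. rewrite (Csqrt_quarter_turn (IZR c) j Hcr Hj). apply Csqrt_upper.
    replace (Ci / IZR c)%C with (Ci * (/ IZR c)%R)%C by (rewrite RtoC_inv by lra; reflexivity).
    repeat progress reim. pose proof (Rinv_0_lt_compat _ Hcr). lra. }
  pose proof (Csqrt_Re_pos _ HQ0) as HY0r. fold Y0 in HY0r.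
  assert (HYl : forall eps, 0 < eps -> at_right 0 (fun t => Cmod (ypath tau' g t - Y0) <= eps)).
  { intros eps He. eapply filter_imp. 2: apply (filter_and _ _ Ht (H0 (eps * Re Y0) ltac:(nra))).
    intros t [Htt Hd].
    assert (Hsl : slit (Ci * (g t - tau'))) by (apply slit_off_cut, (eichler_path_cut _ _ _ Hg); auto).
    set (k := (Ci * (g t - IZR a / IZR c))%C).
    assert (Ek : (Ci * (g t - tau') = Ci / (IZR c * j) + k)%C) by (rewrite <- EQ0; unfold k; ring).
    pose proof (Csqrt_lipschitz _ k HQ0 ltac:(rewrite <- Ek; now apply slit_neq0)) as HL.
    rewrite <- Ek in HL. fold Y0 in HL.
    assert (Hk : Cmod k <= eps * Re Y0) by (unfold k; rewrite Cmod_mult, Cmod_Ci, Rmult_1_l; auto).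
    apply Rmult_le_reg_r with (Re Y0); auto. unfold ypath. lra. }
  assert (Hdir : at_right 0 (fun t => 0 < Re (ypath tau' g t * Csqrt j) /\ 0 < Im (ypath tau' g t * Csqrt j))).
  { destruct HY0 as [R1 R2]. set (r := Rmin (Re (Y0 * Csqrt j)) (Im (Y0 * Csqrt j))).
    assert (Hr : 0 < r) by (apply Rmin_glb_lt; auto). pose proof (Cmod_ge_0 (Csqrt j)) as Hsj.
    eapply filter_imp. 2: apply (HYl (r / 2 / (Cmod (Csqrt j) + 1))); apply Rdiv_lt_0_compat; lra.
    intros t Hd. cbv beta in Hd. set (Y := ypath tau' g t) in *.
    assert (Hm : Cmod (Y * Csqrt j - Y0 * Csqrt j) <= r / 2).
    { replace (Y * Csqrt j - Y0 * Csqrt j)%C with ((Y - Y0) * Csqrt j)%C by ring. rewrite Cmod_mult.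
      apply Rle_trans with (r / 2 / (Cmod (Csqrt j) + 1) * (Cmod (Csqrt j) + 1)).
      apply Rmult_le_compat; try apply Cmod_ge_0; lra. right; field; lra. }
    pose proof (Rabs_Re_le (Y * Csqrt j - Y0 * Csqrt j)) as A1. pose proof (Rabs_Im_le (Y * Csqrt j - Y0 * Csqrt j)) as A2.
    rewrite Re_minus in A1. rewrite Im_minus in A2.
    assert (r <= Re (Y0 * Csqrt j)) by apply Rmin_l. assert (r <= Im (Y0 * Csqrt j)) by apply Rmin_r.
    pose proof (Rle_trans _ _ _ A1 Hm) as B1.
    pose proof (Rle_trans _ _ _ A2 Hm) as B2.
    apply Rabs_le_between in B1. apply Rabs_le_between in B2. lra. }
  set (B := Rabs (IZR d) / IZR c + Cmod tau).
  assert (HB : 0 <= B) by (unfold B; pose proof (Cmod_ge_0 tau); pose proof (Rdiv_le_0_compat _ _ (Rabs_pos (IZR d)) Hcr); lra).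
  assert (Hgeo : forall M, at_right 0 (fun t =>
     let y := ycoord a b c d tau (ypath tau' g t) in
     Re (y * y) <= - (/ (2 * K1)) * Cmod y ^ 2 /\ M <= - Re (y * y))).
  { intros M. set (X0 := IZR c * (2 * K1 * (Im tau + B + Rabs M + 1))).
    eapply filter_imp. 2: apply (filter_and _ _ Hp (filter_and _ _ (Hpbig X0) Hsq)).
    intros t [[P1 [P2 P3]] [P4 [P5 P6]]]. cbv zeta. set (y := ycoord a b c d tau (ypath tau' g t)) in *.
    set (X := Cmod (p t) / IZR c).
    assert (HX : 2 * K1 * (Im tau + B + Rabs M + 1) <= X).
    { unfold X. apply Rmult_le_reg_r with (IZR c); auto.
      replace (Cmod (p t) / IZR c * IZR c) with (Cmod (p t)) by (field; lra). unfold X0 in P4. lra. }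
    assert (HXi : X <= K1 * (Im (p t) / IZR c)).
    { unfold X, Rdiv. rewrite <- Rmult_assoc. apply Rmult_le_compat_r; auto. left; now apply Rinv_0_lt_compat. }
    assert (Eyy : (y * y = Ci * ((p t - IZR d) / IZR c - tau))%C).
    { rewrite <- P5. replace (Ci * (tau - Ci * (y * y) - tau))%C with (- (Ci * Ci) * (y * y))%C by ring. rewrite Ci2. ring. }
    assert (ERe : Re (y * y) = - (Im (p t) / IZR c - Im tau)).
    { rewrite Eyy. replace ((p t - IZR d) / IZR c)%C with ((/ IZR c)%R * (p t - IZR d))%C by (rewrite RtoC_inv by lra; field; auto).
      repeat progress reim. unfold Rdiv. ring. }
    assert (EMod : Cmod y ^ 2 <= X + B).
    { replace (Cmod y ^ 2) with (Cmod (y * y)) by (rewrite Cmod_mult; ring). rewrite Eyy, Cmod_mult, Cmod_Ci, Rmult_1_l.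
      apply Rle_trans with (1 := Cmod_triangle_minus _ _). unfold B. rewrite <- Rplus_assoc. apply Rplus_le_compat_r.
      unfold Cdiv. rewrite Cmod_mult, Cmod_inv, Cmod_R, (Rabs_pos_eq (IZR c)) by (auto; lra).
      unfold X, Rdiv. rewrite <- Rmult_plus_distr_r. apply Rmult_le_compat_r. left; now apply Rinv_0_lt_compat.
      apply Rle_trans with (1 := Cmod_triangle_minus _ _). rewrite Cmod_R. lra. }
    set (I := Im (p t) / IZR c) in *. rewrite ERe.
    assert (HK0 : 0 < / (2 * K1)) by (apply Rinv_0_lt_compat; lra).
    assert (HI : 2 * (Im tau + B + Rabs M + 1) <= I).
    { apply Rmult_le_reg_l with K1. lra. lra. }
    pose proof (Rabs_pos M). pose proof (Rle_abs M).
    split; [|lra].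
    assert (/ (2 * K1) * Cmod y ^ 2 <= I - Im tau); [|lra].
    apply Rle_trans with (/ (2 * K1) * (K1 * I + K1 * B)).
    + apply Rmult_le_compat_l. lra. nra.
    + replace (/ (2 * K1) * (K1 * I + K1 * B)) with ((I + B) / 2) by (field; lra). lra. }
  exists (/ (2 * K1)). split; [apply Rinv_0_lt_compat; lra|]. split.
  - eapply filter_imp. 2: apply (filter_and _ _ (Hgeo 0) (filter_and _ _ Hsq (filter_and _ _ Hdir Hp))).
    intros t [[G1 _] [[_ S2] [[D1 D2] [P1 _]]]]. split; auto. rewrite S2.
    destruct (Csqrt_upper _ P1) as [Q1 Q2]. rewrite Im_mult.
    pose proof (Rmult_lt_0_compat _ _ D1 Q2). pose proof (Rmult_lt_0_compat _ _ D2 Q1). lra.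
  - intros M. eapply filter_imp. 2: apply (Hgeo (M ^ 2)). intros t [_ G]. cbv zeta in G.
    set (y := ycoord a b c d tau (ypath tau' g t)) in *.
    assert (M ^ 2 <= Cmod y ^ 2).
    { apply Rle_trans with (1 := G). replace (Cmod y ^ 2) with (Cmod (y * y)) by (rewrite Cmod_mult; ring).
      apply Rle_trans with (2 := Rabs_Re_le _). rewrite <- Rabs_Ropp. apply Rle_abs. }
    pose proof (Cmod_ge_0 y). destruct (Rle_or_lt M (Cmod y)); auto. nra.
Qed.

Lemma limit_at_cusp : forall eps, 0 < eps ->
  at_right 0 (fun t => Cmod (path_primitive tau' g u' v' t
    - mu * Cexp (PI * Ci * (u * v - u' * v')%R) * Csqrt j * Slim u v tau) <= eps).
Proof.
  intros eps He. set (K := (mu * Cexp (PI * Ci * (u * v - u' * v')%R) * Csqrt j)%C).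
  replace (K * Slim u v tau)%C with (- (2 * Ci) * (K * (Ci / 2 * Slim u v tau)))%C.
  2: { transitivity (- (Ci * Ci) * (K * Slim u v tau))%C. field. rewrite Ci2. ring. }
  revert eps He. apply (path_primitive_of_Hprim tau' g u' v' (at_right 0) (fun t => t)).
  intros eps He. destruct cusp_sector as [kap [Hk [H1 H2]]].
  pose proof (Cmod_ge_0 K) as HK.
  assert (Ht : at_right 0 (fun t => 0 < t)) by (exists (mkposreal 1 Rlt_0_1); auto).
  pose proof (Hprim_limit (at_right 0) _ kap u v tau Htau Hk H1 H2 (eps / (Cmod K + 1)) ltac:(apply Rdiv_lt_0_compat; lra)) as H3.
  eapply filter_imp. 2: apply (filter_and _ _ Ht H3). intros t [Htt Hd].
  assert (Hsl : slit (Ci * (g t - tau'))) by (apply slit_off_cut, (eichler_path_cut _ _ _ Hg); auto).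
  assert (EY : (ypath tau' g t * ypath tau' g t = Ci * (g t - tau'))%C) by (apply Csqrt_sqr, slit_neq0, Hsl).
  assert (Hi2 : 0 < Im (tau' - Ci * (ypath tau' g t * ypath tau' g t))).
  { rewrite EY, lift_back. apply (eichler_path_upper _ _ _ Hg); auto. }
  pose proof (Hprim_transfer a b c d tau mu u' v' Hc Hdet Htau Hmu (ypath tau' g t) Hi2 Htau') as E.
  fold j tau' u v K in E. change ((IZR a * tau + IZR b) / j)%C with tau' in E. rewrite E.
  match goal with |- Cmod (K * ?x - K * ?y) <= _ => replace (K * x - K * y)%C with (K * (x - y))%C by ring end.
  rewrite Cmod_mult. apply Rle_trans with ((Cmod K + 1) * (eps / (Cmod K + 1))).
  apply Rmult_le_compat; try apply Cmod_ge_0; lra. right; field; lra.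
Qed.
End Cusp.

(** * Assembly of the transformation law *)

Lemma Im_gamma (a b c d : Z) (tau : C) : (0 < c)%Z -> (a * d - b * c = 1)%Z -> 0 < Im tau ->
  0 < Im ((IZR a * tau + IZR b) / (IZR c * tau + IZR d)).
Proof.
  intros Hc Hdet Htau. set (j := (IZR c * tau + IZR d)%C).
  assert (Hj : j <> 0) by now apply affine_neq0.
  pose proof (cusp_minus_tau' a b c d tau Hc Hdet Htau) as E. cbv zeta in E. fold j in E.
  assert (Hjp : 0 < Im j) by (unfold j; rewrite Im_affine; apply IZR_lt in Hc; nra).
  assert (Ht : ((IZR a * tau + IZR b) / j = IZR a / IZR c + - / (IZR c * j))%C) by (rewrite <- E; ring).
  rewrite Ht, <- RtoC_div by (apply not_0_IZR; lia). rewrite Im_plus, Im_RtoC, Rplus_0_l.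
  now apply Im_neg_inv_upper.
Qed.

Theorem theorem1p2 (z tau : C) (a b c d : Z)
  (htau : 0 < Im tau)
  (hdet : (a * d - b * c = 1)%Z)
  (hc : (0 < c)%Z) :
  let j := (IZR c * tau + IZR d)%C in
  let z' := (z / j)%C in
  let tau' := ((IZR a * tau + IZR b) / j)%C in
  forall g : R -> C, eichler_path (IZR a / IZR c) tau' g ->
  psi z tau =
    (/ chi a b c d ^ 3 * Cpower j (- (1 / 2)) * Cexp (- (PI * Ci * IZR c * z ^ 2 / j))
     * (psi z' tau'
        - Ci * Cexp (PI * Ci / (IZR c * j) * ((Im z' / Im tau') ^ 2)%R)
          * eichler g a c z' tau'))%C.
Proof.
  intros j z' tau' g Hg.
  destruct (multiplier_chi a b c d hc hdet) as [Hmu Hchi]. set (mu := (chi a b c d ^ 3)%C) in *.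
  assert (Hmu0 : mu <> 0) by (apply Cpow_nz; exact Hchi).
  assert (Htau' : 0 < Im tau') by now apply Im_gamma.
  assert (Hj0 : j <> 0) by now apply affine_neq0.
  pose proof (lower_left_neq0 c hc) as Hc0. pose proof (Csqrt_neq0 j) as Hsj.
  (* Real coordinates of z' in the basis (tau', 1); the u and v below are those of z in the basis
     (tau, 1), so the elliptic variable enters only through the row action of the matrix. *)
  set (u' := Im z' / Im tau'). set (v' := Re z' - u' * Re tau').
  assert (Hz' : z' = (u' * tau' + v')%C).
  { apply C_ext; repeat progress reim; unfold v', u'; field; lra. }
  set (u := IZR a * u' + IZR c * v'). set (v := IZR b * u' + IZR d * v').
  assert (Ez : z = (z' * j)%C) by (unfold z'; field; auto).
  assert (Hz : z = (u * tau + v)%C).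
  { rewrite Ez, Hz'. unfold tau', u, v. rewrite !RtoC_plus, !RtoC_mult.
    transitivity (u' * (IZR a * tau + IZR b) + v' * j)%C. field. auto. unfold j. ring. }
  assert (Hu : u = Im z / Im tau).
  { rewrite Hz. repeat progress reim. field. lra. }
  set (Se := Slim u v tau). set (Se' := Slim u' v' tau').
  set (K := (mu * Cexp (PI * Ci * (u * v - u' * v')%R) * Csqrt j)%C).
  (* Value at the top minus value at the cusp. The former will cancel against psi (z'; tau'),
     leaving only the cusp term. *)
  assert (EI : path_integral (eichler_integrand z' tau') g = (Se' - K * Se)%C).
  { apply (path_integral_limits (IZR a / IZR c) tau' g u' v' Htau' Hg).
    - intros w Hw. now apply eichler_integrand_theta.
    - exact (limit_at_cusp a b c d tau mu u' v' g hc hdet htau Hmu Htau' Hg).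
    - exact (limit_at_top (IZR a / IZR c) tau' g u' v' Htau' Hg). }
  unfold eichler. rewrite EI, Cpower_opp_half.
  rewrite (psi_Slim z tau u v htau Hu Hz), (psi_Slim z' tau' u' v' Htau' eq_refl Hz').
  fold Se Se' u'.
  assert (Him0 : RtoC (Im tau') <> 0) by (apply RtoC_neq0; lra).
  assert (Eu2 : (PI * Ci * IZR a * (Im z' ^ 2)%R / (IZR c * (Im tau' ^ 2)%R))%C = (PI * Ci * IZR a / IZR c * (u' ^ 2)%R)%C).
  { unfold u'. unfold Rdiv. rewrite Rpow_mult_distr, RtoC_mult, pow_inv, RtoC_inv by (apply pow_nonzero; lra).
    rewrite !RtoC_pow. field. auto. }
  rewrite Eu2.
  pose proof (cusp_minus_tau' a b c d tau hc hdet htau) as Ecusp. cbv zeta in Ecusp. fold j in Ecusp. fold tau' in Ecusp.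
  (* By a/c - tau' = 1 / (c j), the two prefactors of the integral combine to the exponential that
     relates Se' to psi (z'; tau'). *)
  assert (E1 : (Cexp (PI * Ci / (IZR c * j) * (u' ^ 2)%R) * Cexp (- (PI * Ci * IZR a / IZR c * (u' ^ 2)%R)) =
     Cexp (- (PI * Ci * (u' ^ 2)%R * tau')))%C).
  { rewrite <- Cexp_plus. f_equal. unfold Cdiv at 1. rewrite <- Ecusp. field. auto. }
  assert (Hu'r : (u' ^ 2 = u' * u')%R) by ring. assert (Hur : (u ^ 2 = u * u)%R) by ring.
  (* the exponent identity  - u'^2 tau' + (u v - u' v') + u^2 tau - c z z' = 0 *)
  assert (E2 : (Cexp (- (PI * Ci * IZR c * z ^ 2 / j)) * (Cexp (- (PI * Ci * (u' ^ 2)%R * tau')) * Cexp (PI * Ci * (u * v - u' * v')%R))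
     = Cexp (- (PI * Ci * (u ^ 2)%R * tau)))%C).
  { rewrite <- !Cexp_plus. f_equal.
    assert (A1 : (u' * tau' = z' - v')%C) by (rewrite Hz'; ring).
    assert (A2 : (u * tau = z - v)%C) by (rewrite Hz; ring).
    assert (A3 : (u * z - u' * z' = IZR c * z * z')%C).
    { transitivity ((u * j - u') * z')%C. rewrite Ez at 1. ring.
      transitivity (IZR c * j * z' * z')%C. 2: rewrite Ez; ring. f_equal.
      rewrite Hz'. unfold u, tau'. rewrite RtoC_plus, !RtoC_mult.
      transitivity (IZR c * (u' * (IZR a * tau + IZR b) + v' * j) )%C. 2: field; auto.
      transitivity (IZR a * u' * j + IZR c * v' * j - u' * (IZR a * IZR d - IZR b * IZR c))%C.
      rewrite (det_C a b c d hdet). ring. unfold j. ring. }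
    rewrite Hu'r, Hur, !RtoC_mult, RtoC_minus, !RtoC_mult.
    replace (PI * Ci * (u' * u') * tau')%C with (PI * Ci * u' * (u' * tau'))%C by ring.
    replace (PI * Ci * (u * u) * tau)%C with (PI * Ci * u * (u * tau))%C by ring.
    rewrite A1, A2.
    replace (PI * Ci * IZR c * z ^ 2 / j)%C with (PI * Ci * (IZR c * z * z'))%C by (unfold z'; field; auto).
    rewrite <- A3. ring. }
  match goal with |- _ = (_ * _ * ?e * (?p1 - Ci * ?x * (?y * _)))%C =>
    transitivity (/ mu * / Csqrt j * e * (Ci * ((x * y) * (K * Se))) )%C end.
  - rewrite E1. unfold K. rewrite <- E2. field. auto.
  - rewrite E1. f_equal.
    match goal with |- _ = (?A - Ci * ?x * (?y * ?D))%C =>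
      replace (Ci * x * (y * D))%C with (Ci * (x * y) * D)%C by ring end.
    rewrite E1. ring.
Qed.
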